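(* Let $q\ge1$, $L_0>0$ and $1\le p\le\infty$ be fixed. Then for any $\vec\beta\in(0,\infty)^d$, $\vec r\in[1,\infty]^d$ and $\vec L\in[L_0,\infty)^d$ there exists $c>0$, independent of $\vec L$, such that $$\liminf_{\varepsilon\to0}\ \inf_{\tilde f_\varepsilon}\ \sup_{f\in\mathbb N_{\vec r,d}(\vec\beta,\vec L)}\delta_\varepsilon^{-\mathfrak a}\,\mathcal R^{(p)}_\varepsilon\big[\tilde f_\varepsilon;f\big]\ge c,$$ where the infimum is taken over all possible estimators.
   Context: Model. $b>0$ is fixed, $\nu_d$ is Lebesgue measure, $W$ is white noise on $\mathbb R^d$ with intensity $\nu_d$. For $\varepsilon\in(0,1)$ one observes $X_\varepsilon(g)=\int fg\,d\nu_d+\varepsilon\int g(t)W(dt)$ for all $g\in\mathbb L_2(\mathbb R^d,\nu_d)$. An estimator is any measurable function of the observation with values in $\mathbb L_p(\mathbb R^d,\nu_d)$. Functions to be estimated vanish outside $(-b,b)^d$. The risk is $\mathcal R^{(p)}_\varepsilon[\tilde f;f]=\{\mathbb E_f^{(\varepsilon)}\|\tilde f-f\|_p^q\}^{1/q}$, where $\|\cdot\|_p$ is the $\mathbb L_p$ norm over $(-b,b)^d$ (supremum norm if $p=\infty$). Anisotropic Nikolskii class. With $\Delta_{u,j}g(x)=g(x+u\mathbf e_j)-g(x)$ ($\mathbf e_j$ canonical basis vectors) and $\Delta^k_{u,j}=\Delta_{u,j}\Delta_{u,j}^{k-1}$, $\bar{\mathbb N}_{\vec r,d}(\vec\beta,\vec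 L)$ is the set of $g:\mathbb R^d\to\mathbb R$ such that for every $j=1,\dots,d$: $\|g\|_{r_j,\mathbb R^d}\le L_j$, and there is a natural number $k_j>\beta_j$ with $\|\Delta^{k_j}_{u,j}g\|_{r_j,\mathbb R^d}\le L_j|u|^{\beta_j}$ for all $u\in\mathbb R$. $\mathbb N_{\vec r,d}(\vec\beta,\vec L)=\bar{\mathbb N}_{\vec r,d}(\vec\beta,\vec L)\cap\mathbb L_2(\mathbb R^d)$ (functions vanishing outside $(-b,b)^d$). Parameters. $\frac1\beta=\sum_j\frac1{\beta_j}$, $\frac1\omega=\sum_j\frac1{\beta_jr_j}$, $L_\beta=\prod_jL_j^{1/\beta_j}$; $\tau(s)=1-1/\omega+1/(s\beta)$, $\kappa(s)=\omega(2+1/\beta)-s$ for $1\le s\le\infty$ (with $1/\infty=0$, $\kappa(\infty)=-\infty$); $p^*=[\max_jr_j]\vee p$. $$\mathfrak a=\begin{cases}\frac{\beta}{2\beta+1},&\kappa(p)>0;\\ \frac{\tau(p)}{2\tau(2)},&\kappa(p)\le0,\ \tau(p^* )>0;\\ \frac{\omega(p^*-p)}{p(p^*-\omega(2+1/\beta))},&\kappa(p)\le0,\ \tau(p^* )\le0,\ p^*>p;\\ 0,&\kappa(p)\le0,\ \tau(p^* )\le0,\ p^*=p,\end{cases}$$ (the third expression is read as $\omega/p$ if $p^*=\infty$), and $$\delta_\varepsilon=\begin{cases}L_\beta\varepsilon^2,&\kappa(p)>0;\\ L_\beta\varepsilon^2|\ln\varepsilon|,&\kappa(p)\le0,\ \tau(p^*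 )\le0;\\ L_\beta^{\frac{1-2/p}{\tau(p)}}\varepsilon^2|\ln\varepsilon|,&\kappa(p)\le0,\ \tau(p^* )>0.\end{cases}$$ *)

(* Defs.v *)
From HB Require Import structures.
From mathcomp Require Import all_boot all_order all_algebra.
From mathcomp Require Import all_classical all_reals all_analysis.

Set Implicit Arguments.
Unset Strict Implicit.
Unset Printing Implicit Defensive.
Import Order.TTheory GRing.Theory Num.Theory.
Import numFieldNormedType.Exports.

Local Open Scope classical_set_scope.
Local Open Scope ring_scope.

(* d.-tuple carries the product sigma-algebra, here the Borel sets of R^d *)
Notation Rd R d := (d.-tuple (measurableTypeR R)).

(* the library's sigma-finiteness instance on m1 \x m2 is hidden by a later,
   more specific instance on products of subprobabilities *)

Lemma sigma_finite_product_measure1 d1 d2 (T1 : measurableType d1)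
    (T2 : measurableType d2) (R : realType)
    (m1 : {sigma_finite_measure set T1 -> \bar R})
    (m2 : {sigma_finite_measure set T2 -> \bar R}) :
  sigma_finite setT (m1 \x m2)%E.
Proof.
have /sigma_finiteP[F [TF ndF Foo]] := sigma_finiteT m1.
have /sigma_finiteP[G [TG ndG Goo]] := sigma_finiteT m2.
exists (fun n => F n `*` G n).
  rewrite -setXTT TF TG predeqE => -[x y]; split.
    move=> [/= [n _ Fnx] [k _ Gky]]; exists (maxn n k) => //; split.
    - by move: x Fnx; exact/subsetPset/ndF/leq_maxl.
    - by move: y Gky; exact/subsetPset/ndG/leq_maxr.
  by move=> [n _ []/= ? ?]; split; exists n.
move=> k; have [? ?] := Foo k; have [? ?] := Goo k.
split; first exact: measurableX.
by rewrite product_measure1E// lte_mul_pinfty// ge0_fin_numE.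
Qed.

Section lebesgue_measure_Rd_step.
Context {R : realType}.

Definition cons_pair d (z : measurableTypeR R * Rd R d) : Rd R d.+1 :=
  [tuple of z.1 :: z.2].

Lemma measurable_cons_pair d :
  measurable_fun [set: measurableTypeR R * Rd R d] (@cons_pair d).
Proof. by apply: measurable_cons. Qed.

Section step.
Variables (d : nat) (mu : {sigma_finite_measure set (Rd R d) -> \bar R}).

Definition leb_step : set (Rd R d.+1) -> \bar R :=
  pushforward (lebesgue_measure \x mu)%E (@cons_pair d).

Let m : {measure set (Rd R d.+1) -> \bar R} :=
  measure_function_pushforward__canonical__measure_function_Measure
    (lebesgue_measure \x mu)%E (@measurable_cons_pair d).

HB.instance Definition _ := isMeasure.Build _ _ _ leb_step
  (measure0 m) (measure_ge0 m) (@measure_semi_sigma_additive _ _ _ m).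

Let leb_step_sigma_finite : sigma_finite setT leb_step.
Proof.
have [F UF mF] := sigma_finite_product_measure1 lebesgue_measure mu.
pose h (t : Rd R d.+1) : measurableTypeR R * Rd R d :=
  (thead t, [tuple of behead t]).
have mh : measurable_fun setT h.
  apply/measurable_fun_pairP; split; first exact: (measurable_tnth ord0).
  exact: measurable_behead.
exists (fun n => h @^-1` F n).
  by rewrite -preimage_bigcup -UF preimage_setT.
move=> n; split; first by rewrite -[X in measurable X]setTI; exact: mh (mF n).1.
rewrite /leb_step /pushforward -comp_preimage.
rewrite (_ : h \o @cons_pair d = id) ?preimage_id; first exact: (mF n).2.
apply/funext => -[x t] /=; rewrite /h /cons_pair/= theadE; congr pair.
exact: val_inj.
Qed.

HB.instance Definition _ :=
  Measure_isSigmaFinite.Build _ _ _ leb_step leb_step_sigma_finite.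

End step.
End lebesgue_measure_Rd_step.

Fixpoint lebesgue_measure_Rd {R : realType} (d : nat) :
    {sigma_finite_measure set (Rd R d) -> \bar R} :=
  match d with
  | 0 => dirac [tuple]
  | d'.+1 => leb_step (lebesgue_measure_Rd d')
  end.

Lemma le1_2e {R : realType} : (1 <= 2%:E :> \bar R)%E.
Proof. by rewrite lee_fin ler1n. Qed.

(* square-integrable functions on R^d (not their a.e.-classes) *)
Notation L2 R d := (LfunType (@lebesgue_measure_Rd R d) (@le1_2e R)).

Section white_noise_model.
Context {R : realType} (d : nat).
Context (dO : measure_display) (Omega : measurableType dO).
Variable P : probability Omega R.
Implicit Types (W : set (Rd R d) -> Omega -> R) (A : set (Rd R d)).
Local Notation nu := (lebesgue_measure_Rd d).

(* N(0, v); normal_prob with zero deviation is the uniform law on [0, 1] *)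
Definition centered_normal (v : R) : set R -> \bar R :=
  if v == 0 then dirac (0 : R) else normal_prob 0 (Num.sqrt v).

Definition finite_measure_set A := measurable A /\ (nu A < +oo)%E.

(* Gaussian independently scattered random measure with intensity nu *)
Definition white_noise W :=
  [/\ forall A, finite_measure_set A -> measurable_fun setT (W A),
      forall A (B : set R), finite_measure_set A -> measurable B ->
        P (W A @^-1` B) = centered_normal (fine (nu A)) B,
      forall n (A : 'I_n -> set (Rd R d)) (B : 'I_n -> set R),
        (forall i, finite_measure_set (A i)) -> trivIset setT A ->
        (forall i, measurable (B i)) ->
        P [set w | forall i, B i (W (A i) w)] =
        (\prod_(i < n) P (W (A i) @^-1` B i))%E &
      forall A A', finite_measure_set A -> finite_measure_set A' ->
        A `&` A' = set0 ->
        {ae P, forall w, W (A `|` A') w = W A w + W A' w}].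

(* Z is the L2(P)-limit of integrals of step functions approximating g *)
Definition wiener_integral W (g : Rd R d -> R) (Z : Omega -> R) :=
  measurable_fun setT Z /\
  forall e : R, 0 < e ->
  exists n (a : 'I_n -> R) (A : 'I_n -> set (Rd R d)),
    [/\ forall i, finite_measure_set (A i), trivIset setT A,
        ('N[nu]_2%:E[EFin \o (fun x => g x - \sum_(i < n) a i * \1_(A i) x)%R]
          < e%:E)%E &
        ('N[P]_2%:E[EFin \o (fun w => Z w - \sum_(i < n) a i * W (A i) w)%R]
          < e%:E)%E].

(* the process (X(g)) indexed by all g in L2; estimators see it through the
   sigma-algebra generated by its coordinates *)
Definition observation := L2 R d -> R.

Definition cylinder : set (set observation) :=
  <<s \bigcup_(g in [set: L2 R d])
        preimage_set_system setT (fun x : observation => x g) measurable >>.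

Definition observe (Wint : L2 R d -> Omega -> R) (eps : R) (f : Rd R d -> R)
    (w : Omega) : observation :=
  fun g => (\int[nu]_t (f t * g t)) + eps * Wint g w.

(* For p = +oo, 'N[nu]_p is the essential supremum. The pointwise supremum is not
   compatible with the a.e.-defined constraints of the functional class: when
   all r_j are finite, the class contains arbitrarily high spikes at one point. *)
Section estimators.
Variables (p : \bar R) (p1 : (1 <= p)%E).

Definition Lp_open (U : set (LfunType nu p1)) :=
  forall g, U g -> exists2 e : R, 0 < e &
    forall h : LfunType nu p1, ('N[nu]_p[EFin \o (h \- g)%R] < e%:E)%E -> U h.

(* Borel measurability for the topology of the L_p (semi)norm *)
Definition estimator (T : observation -> LfunType nu p1) :=
  forall B, <<s Lp_open >> B -> cylinder (T @^-1` B).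

Definition cube (b : R) : set (Rd R d) :=
  [set x | forall j, - b < (tnth x j : R) < b].

Definition risk Wint (b eps q : R) (T : observation -> LfunType nu p1) f :=
  ((\int[P]_w 'N[nu]_p[(EFin \o (T (observe Wint eps f w) \- f)%R) \_ (cube b)]
      `^ q) `^ q^-1)%E.

End estimators.
End white_noise_model.
Arguments cube {R d} b.

Section nikolskii.
Context {R : realType} (d : nat).
Implicit Types (g : Rd R d -> R) (beta L : 'I_d -> R) (r : 'I_d -> \bar R).
Local Notation nu := (lebesgue_measure_Rd d).

Definition shift (u : R) (j : 'I_d) (x : Rd R d) : Rd R d :=
  [tuple (tnth x i : R) + u * (i == j)%:R | i < d].

Definition Delta (u : R) (j : 'I_d) g : Rd R d -> R :=
  fun x => g (shift u j x) - g x.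

Definition nikolskii_bar beta r L : set (Rd R d -> R) :=
  [set g | forall j,
     ('N[nu]_(r j)[EFin \o g] <= (L j)%:E)%E /\
     exists2 k : nat, beta j < k%:R &
       forall u : R, ('N[nu]_(r j)[EFin \o iter k (Delta u j) g]
                      <= (L j * `|u| `^ beta j)%:E)%E].

Definition nikolskii (b : R) beta r L : set (Rd R d -> R) :=
  [set g | [/\ nikolskii_bar beta r L g, g \in Lfun nu 2%:E &
                forall x, ~ cube b x -> g x = 0]].

End nikolskii.

Section rate.
Context {R : realType} (d : nat) (beta : 'I_d -> R) (r : 'I_d -> \bar R).
Implicit Types s p : \bar R.

Definition inv_beta : R := \sum_(j < d) (beta j)^-1.
Definition beta_mean : R := inv_beta^-1.

Definition inv_omega : R := \sum_(j < d) (beta j)^-1 * fine (r j)^-1%E.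
(* +oo when all the r j are +oo *)
Definition omega : \bar R := (inv_omega%:E^-1)%E.

Definition L_beta (L : 'I_d -> R) : R := \prod_(j < d) L j `^ (beta j)^-1.

Definition tau s : R := 1 - inv_omega + fine s^-1%E * inv_beta.

Definition kappa s : \bar R :=
  (if s == +oo then -oo else omega * (2 + inv_beta)%:E - s)%E.

Definition pstar p : \bar R := maxe (\big[maxe/-oo%E]_(j < d) r j) p.

(* when omega is read with fine below, inv_omega >= 1 because tau (pstar p) <= 0 *)
Definition rate_exponent p : R :=
  if (0 < kappa p)%E then beta_mean / (2 * beta_mean + 1)
  else if 0 < tau (pstar p) then tau p / (2 * tau 2%:E)
  else if (p < pstar p)%E then
    if pstar p == +oo%E then fine omega / fine p
    else fine omega * (fine (pstar p) - fine p) /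
         (fine p * (fine (pstar p) - fine omega * (2 + inv_beta)))
  else 0.

Definition delta p (L : 'I_d -> R) (eps : R) : R :=
  if (0 < kappa p)%E then L_beta L * eps ^+ 2
  else if tau (pstar p) <= 0 then L_beta L * eps ^+ 2 * `|ln eps|
  else L_beta L `^ ((1 - 2 * fine p^-1%E) / tau p) * eps ^+ 2 * `|ln eps|.

End rate.

(* Main.v *)
From HB Require Import structures.
Require Import Defs.
From mathcomp Require Import all_boot all_order all_algebra.
From mathcomp Require Import all_classical all_reals all_analysis.
From mathcomp Require Import ess_sup_inf measurable_realfun lra.
Set Implicit Arguments.
Unset Strict Implicit.
Unset Printing Implicit Defensive.
Import Order.TTheory GRing.Theory Num.Theory.
Import numFieldNormedType.Exports.
Local Open Scope classical_set_scope.
Local Open Scope ring_scope.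

(** The lower bound rests on a family of sparse bump sums that no estimator can
decode.

Cut (-b, b)^d into cells with sides h_1, ..., h_d <= 1 and volume V, and group some
of them into S blocks of n cells. For each choice m of one cell per block, let
f_m be A times the sum of the S smooth bumps standing on the chosen cells
(bump_sum). The bumps have disjoint supports, so f_m lives on a set of measure
about rho = S * V; its r_j-norm is about A * rho^(1/r_j), and a k-th difference
with step u in direction j multiplies this by (|u|/h_j)^k. Hence f_m is in the
Nikolskii class as soon as C * A * rho^(1/r_j) <= L_j * h_j^beta_j for all j
(nikolskii_bump_sum).

Look at one block, everything outside it being fixed. The events that the
estimator is closer to the k-th bump, in the L_p norm of the block, than half
the distance between two bumps are disjoint in k. If the bump of this block is
erased from the signal, the law of the observation does not depend on the active
cell k, so the average over k of the probabilities of these events is at most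
1/n. Putting the bump back shifts the white noise by a function h with
|h|_2^2 <= A^2 * V / eps^2, and such a shift satisfies, for every lam > 0,

  2 * P_h(E) <= lam * P_0(E) + exp(|h|_2^2) / lam        (observe_shift_event).

With lam = n/4 and exp(A^2 * V / eps^2) <= n/16, the active cell is found with
average probability at most 1/4. Averaging over m, some f_m leaves on average at
least 3/4 of the blocks undecoded, hence at least half of them with probability
at least 1/2 by the Markov inequality, and then the L_p error is at least of
order A * rho^(1/p) (minimax_bumps).

The shift inequality is an L_2 bound on the likelihood ratio. It is explicit for
a normal law, tensorizes, and so holds for white noise on disjoint sets; finite
families of sets are reduced to their atoms, the cost of the shift being bounded
by the Bessel inequality (white_noise_shift). It passes to Lipschitz functions of
finitely many Wiener integrals by L_2 approximation, and to all cylinder events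
because the events that such functions approximate form a sigma-algebra
(approximable_cylinder).

It remains to make A * rho^(1/p) as large as the constraints allow. Equality in
the smoothness constraints determines h_j, and V is then a constant times
A^(1/beta) * rho^(1/omega) / L_beta. In logarithmic scale the remaining
constraints h_j <= min(1, b), V <= rho and exp(A^2 * V / eps^2) <= b^d / (32 * rho)
are linear except for the last one (risk_lower_bound). The four regimes of the
rate are the possible sets of active constraints:
- rho is constant and A^2 * V = eps^2 (dense_rate);
- one block, rho = V, and A^2 * V of order eps^2 * |ln eps| (sparse_rate);
- A * rho^s is constant for s = 1 / p*, the bumps being as high as the largest
  integrability index p* permits, and A^2 * V of order eps^2 * |ln eps|
  (intermediate_rate);
- A * rho^(1/p) is constant while rho goes to 0, so that the risk does not vanish
  (inconsistency_rate). *)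

(** * Boxes and norms of possibly non-measurable functions *)

Section boxes.
Context {R : realType}.

Definition cbox d (lo hi : 'I_d -> R) : set (Rd R d) :=
  [set x | forall j, lo j <= (tnth x j : R) <= hi j].

Lemma measurable_cbox d (lo hi : 'I_d -> R) : measurable (cbox lo hi).
Proof.
rewrite (_ : cbox lo hi =
  \bigcap_(j in [set: 'I_d]) ((fun x : Rd R d => tnth x j) @^-1` `[lo j, hi j])).
  apply: fin_bigcap_measurable; first exact: finite_finset.
  move=> j _; rewrite -[X in measurable X]setTI.
  by apply: measurable_tnth => //; exact: measurable_itv.
apply/seteqP; split => x /= h j; first by move=> _ /=; rewrite in_itv/=.
by have := h j I; rewrite /= in_itv.
Qed.

Lemma lebesgue_cbox d (lo hi : 'I_d -> R) : (forall j, lo j <= hi j) ->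
  lebesgue_measure_Rd d (cbox lo hi) = (\prod_j (hi j - lo j))%:E.
Proof.
elim: d lo hi => [|d IH] lo hi lohi.
  rewrite big_ord0 /= diracE mem_set// => -[].
  by case.
rewrite big_ord_recl EFinM /=.
transitivity ((lebesgue_measure \x lebesgue_measure_Rd d)%E
   (`[lo ord0, hi ord0] `*` cbox (fun j => lo (lift ord0 j)) (fun j => hi (lift ord0 j)))).
  rewrite /leb_step /pushforward; congr (_ _).
  apply/seteqP; split => -[x t] /=.
    move=> h; split => /=.
      by have := h ord0; rewrite in_itv/= (tnth_nth 0).
    by move=> j; have := h (lift ord0 j); rewrite tnthS.
  rewrite in_itv/= => -[h1 h2] j.
  by case: (unliftP ord0 j) => [k|] ->; rewrite ?tnthS//; exact: h2.
rewrite product_measure1E//; last exact: measurable_cbox.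
rewrite IH//; congr (_ * _)%E.
apply: etrans; first exact: (lebesgue_measure_itv `[lo ord0, hi ord0]).
rewrite /= lte_fin.
have := lohi ord0; rewrite le_eqVlt => /orP[/eqP ->|->]; last by [].
by rewrite ltxx subrr.
Qed.

End boxes.

Lemma ge0_le_poweR (R : realType) (x y : \bar R) (r : R) :
  0 <= r -> (0 <= x -> x <= y -> x `^ r <= y `^ r)%E.
Proof.
move=> r0 x0 xy; apply: gt0_ler_poweR; rewrite ?in_itv/= ?leey ?andbT//.
exact: le_trans xy.
Qed.

Section Lnorm_bounds.
Local Open Scope ereal_scope.
Context d (T : measurableType d) (R : realType).
Variable mu : {measure set T -> \bar R}.

(** The integral of a nonnegative function is a supremum over the simple functions
below it, so that monotonicity holds without measurability. The risk can thus
be bounded below without proving that the error of the estimator is measurable. *)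
Lemma le_integral_nonmeasurable (f g : T -> \bar R) :
  (forall x, 0 <= f x) -> (forall x, f x <= g x) ->
  \int[mu]_x f x <= \int[mu]_x g x.
Proof.
move=> f0 fg; have g0 x : 0 <= g x by exact: le_trans (fg x).
rewrite !ge0_integralTE//; apply: le_ereal_sup => _ [h /= hf <-].
by exists h => //= x; exact: le_trans (fg x).
Qed.

Lemma Lnorm_le_nonmeasurable (f g : T -> R) (r : \bar R) : 1 <= r ->
  (forall x, `|f x| <= `|g x|)%R -> 'N[mu]_r[EFin \o f] <= 'N[mu]_r[EFin \o g].
Proof.
move=> r1 fg; rewrite unlock; case: r r1 => [r|_|//].
  rewrite lee_fin => r1; have r0 : (0 <= r)%R by exact: le_trans r1.
  apply: ge0_le_poweR; first by rewrite invr_ge0.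
    by apply: integral_ge0 => x _; exact: poweR_ge0.
  apply: le_integral_nonmeasurable => x; first exact: poweR_ge0.
  by apply: ge0_le_poweR; rewrite ?abse_ge0//= lee_fin.
case: ifPn => // _; apply: le_ess_sup; apply: nearW => x /=.
by rewrite lee_fin.
Qed.

Lemma Lnorm_indic_cst (D : set T) (M : R) (r : \bar R) : 1 <= r ->
  measurable D -> 0 < mu D < +oo -> (0 <= M)%R ->
  'N[mu]_r[EFin \o (fun x => M * \1_D x)%R] =
  M%:E * (mu D `^ (fine r^-1)).
Proof.
move=> r1 mD /andP[D0 Doo] M0; rewrite unlock; case: r r1 => [r|_|//].
  rewrite lee_fin => r1; have r0 : (0 < r)%R by exact: lt_le_trans r1.
  have rE : (r%:E^-1 = (r^-1)%:E) by rewrite inver gt_eqF.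
  rewrite rE /=.
  rewrite (eq_integral (fun x => (M `^ r)%:E * (\1_D x)%:E)); last first.
    move=> x _ /=.
    rewrite ger0_norm ?mulr_ge0// powRM// indicE; case: (_ \in _) => /=.
      by rewrite powR1 mule1 mulr1.
    by rewrite powR0 ?gt_eqF// mulr0 mule0.
  rewrite ge0_integralZl//; last 2 first.
  - by apply/measurable_EFinP; exact: measurable_indic.
  - by rewrite lee_fin powR_ge0.
  rewrite integral_indic// setIT.
  rewrite poweRM//; last by rewrite lee_fin powR_ge0.
  by rewrite /= -powRrM mulfV ?gt_eqF// powRr1.
rewrite (_ : mu [set: T] > 0); last first.
  by apply: (lt_le_trans D0); apply: le_measure; rewrite ?inE.
rewrite invey /= poweRe0 mule1.
apply/eqP; rewrite eq_le; apply/andP; split.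
  apply/ess_supP; apply: nearW => x /=.
  rewrite lee_fin ger0_norm ?mulr_ge0// indicE; case: (_ \in _) => /=.
    by rewrite mulr1.
  by rewrite mulr0.
apply: le_ereal_inf_tmp => y /= [N [mN N0 DN]].
rewrite leNgt; apply/negP => yM.
have : mu D <= mu N.
  apply: le_measure; rewrite ?inE// => x Dx; apply: DN => /=.
  rewrite indicE mem_set// mulr1 ger0_norm//.
  by move=> h; have := lt_le_trans yM h; rewrite ltxx.
by rewrite N0 leNgt D0.
Qed.

End Lnorm_bounds.

Section Lnorm_supports.
Local Open Scope ereal_scope.
Context d (T : measurableType d) (R : realType).
Variable mu : {measure set T -> \bar R}.

Lemma le_of_poweR_le (x y : \bar R) (p : R) :
  (0 < p)%R -> 0 <= x -> 0 <= y -> x `^ p <= y `^ p -> x <= y.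
Proof.
move=> p0 x0 y0 h; rewrite -(poweRe1 x0) -(poweRe1 y0) -(@mulfV _ p) ?gt_eqF//.
by rewrite !poweRrM ge0_le_poweR// ?invr_ge0 ?(ltW p0)// poweR_ge0.
Qed.

Lemma fine_inv_ge0 (r : \bar R) : 1 <= r -> (0 <= fine r^-1)%R.
Proof.
move=> r1; apply: fine_ge0; rewrite inve_ge0.
exact: le_trans r1.
Qed.

Lemma Lnorm_le_support (f : T -> R) (D : set T) (M m : R) (r : \bar R) : 1 <= r ->
  measurable D -> 0 < mu D <= m%:E -> (0 <= M)%R ->
  (forall x, `|f x| <= M)%R -> (forall x, ~ D x -> f x = 0%R) ->
  'N[mu]_r[EFin \o f] <= (M * m `^ (fine r^-1))%:E.
Proof.
move=> r1 mD /andP[D0 Dm] M0 fM f0.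
apply: (@le_trans _ _ ('N[mu]_r[EFin \o (fun x => M * \1_D x)%R])).
  apply: Lnorm_le_nonmeasurable => // x.
  rewrite indicE; case: (boolP (x \in D)) => [_|].
    by rewrite mulr1 (ger0_norm M0).
  by rewrite notin_setE => /f0 ->; rewrite normr0 normr_ge0.
rewrite Lnorm_indic_cst// ?D0 ?(le_lt_trans Dm) ?ltry//.
rewrite EFinM; apply: lee_wpmul2l; rewrite ?lee_fin//.
by rewrite -poweR_EFin ge0_le_poweR ?fine_inv_ge0// ltW.
Qed.

Lemma Lnorm_ge_support (f : T -> R) (D : set T) (M m : R) (r : \bar R) : 1 <= r ->
  measurable D -> (0 < m)%R -> m%:E <= mu D < +oo -> (0 <= M)%R ->
  (forall x, D x -> M <= `|f x|)%R ->
  (M * m `^ (fine r^-1))%:E <= 'N[mu]_r[EFin \o f].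
Proof.
move=> r1 mD m0 /andP[Dm Doo] M0 fM.
apply: (@le_trans _ _ ('N[mu]_r[EFin \o (fun x => M * \1_D x)%R])); last first.
  apply: Lnorm_le_nonmeasurable => // x.
  rewrite indicE; case: (boolP (x \in D)) => [|_].
    by rewrite inE mulr1 (ger0_norm M0) => /fM.
  by rewrite mulr0 normr0.
rewrite Lnorm_indic_cst// ?Doo ?andbT; last by rewrite (lt_le_trans _ Dm).
rewrite EFinM; apply: lee_wpmul2l; rewrite ?lee_fin//.
by rewrite -poweR_EFin ge0_le_poweR ?fine_inv_ge0// lee_fin ltW.
Qed.

(** For finite p the p-th powers of the norms over disjoint blocks add up; for
p = +oo a single block suffices, and #|K| to the power 0 is 1. *)
Lemma Lnorm_blocks_ge (u : T -> R) (I : finType) (B : I -> set T) (C : set T)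
    (p : \bar R) (a : R) (K : {set I}) : 1 <= p ->
  measurable_fun setT u -> (forall i, measurable (B i)) ->
  trivIset setT B -> (forall i, B i `<=` C) -> (0 <= a)%R ->
  (forall i, i \in K -> a%:E <= 'N[mu]_p[EFin \o (fun x => u x * \1_(B i) x)%R]) ->
  (0 < #|K|)%N ->
  (a * #|K|%:R `^ fine p^-1)%:E <= 'N[mu]_p[(EFin \o u) \_ C].
Proof.
move=> p1 mu_ mB tB BC a0 aK K0.
have -> : (EFin \o u) \_ C = EFin \o (fun x => u x * \1_C x)%R.
  apply/funext => x /=; rewrite patchE indicE; case: ifP => _ /=; first by rewrite mulr1.
  by rewrite mulr0.
case: p p1 aK => [p|_|//].
  rewrite lee_fin => p1 aK; have p0 : (0 < p)%R by exact: lt_le_trans p1.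
  rewrite inver gt_eqF//=; apply: (le_of_poweR_le p0) => //.
  - by rewrite lee_fin mulr_ge0// powR_ge0.
  - exact: Lnorm_ge0.
  rewrite powR_Lnorm ?gt_eqF// poweR_EFin powRM ?powR_ge0//.
  rewrite -powRrM mulVf ?gt_eqF// powRr1//.
  pose F i := fun x => (`|u x * \1_(B i) x| `^ p)%:E.
  apply: (@le_trans _ _ (\int[mu]_x (\sum_(i <- enum K) F i x))).
    rewrite ge0_integral_sum//; last 2 first.
    - move=> i; apply/measurable_EFinP; apply: (measurableT_comp (measurable_powR p)).
      by apply: measurableT_comp => //; apply: measurable_funM => //; exact: measurable_indic.
    - by move=> i x _; rewrite lee_fin powR_ge0.
    rewrite big_enum/=; apply: (@le_trans _ _ (\sum_(i in K) (a%:E `^ p))).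
      by rewrite sumEFin lee_fin sumr_const mulr_natr.
    apply: lee_sum => i iK.
    rewrite -[leRHS](@powR_Lnorm _ _ _ mu (EFin \o (fun x => u x * \1_(B i) x)%R)) ?gt_eqF//.
    by apply: ge0_le_poweR; rewrite ?(ltW p0) ?lee_fin ?aK.
  apply: le_integral_nonmeasurable => x; rewrite big_enum/=.
    by apply: sume_ge0 => i _; rewrite lee_fin powR_ge0.
  have [[i [iK Bix]]|nB] := pselect (exists i, i \in K /\ B i x).
    rewrite (bigD1 i)//= big1 ?adde0.
      rewrite /F /= !indicE !mem_set//; exact: (BC i).
    move=> j /andP[jK ji]; rewrite /F indicE.
    case: (boolP (x \in B j)) => [/set_mem Bjx|_].
      by move: ji; rewrite (tB j i)// ?eqxx//; exists x.
    by rewrite mulr0 normr0 powR0 ?gt_eqF.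
  rewrite big1 ?poweR_ge0// => i iK; rewrite /F indicE memNset ?mulr0 ?normr0 ?powR0 ?gt_eqF//.
  by move=> Bix; apply: nB; exists i.
rewrite invey /= => aK; rewrite powRr0 mulr1.
have /card_gt0P[i iK] := K0.
apply: (le_trans (aK i iK)).
apply: Lnorm_le_nonmeasurable; [by rewrite leey|move=> x].
rewrite !indicE; case: (boolP (x \in B i)) => [/set_mem/BC Cx|_].
  by rewrite mem_set.
by rewrite mulr0 normr0.
Qed.

End Lnorm_supports.

(** * Quasi-invariance of Gaussian laws under shifts *)

Section quasi_invariance.
Local Open Scope ereal_scope.
Context d (T : measurableType d) (R : realType).

(** The function l is the density, with respect to mu, of the image of mu under
theta. Its second moment is at most K, which is all that the shift inequality uses. *)
Definition quasi_invariant (mu : set T -> \bar R) (theta : T -> T) (K : R) :=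
  exists l : T -> R, [/\ measurable_fun setT l, forall x, (0 <= l x)%R,
    forall psi : T -> \bar R, measurable_fun setT psi -> (forall x, 0 <= psi x) ->
      \int[mu]_x psi (theta x) = \int[mu]_x (psi x * (l x)%:E) &
    \int[mu]_x (l x ^+ 2)%:E <= K%:E].

End quasi_invariance.

Section gaussian_shift.
Local Open Scope ereal_scope.
Context (R : realType).
Local Notation leb := (@lebesgue_measure R).

Lemma integral_normal_prob (m s : R) (psi : R -> \bar R) :
  measurable_fun setT psi -> (forall x, 0 <= psi x) ->
  \int[normal_prob m s]_x psi x = \int[leb]_x (psi x * (normal_pdf m s x)%:E).
Proof.
move=> mpsi psi0.
have dom := normal_prob_dominates m s.
rewrite -(Radon_Nikodym_SigmaFinite.change_of_variables dom)//.
apply: ae_eq_integral => //.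
- apply: emeasurable_funM => //.
  exact: measurable_int (Radon_Nikodym_SigmaFinite.f_integrable dom).
- by apply: emeasurable_funM => //; apply/measurable_EFinP; exact: measurable_normal_pdf.
have : ae_eq leb setT (Radon_Nikodym_SigmaFinite.f (normal_prob m s) leb)
    (fun x => (normal_pdf m s x)%:E).
  apply: integral_ae_eq => //.
  - exact: Radon_Nikodym_SigmaFinite.f_integrable.
  - by apply/measurable_EFinP; exact: measurable_normal_pdf.
  - by move=> E _ mE; rewrite -Radon_Nikodym_SigmaFinite.f_integral.
by apply: filterS => x /= /(_ I) ->.
Qed.

Lemma lebesgue_integral_shift (c : R) (psi : R -> \bar R) :
  measurable_fun setT psi -> (forall x, 0 <= psi x) ->
  \int[leb]_x psi (x + c)%R = \int[leb]_x psi x.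
Proof.
move=> mpsi psi0.
have mc : measurable_fun setT (fun x : measurableTypeR R => (x + c)%R : measurableTypeR R).
  exact: measurable_funD.
pose m := measure_function_pushforward__canonical__measure_function_Measure leb mc.
transitivity (\int[m]_x psi x).
  by rewrite ge0_integral_pushforward.
apply: eq_measure_integral => A mA _; apply/esym.
apply: lebesgue_measure_unique => // X [[a b] _ <-] /=.
rewrite /pushforward.
rewrite (_ : (fun x : R => (x + c)%R) @^-1` `]a, b]%classic = `](a - c)%R, (b - c)%R]%classic).
  have H x y := lebesgue_measure_itv (Interval (BRight x) (BRight y) : interval R).
  rewrite !H /= !lte_fin ltrD2r; case: ifP => // _.
  by rewrite -!EFinB; congr EFin; rewrite opprB addrA subrK.
by apply/seteqP; split => x; rewrite /= !in_itv/= ltrBlDr lerBrDr.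
Qed.

(** The likelihood ratio at x is exp((2 c x - c^2) / (2 s^2)); the second moment
is exp(c^2 / s^2) because its square is the same constant times the density
ratio for the shift 2c. *)
Lemma quasi_invariant_normal (s c : R) : (s != 0)%R ->
  quasi_invariant (normal_prob 0 s) (fun x : R => (x + c)%R) (expR (c ^+ 2 / s ^+ 2)).
Proof.
move=> s0; pose l x := expR ((2 * c * x - c ^+ 2) / (s ^+ 2 *+ 2)).
have ml : measurable_fun setT l.
  apply: measurableT_comp => //; apply: measurable_funM => //.
  by apply: measurable_funB => //; exact: measurable_funM.
exists l; split => //.
- by move=> x; exact: expR_ge0.
- move=> psi mpsi psi0.
  have mpsic : measurable_fun setT (fun x : R => psi (x + c)%R).
    by apply: measurableT_comp => //; exact: measurable_funD.
  rewrite integral_normal_prob//.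
  rewrite integral_normal_prob//; last 2 first.
  + by apply: emeasurable_funM => //; exact/measurable_EFinP.
  + by move=> x; rewrite mule_ge0// lee_fin expR_ge0.
  rewrite -[RHS](lebesgue_integral_shift c); last 2 first.
  + apply: emeasurable_funM; last by apply/measurable_EFinP; exact: measurable_normal_pdf.
    by apply: emeasurable_funM => //; exact/measurable_EFinP.
  + by move=> x; rewrite mule_ge0 ?lee_fin ?normal_pdf_ge0// mule_ge0// lee_fin expR_ge0.
  apply: eq_integral => x _; rewrite -muleA; congr (_ * _).
  rewrite -EFinM normal_pdfE// mulrCA; congr (_ * _)%:E.
  rewrite /normal_fun /l -expRD; congr expR.
  rewrite !subr0 -mulrDl; congr (_ / _)%R.
  lra.
- rewrite integral_normal_prob//; last 2 first.
  + by apply/measurable_EFinP; exact: measurable_funX.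
  + by move=> x; rewrite lee_fin sqr_ge0.
  rewrite [leLHS](_ : _ =
    \int[leb]_x ((expR (c ^+ 2 / s ^+ 2))%:E * (normal_pdf (2 * c) s x)%:E)).
    rewrite ge0_integralZl//.
    - by rewrite integral_normal_pdf mule1.
    - by apply/measurable_EFinP; exact: measurable_normal_pdf.
    - by move=> *; rewrite lee_fin ?normal_pdf_ge0 ?expR_ge0.
  apply: eq_integral => x _; rewrite -!EFinM !normal_pdfE//; congr EFin.
  rewrite mulrCA [RHS]mulrCA; congr (_ * _)%R.
  rewrite /normal_fun /l -expRM_natl -!expRD; congr expR.
  have s2 : (s ^+ 2 *+ 2 != 0)%R by rewrite mulrn_eq0/= sqrf_eq0.
  rewrite mulr_natl.
  have -> : (c ^+ 2 / s ^+ 2 = (2 * c ^+ 2) / (s ^+ 2 *+ 2))%R.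
    by rewrite -[(s ^+ 2 *+ 2)%R]mulr_natl [in RHS]invfM [RHS]mulrACA mulfV ?mul1r// pnatr_eq0.
  rewrite -!mulrnAl -!mulrDl; congr (_ / _)%R.
  lra.
Qed.

(** The law centered_normal v, packed as a probability. *)
Definition gaussian (v : R) : probability (measurableTypeR R) R :=
  if (v == 0)%R then (dirac (0%R : measurableTypeR R) : probability _ _)
  else (normal_prob 0 (Num.sqrt v) : probability _ _).

Lemma gaussianE v : gaussian v = centered_normal v :> (set R -> \bar R).
Proof. by rewrite /gaussian /centered_normal; case: ifP. Qed.

Lemma quasi_invariant_gaussian (v c : R) : (0 <= v)%R -> (v = 0 -> c = 0)%R ->
  quasi_invariant (gaussian v) (fun x : R => (x + c)%R) (expR (c ^+ 2 / v)).
Proof.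
move=> v0 vc; rewrite /gaussian; case: ifPn => [/eqP/[dup] v00/vc ->|vN].
  exists (cst 1%R); split => //.
  - by move=> psi _ _; apply: eq_integral => x _; rewrite addr0 mule1.
  - rewrite (eq_integral (cst 1)); last by move=> x _ /=; rewrite expr1n.
    by rewrite integral_cst// mul1e /= diracE in_setT expr0n mul0r expR0.
rewrite -[X in (_ / X)%R](@sqr_sqrtr _ v)//.
by apply: quasi_invariant_normal; rewrite sqrtr_eq0 -ltNge lt_neqAle eq_sym vN.
Qed.

End gaussian_shift.

Section quasi_invariant_product.
Local Open Scope ereal_scope.
Context d1 d2 (T1 : measurableType d1) (T2 : measurableType d2) (R : realType).
Variables (mu1 : probability T1 R) (mu2 : probability T2 R).

Lemma quasi_invariant_prod (th1 : T1 -> T1) (th2 : T2 -> T2) (K1 K2 : R) :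
  measurable_fun setT th1 -> measurable_fun setT th2 ->
  quasi_invariant mu1 th1 K1 -> quasi_invariant mu2 th2 K2 ->
  quasi_invariant (mu1 \x mu2) (fun z => (th1 z.1, th2 z.2)) (K1 * K2).
Proof.
move=> mth1 mth2 [l1 [ml1 l10 l1E l1K]] [l2 [ml2 l20 l2E l2K]].
have mm : measurable_fun setT (fun z : T1 * T2 => l1 z.1 * l2 z.2)%R.
  by apply: measurable_funM; [exact: measurableT_comp ml1 _|exact: measurableT_comp ml2 _].
exists (fun z => l1 z.1 * l2 z.2)%R; split => //.
- by move=> z; rewrite mulr_ge0.
- move=> psi mpsi psi0.
  have mth : measurable_fun setT (fun z : T1 * T2 => (th1 z.1, th2 z.2)).
    by apply/measurable_fun_pairP; split;
      [exact: measurableT_comp mth1 _|exact: measurableT_comp mth2 _].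
  have mpsith : measurable_fun setT (fun z : T1 * T2 => psi (th1 z.1, th2 z.2)).
    exact: measurableT_comp mpsi mth.
  have mpsi1 : measurable_fun setT (fun z : T1 * T2 => psi (th1 z.1, z.2)).
    apply: measurableT_comp mpsi _; apply/measurable_fun_pairP.
    by split; [exact: measurableT_comp mth1 _|exact: measurable_snd].
  have mL2 : measurable_fun setT (fun z : T1 * T2 => (l2 z.2)%:E).
    by apply/measurable_EFinP; exact: measurableT_comp ml2 _.
  have mL1 : measurable_fun setT (fun z : T1 * T2 => (l1 z.1)%:E).
    by apply/measurable_EFinP; exact: measurableT_comp ml1 _.
  apply: etrans; first exact: (@fubini_tonelli1 _ _ _ _ _ mu1 mu2 _ mpsith).
  transitivity (\int[mu1]_x \int[mu2]_y (psi (th1 x, y) * (l2 y)%:E)).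
    apply: eq_integral => x _; rewrite /fubini_F /=.
    rewrite (l2E (fun y => psi (th1 x, y)))//.
    exact: measurableT_comp mpsi (measurable_pair1 _).
  rewrite (@fubini_tonelli _ _ _ _ _ mu1 mu2 (fun z => psi (th1 z.1, z.2) * (l2 z.2)%:E))/=; last 2 first.
  - exact: emeasurable_funM.
  - by move=> z; rewrite mule_ge0// lee_fin.
  apply/esym; apply: etrans; first apply: (@fubini_tonelli2 _ _ _ _ _ mu1 mu2).
  - by apply: emeasurable_funM => //; apply/measurable_EFinP.
  - by move=> z; rewrite mule_ge0// lee_fin mulr_ge0.
  apply/esym; apply: eq_integral => y _; rewrite /fubini_G/=.
  rewrite ge0_integralZr//; last 2 first.
  - exact: measurableT_comp mpsi1 (measurable_pair2 _).
  - by rewrite lee_fin.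
  rewrite (l1E (fun x => psi (x, y)))//; last first.
    exact: measurableT_comp mpsi (measurable_pair2 _).
  rewrite -ge0_integralZr//; last 3 first.
  - apply: emeasurable_funM; last exact/measurable_EFinP.
    exact: measurableT_comp mpsi (measurable_pair2 _).
  - by move=> x _; rewrite mule_ge0// lee_fin.
  - by rewrite lee_fin.
  by apply: eq_integral => x _; rewrite -muleA EFinM.
- apply: (@le_trans _ _ (\int[mu1]_x \int[mu2]_y ((l1 x * l2 y) ^+ 2)%:E)).
    rewrite le_eqVlt; apply/orP; left; apply/eqP.
    apply: (@fubini_tonelli1 _ _ _ _ _ mu1 mu2 (fun z => ((l1 z.1 * l2 z.2) ^+ 2)%:E)).
  + by apply/measurable_EFinP; exact: measurable_funX.
  + by move=> z; rewrite lee_fin sqr_ge0.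
  have m2 : measurable_fun setT (fun y => (l2 y ^+ 2)%:E).
    by apply/measurable_EFinP; exact: measurable_funX.
  have m1 : measurable_fun setT (fun y => (l1 y ^+ 2)%:E).
    by apply/measurable_EFinP; exact: measurable_funX.
  rewrite (eq_integral (fun x => (l1 x ^+ 2)%:E * \int[mu2]_y (l2 y ^+ 2)%:E)).
    rewrite ge0_integralZr//; last 2 first.
    + by move=> x _; rewrite lee_fin sqr_ge0.
    + by apply: integral_ge0 => y _; rewrite lee_fin sqr_ge0.
    rewrite EFinM; apply: lee_pmul => //.
    + by apply: integral_ge0 => y _; rewrite lee_fin sqr_ge0.
    + by apply: integral_ge0 => y _; rewrite lee_fin sqr_ge0.
  move=> x _; rewrite -ge0_integralZl//; last 2 first.
  + by move=> y _; rewrite lee_fin sqr_ge0.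
  + by rewrite lee_fin sqr_ge0.
  by apply: eq_integral => y _; rewrite -EFinM exprMn.
Qed.

End quasi_invariant_product.

Section tuple_product.
Local Open Scope ereal_scope.
Context (R : realType).

HB.instance Definition _ n :=
  isMeasurableFun.Build _ _ _ _ (@cons_pair R n) (@measurable_cons_pair R n).

(** Built along the recursion that defines Lebesgue measure on tuples, so that
the lemmas on cons_pair apply. *)
Fixpoint prod_tuple n : ('I_n -> probability (measurableTypeR R) R) ->
    probability (Rd R n) R :=
  match n with
  | 0 => fun=> (dirac ([tuple] : Rd R 0) : probability _ _)
  | n'.+1 => fun m =>
      (distribution (m ord0 \x prod_tuple (fun i => m (lift ord0 i)) : probability _ _)%E
        (@cons_pair R n' : {mfun _ >-> _}) : probability _ _)
  end.

Definition mbox n (B : 'I_n -> set R) : set (Rd R n) :=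
  [set x | forall i, B i (tnth x i)].

Lemma measurable_mbox n (B : 'I_n -> set R) : (forall i, measurable (B i)) ->
  measurable (mbox B).
Proof.
move=> mB; rewrite (_ : mbox B =
  \bigcap_(j in [set: 'I_n]) ((fun x : Rd R n => tnth x j) @^-1` B j)).
  apply: fin_bigcap_measurable; first exact: finite_finset.
  by move=> j _; rewrite -[X in measurable X]setTI; apply: measurable_tnth => //; exact: mB.
by apply/seteqP; split => x /= h j; [move=> _; exact: h|exact: (h j I)].
Qed.

Lemma prod_tuple_mbox n (m : 'I_n -> probability (measurableTypeR R) R)
    (B : 'I_n -> set R) : (forall i, measurable (B i)) ->
  prod_tuple m (mbox B) = \prod_i m i (B i).
Proof.
elim: n m B => [|n IH] m B mB.
  by rewrite big_ord0 /= diracE mem_set// => -[].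
rewrite big_ord_recl /= -(IH _ (fun i => B (lift ord0 i)))//.
rewrite -product_measure1E; [|exact: mB|exact: measurable_mbox].
rewrite /distribution /pushforward; congr (_ _).
apply/seteqP; split => -[x t] /=.
  move=> h; split => /=; first by have := h ord0; rewrite /= (tnth_nth 0%R).
  by move=> j; have := h (lift ord0 j); rewrite /= tnthS.
by move=> -[h1 h2] j; case: (unliftP ord0 j) => [k|] ->; rewrite /= ?tnthS//; exact: h2.
Qed.

(** Boxes are stable under intersection and generate the sigma-algebra of tuples. *)
Lemma prod_tuple_unique n (m : 'I_n -> probability (measurableTypeR R) R)
    (Q : probability (Rd R n) R) :
  (forall B : 'I_n -> set R, (forall i, measurable (B i)) ->
     Q (mbox B) = \prod_i m i (B i)) ->
  forall A, measurable A -> Q A = prod_tuple m A.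
Proof.
move=> QE; pose G : set (set (Rd R n)) :=
  [set X | exists2 B : 'I_n -> set R, (forall i, measurable (B i)) & X = mbox B].
apply: (measure_unique G (fun=> setT)).
- apply/seteqP; split.
    apply: smallest_sub; first exact: smallest_sigma_algebra.
    move=> X; rewrite -bigcup_seq/= => -[i _ [B mB <-]].
    apply: sub_sigma_algebra.
    exists (fun j => if j == i then B else setT).
      by move=> j; case: ifP.
    apply/seteqP; split => x /=.
      by move=> [_ Bx] j; case: eqP => // ->.
    by move=> /(_ i); rewrite eqxx.
  apply: smallest_sub; first exact: sigma_algebra_measurable.
  by move=> _ [B mB ->]; exact: measurable_mbox.
- move=> _ _ [B mB ->] [C mC ->]; exists (fun i => B i `&` C i).
    by move=> i; exact: measurableI.
  apply/seteqP; split => x /=; first by move=> [h1 h2] i; split.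
  by move=> h; split => i; case: (h i).
- move=> _; exists (fun=> setT) => //; by apply/seteqP; split.
- by rewrite bigcup_const//.
- by move=> _ [B mB ->]; exact: etrans (QE B mB) (esym (prod_tuple_mbox m mB)).
- by move=> _; rewrite (le_lt_trans (probability_le1 _ _))// ltry.
Qed.

Lemma quasi_invariant_prod_tuple n (m : 'I_n -> probability (measurableTypeR R) R)
    (c K : 'I_n -> R) :
  (forall i, quasi_invariant (m i) (fun x => (x + c i)%R) (K i)) ->
  quasi_invariant (prod_tuple m) (fun x => [tuple (tnth x i + c i)%R | i < n])
    (\prod_i K i).
Proof.
elim: n m c K => [|n IH] m c K h.
  exists (cst 1%R); split => //.
  - move=> psi _ _; apply: eq_integral => x _; rewrite mule1; congr psi.
    by rewrite [LHS]tuple0 [RHS]tuple0.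
  - rewrite (eq_integral (cst 1)); last by move=> x _ /=; rewrite expr1n.
    by rewrite integral_cst// mul1e /= diracE in_setT big_ord0.
have mc : measurable_fun setT (fun x : measurableTypeR R => (x + c ord0)%R).
  exact: measurable_funD.
have mt : measurable_fun setT (fun x : Rd R n =>
    [tuple (tnth x i + c (lift ord0 i))%R | i < n] : Rd R n).
  apply/measurable_fun_tnthP => i; rewrite (_ : _ \o _ = fun x : Rd R n =>
    (tnth x i + c (lift ord0 i))%R); last by apply/funext => x; rewrite /= tnth_mktuple.
  by apply: measurable_funD => //; exact: measurable_tnth.
have [l [ml l0 lE lK]] := quasi_invariant_prod mc mt (h ord0)
  (IH _ _ _ (fun i => h (lift ord0 i))).
pose u (t : Rd R n.+1) : measurableTypeR R * Rd R n :=
  (thead t, [tuple of behead t]).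
have mu_ : measurable_fun setT u.
  apply/measurable_fun_pairP; split; first exact: (measurable_tnth ord0).
  exact: measurable_behead.
have uK z : u (cons_pair z) = z.
  by case: z => x t; rewrite /u /cons_pair/= theadE; congr pair; exact: val_inj.
have IP (f : Rd R n.+1 -> \bar R) : measurable_fun setT f -> (forall x, 0 <= f x) ->
    \int[prod_tuple m]_x f x =
    \int[m ord0 \x prod_tuple (fun i => m (lift ord0 i))]_z f (cons_pair z).
  by move=> mf f0; apply: etrans; first exact:
    (ge0_integral_pushforward (@measurable_cons_pair R n) _ measurableT mf (fun y _ => f0 y)).
have ms : measurable_fun setT (fun x : Rd R n.+1 =>
    [tuple (tnth x i + c i)%R | i < n.+1] : Rd R n.+1).
  apply/measurable_fun_tnthP => i; rewrite (_ : _ \o _ = fun x : Rd R n.+1 =>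
    (tnth x i + c i)%R); last by apply/funext => x; rewrite /= tnth_mktuple.
  by apply: measurable_funD => //; exact: measurable_tnth.
exists (l \o u); split.
- exact: measurableT_comp.
- by move=> x; exact: l0.
- move=> psi mpsi psi0 /=.
  rewrite IP//; last exact: measurableT_comp mpsi ms.
  rewrite IP; last 2 first.
  + by apply: emeasurable_funM => //; apply/measurable_EFinP; exact: measurableT_comp ml mu_.
  + by move=> x; rewrite mule_ge0// lee_fin; exact: l0.
  have := lE (psi \o @cons_pair R n) (measurableT_comp mpsi (@measurable_cons_pair R n)) (fun=> psi0 _).
  move=> E; transitivity (\int[(m ord0 \x prod_tuple (fun i : 'I_n => m (lift ord0 i)))]_x
    ((psi \o @cons_pair R n) x * (l x)%:E)).
    rewrite -E; apply: eq_integral => -[x t] _ /=; congr psi.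
    apply: eq_from_tnth => i; rewrite tnth_mktuple.
    by case: (unliftP ord0 i) => [k|] ->; rewrite ?tnthS ?tnth_mktuple.
  by apply: eq_integral => z _; rewrite /= uK.
- rewrite big_ord_recl IP; last 2 first.
  + by apply/measurable_EFinP; apply: measurable_funX; exact: measurableT_comp ml mu_.
  + by move=> x; rewrite lee_fin sqr_ge0.
  apply: le_trans lK; rewrite le_eqVlt; apply/orP; left; apply/eqP.
  by apply: eq_integral => z _; rewrite /= uK.
Qed.

End tuple_product.

Section quasi_invariant_le.
Local Open Scope ereal_scope.
Context d (T : measurableType d) (R : realType).

(** Cauchy-Schwarz in the form 2 a b <= lam a^2 + b^2 / lam, where b is the
density and a = phi satisfies a^2 <= a. *)
Lemma quasi_invariant_le (mu : {measure set T -> \bar R}) (theta : T -> T) (K : R) (phi : T -> R)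
    (lam : R) :
  measurable_fun setT theta ->
  quasi_invariant mu theta K -> measurable_fun setT phi ->
  (forall x, 0 <= phi x <= 1)%R -> (0 < lam)%R ->
  2%:E * \int[mu]_x (phi (theta x))%:E <=
  lam%:E * \int[mu]_x (phi x)%:E + (K / lam)%:E.
Proof.
move=> mth [l [ml l0 lE lK]] mphi phi01 lam0.
have mphiE : measurable_fun setT (EFin \o phi) by exact/measurable_EFinP.
have phi0 x : 0 <= (phi x)%:E by rewrite lee_fin; case/andP: (phi01 x).
have mlE : measurable_fun setT (EFin \o l) by exact/measurable_EFinP.
have mprod : measurable_fun setT (fun x => (phi x)%:E * (l x)%:E).
  exact: emeasurable_funM.
rewrite (lE (EFin \o phi))//=.
rewrite -[leLHS]ge0_integralZl//; last first.
  by move=> x _; rewrite mule_ge0// lee_fin.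
apply: (@le_trans _ _ (\int[mu]_x (lam%:E * (phi x)%:E + lam^-1%:E * (l x ^+ 2)%:E))).
  apply: le_integral_nonmeasurable => x.
    by rewrite !mule_ge0// lee_fin// ?ler0n.
  rewrite -!EFinM -EFinD lee_fin.
  have /andP[p0 p1] := phi01 x.
  set a := phi x in p0 p1 *; set b := l x.
  have : (0 <= lam^-1 * (lam * a - b) ^+ 2)%R.
    by rewrite mulr_ge0 ?sqr_ge0 ?invr_ge0 ?(ltW lam0).
  have -> : (lam^-1 * (lam * a - b) ^+ 2 = lam * a ^+ 2 - 2 * (a * b) + lam^-1 * b ^+ 2)%R.
    have -> : (lam^-1 * (lam * a - b) ^+ 2 = (lam^-1 * lam) * (lam * a ^+ 2) -
        2 * ((lam^-1 * lam) * (a * b)) + lam^-1 * b ^+ 2)%R by lra.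
    by rewrite mulVf ?gt_eqF// !mul1r.
  have : (lam * a ^+ 2 <= lam * a)%R.
    by rewrite ler_wpM2l ?(ltW lam0)// expr2 ler_piMl.
  lra.
rewrite ge0_integralD//; last 4 first.
- by move=> x _; rewrite mule_ge0// lee_fin ltW.
- by apply: measurable_funeM.
- by move=> x _; rewrite mule_ge0// lee_fin ?invr_ge0 ?sqr_ge0// ltW.
- by apply: measurable_funeM; apply/measurable_EFinP; exact: measurable_funX.
rewrite ge0_integralZl ?lee_fin ?(ltW lam0)//.
apply: leeD => //.
rewrite ge0_integralZl//; last 3 first.
- by apply/measurable_EFinP; exact: measurable_funX.
- by move=> x _; rewrite lee_fin sqr_ge0.
- by rewrite lee_fin invr_ge0 ltW.
by rewrite mulrC EFinM; apply: lee_wpmul2l => //; rewrite lee_fin invr_ge0 ltW.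
Qed.

End quasi_invariant_le.

(** * White noise on disjoint sets *)

Section white_noise.
Context {R : realType} (d : nat).
Context (dO : measure_display) (Omega : measurableType dO).
Variable P : probability Omega R.
Variable W : set (Rd R d) -> Omega -> R.
Hypothesis W_noise : white_noise P W.
Local Notation nu := (@lebesgue_measure_Rd R d).

Let W_meas A : finite_measure_set A -> measurable_fun setT (W A).
Proof. by case: W_noise => h _ _ _; exact: h. Qed.

Lemma measurable_mktuple n (X : 'I_n -> Omega -> R) :
  (forall i, measurable_fun setT (X i)) ->
  measurable_fun setT (fun w => [tuple X i w | i < n] : Rd R n).
Proof.
move=> mX; apply/measurable_fun_tnthP => i.
rewrite (_ : _ \o _ = X i); last by apply/funext => x; rewrite /= tnth_mktuple.
exact: mX.
Qed.

(** Independence fixes the joint law on boxes, hence everywhere. *)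
Lemma white_noise_law n (B : 'I_n -> set (Rd R d)) :
  (forall i, finite_measure_set (B i)) -> trivIset setT B ->
  forall A : set (Rd R n), measurable A ->
  pushforward P (fun w => [tuple W (B i) w | i < n] : Rd R n) A =
  prod_tuple (fun i => gaussian (fine (nu (B i)))) A.
Proof.
move=> fB tB.
have mZ := measurable_mktuple (fun i => W_meas (fB i)).
pose Z : {mfun Omega >-> Rd R n} := HB.pack (fun w => [tuple W (B i) w | i < n] : Rd R n)
  (isMeasurableFun.Build _ _ _ _ _ mZ).
apply: (@prod_tuple_unique _ _ _ (distribution P Z : probability _ _)) => C mC.
case: W_noise => _ law indep _.
transitivity (P [set w | forall i, C i (W (B i) w)]).
  rewrite /distribution /pushforward; congr (P _).
  by apply/seteqP; split => w /= h i; have := h i; rewrite tnth_mktuple.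
rewrite indep//; apply: eq_bigr => i _.
by rewrite law// gaussianE.
Qed.

(** The cost of the shift is the sum of the squared shifts in units of standard
deviation. Sets of measure zero carry no noise, and may not be shifted. *)
Lemma white_noise_shift_disjoint n (B : 'I_n -> set (Rd R d)) (c : 'I_n -> R)
    (phi : Rd R n -> R) (lam : R) :
  (forall i, finite_measure_set (B i)) -> trivIset setT B ->
  (forall i, fine (nu (B i)) = 0 -> c i = 0) ->
  measurable_fun setT phi -> (forall x, 0 <= phi x <= 1) -> 0 < lam ->
  (2%:E * \int[P]_w (phi [tuple W (B i) w + c i | i < n])%:E <=
   lam%:E * \int[P]_w (phi [tuple W (B i) w | i < n])%:E +
   (expR (\sum_i c i ^+ 2 / fine (nu (B i))) / lam)%:E)%E.
Proof.
move=> fB tB c0 mphi phi01 lam0.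
pose m i := gaussian (fine (nu (B i))).
have mZ := measurable_mktuple (fun i => W_meas (fB i)).
have IE (f : Rd R n -> R) : measurable_fun setT f -> (forall x, 0 <= f x) ->
    (\int[P]_w (f [tuple W (B i) w | i < n])%:E = \int[prod_tuple m]_x (f x)%:E)%E.
  pose Zm := measure_function_pushforward__canonical__measure_function_Measure P mZ.
  move=> mf f0; transitivity (\int[Zm]_x (f x)%:E)%E.
    apply/esym; apply: etrans; first apply: (ge0_integral_pushforward mZ P measurableT).
    - exact/measurable_EFinP.
    - by move=> x _; rewrite lee_fin.
    by rewrite preimage_setT.
  apply: eq_measure_integral => A mA _.
  exact: white_noise_law.
have mth : measurable_fun setT (fun x : Rd R n => [tuple tnth x i + c i | i < n] : Rd R n).
  apply/measurable_fun_tnthP => i; rewrite (_ : _ \o _ = fun x : Rd R n =>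
    (tnth x i + c i)); last by apply/funext => x; rewrite /= tnth_mktuple.
  by apply: measurable_funD => //; exact: measurable_tnth.
have phi0 x : 0 <= phi x by case/andP: (phi01 x).
rewrite (IE phi)//.
have -> : (\int[P]_w (phi [tuple W (B i) w + c i | i < n])%:E =
    \int[prod_tuple m]_x (phi [tuple tnth x i + c i | i < n])%:E)%E.
  rewrite -(IE (fun x => phi [tuple tnth x i + c i | i < n]))//; last exact: measurableT_comp mphi mth.
  apply: eq_integral => w _; congr (phi _)%:E.
  by apply: eq_from_tnth => i; rewrite !tnth_mktuple.
rewrite expR_sum.
apply: (quasi_invariant_le mth) => //.
apply: quasi_invariant_prod_tuple => i.
apply: quasi_invariant_gaussian; last exact: c0.
exact: fine_ge0.
Qed.

End white_noise.

(** * Inner products and the Bessel inequality *)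

Section inner_product.
Context dT (T : measurableType dT) (R : realType).
Variable mu : {measure set T -> \bar R}.
Local Notation L2 := (Lfun mu 2%:E).
Implicit Types f g h : T -> R.

Definition ip f g : R := \int[mu]_x (f x * g x).

Lemma ip_integrable f g : f \in L2 -> g \in L2 ->
  mu.-integrable setT (EFin \o (fun x => f x * g x)).
Proof. by move=> f2 g2; apply/Lfun1_integrable; exact: Lfun2_mul_Lfun1. Qed.

Lemma L2_measurable f : f \in L2 -> measurable_fun setT f.
Proof. by rewrite inE => /andP[/[!inE]]. Qed.

Lemma L2_D f g : f \in L2 -> g \in L2 -> (fun x => f x + g x) \in L2.
Proof. by move=> f2 g2; exact: (Lfun_addr_closed mu le1_2e).2. Qed.

Lemma L2_Z a f : f \in L2 -> (fun x => a * f x) \in L2.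
Proof.
move=> f2; rewrite (_ : (fun x => a * f x) = a \o* f).
  by apply: Lfun_scale; rewrite // ler1n.
by apply/funext => x; rewrite /= mulrC.
Qed.

Lemma L2_0 : (fun=> 0) \in L2.
Proof. exact: (Lfun_addr_closed mu le1_2e).1. Qed.

Lemma L2_sum (I : Type) (s : seq I) (F : I -> T -> R) :
  (forall i, F i \in L2) -> (fun x => \sum_(i <- s) F i x) \in L2.
Proof.
move=> hF; elim: s => [|i s IH].
  by under eq_fun do rewrite big_nil; exact: L2_0.
by under eq_fun do rewrite big_cons; exact: L2_D.
Qed.

Lemma ipC f g : ip f g = ip g f.
Proof. by apply: eq_Rintegral => x _; rewrite mulrC. Qed.

Lemma ipDr h f g : h \in L2 -> f \in L2 -> g \in L2 ->
  ip h (fun x => f x + g x) = ip h f + ip h g.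
Proof.
move=> h2 f2 g2; rewrite -RintegralD//; try exact: ip_integrable.
by apply: eq_Rintegral => x _; rewrite mulrDr.
Qed.

Lemma ipZr h a f : h \in L2 -> f \in L2 -> ip h (fun x => a * f x) = a * ip h f.
Proof.
move=> h2 f2; rewrite -RintegralZl//; last exact: ip_integrable.
by apply: eq_Rintegral => x _; rewrite mulrCA.
Qed.

Lemma ip_sumr h (I : Type) (s : seq I) (F : I -> T -> R) : h \in L2 ->
  (forall i, F i \in L2) ->
  ip h (fun x => \sum_(i <- s) F i x) = \sum_(i <- s) ip h (F i).
Proof.
move=> h2 hF; elim: s => [|i s IH].
  rewrite big_nil /ip /Rintegral (eq_integral (cst 0%E)) ?integral0// => x _.
  by rewrite big_nil mulr0.
rewrite big_cons -IH -ipDr//; last exact: L2_sum.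
by congr ip; apply/funext => x; rewrite big_cons.
Qed.

Lemma L2_indic (A : set T) : measurable A -> (mu A < +oo)%E -> (\1_A : T -> R) \in L2.
Proof.
move=> mA Aoo; apply/andP; split; first by rewrite inE; exact: measurable_indic.
rewrite inE /= /finite_norm unlock; apply: poweR_lty.
rewrite (_ : (\int[mu]_x _)%E = (\int[mu]_x (\1_A x)%:E)%E).
  by rewrite integral_indic// setIT.
apply: eq_integral => x _ /=; rewrite ger0_norm// indicE.
by case: (_ \in _); rewrite /= ?powR1// powR0.
Qed.

Lemma ip_indic2 (A : set T) : measurable A -> ip \1_A \1_A = fine (mu A).
Proof.
move=> mA; rewrite /ip /Rintegral; congr fine.
rewrite (eq_integral (fun x => (\1_A x)%:E)); first by rewrite integral_indic// setIT.
by move=> x _; rewrite indicE; case: (_ \in _); rewrite ?mulr1 ?mulr0.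
Qed.

Lemma ip_cauchy f g : f \in L2 -> g \in L2 ->
  (`|ip f g|%:E <= 'N[mu]_2%:E[EFin \o f] * 'N[mu]_2%:E[EFin \o g])%E.
Proof.
move=> f2 g2; have mf := L2_measurable f2; have mg := L2_measurable g2.
apply: (@le_trans _ _ ('N[mu]_1[EFin \o (fun x => (f x * g x)%R)])%E).
  rewrite Lnorm1 EFin_normr_Rintegral//; last exact: ip_integrable.
  apply: le_abse_integral => //; apply/measurable_EFinP; exact: measurable_funM.
apply: hoelder => //.
by have := @splitr R 1; rewrite !mul1r.
Qed.

Lemma ip_null h (A : set T) : h \in L2 -> measurable A -> mu A = 0%E ->
  ip h \1_A = 0.
Proof.
move=> h2 mA A0; rewrite /ip /Rintegral (_ : (\int[mu]_x _)%E = 0%E)//.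
rewrite (_ : (\int[mu]_x _)%E = (\int[mu]_(x in A) (h x)%:E)%E).
  apply: null_set_integral => //; apply/measurable_funTS/measurable_EFinP.
  exact: L2_measurable.
rewrite [RHS]integral_mkcond; apply: eq_integral => x _; rewrite patchE indicE.
by case: ifP => _; rewrite ?mulr1 ?mulr0.
Qed.

(** The residual of h after projection on the span of the indicators has
nonnegative square norm. A set of measure zero contributes 0, as x / 0 = 0. *)
Lemma bessel_indic h (J : finType) (B : J -> set T) : h \in L2 ->
  (forall j, measurable (B j) /\ (mu (B j) < +oo)%E) -> trivIset setT B ->
  \sum_j ip h \1_(B j) ^+ 2 / fine (mu (B j)) <= ip h h.
Proof.
move=> h2 fB tB.
pose m j := ip h \1_(B j) / fine (mu (B j)).
have iB j : (\1_(B j) : T -> R) \in L2 by apply: L2_indic; case: (fB j).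
have ort i j : ip \1_(B i) \1_(B j) = if i == j then fine (mu (B j)) else 0.
  case: eqP => [->|/eqP ij]; first by rewrite ip_indic2//; case: (fB j).
  rewrite /ip /Rintegral (eq_integral (cst 0%E)) ?integral0// => x _.
  rewrite !indicE; case: (boolP (x \in B i)) => [/set_mem Bi|_]; last by rewrite mul0r.
  case: (boolP (x \in B j)) => [/set_mem Bj|_]; last by rewrite mulr0.
  by move: ij; rewrite (tB i j)// ?eqxx//; exists x.
pose g x := \sum_j m j * \1_(B j) x.
have g2 : g \in L2 by apply: L2_sum => j; exact: L2_Z.
have hg : ip h g = \sum_j m j * ip h \1_(B j).
  by rewrite ip_sumr//; [apply: eq_bigr => j _; rewrite ipZr|move=> j; exact: L2_Z].
have gg : ip g g = \sum_j m j * (m j * fine (mu (B j))).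
  rewrite {2}/g ip_sumr//; last by move=> j; exact: L2_Z.
  apply: eq_bigr => j _; rewrite ipZr// ipC ip_sumr//; last by move=> i; exact: L2_Z.
  rewrite (bigD1 j)//= big1 ?addr0 ?ipZr// ?ort ?eqxx// => i ij.
  by rewrite ipZr// ort eq_sym (negbTE ij) mulr0.
have mE j : m j * ip h \1_(B j) = ip h \1_(B j) ^+ 2 / fine (mu (B j)).
  by rewrite /m mulrAC -expr2.
have mE2 j : m j * (m j * fine (mu (B j))) = ip h \1_(B j) ^+ 2 / fine (mu (B j)).
  rewrite -mE; have [v0|v0] := eqVneq (fine (mu (B j))) 0.
    by rewrite /m v0 invr0 !mulr0 !mul0r.
  by congr (_ * _); rewrite /m mulfVK.
have mg2 : (fun x => (-1) * g x) \in L2 by exact: L2_Z.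
have hg2 : (fun x => h x + (-1) * g x) \in L2 by exact: L2_D.
have : 0 <= ip (fun x => h x + (-1) * g x) (fun x => h x + (-1) * g x).
  by apply: Rintegral_ge0 => x _; rewrite -expr2 sqr_ge0.
set u := fun x => h x + (-1) * g x.
have ug k : k \in L2 -> ip k u = ip k h - ip k g.
  by move=> k2; rewrite ipDr// ipZr// mulN1r.
rewrite ug// (ipC u h) (ipC u g) !ug// (ipC g h) hg gg.
rewrite (eq_bigr _ (fun j _ => mE j)) (eq_bigr _ (fun j _ => mE2 j)).
set S := \sum_j _ / _.
lra.
Qed.

End inner_product.

(** * White noise on finite families of sets *)

Section atoms.
Context (T : Type) (I : finType) (A : I -> set T).

(** The atom outside all the A i is replaced by the empty set, since it may have
infinite measure. *)
Definition atom (S : {set I}) : set T :=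
  if S == finset.set0 then set0 else [set x | forall i, A i x <-> i \in S].

Lemma trivIset_atom : trivIset setT atom.
Proof.
move=> S S' _ _ [x []]; rewrite /atom; case: ifP => // _ h; case: ifP => // _ h'.
apply/setP => i; apply/idP/idP; first by move=> /(h i).2/(h' i).1.
by move=> /(h' i).2/(h i).1.
Qed.

Lemma atom_sub (S : {set I}) i : i \in S -> atom S `<=` A i.
Proof.
move=> iS x; rewrite /atom; case: ifP => // _ h; exact: (h i).2.
Qed.

Definition atoms_in (i : I) : seq {set I} := [seq S : {set I} <- enum {: {set I}} | i \in S].

Lemma atom_cover i : A i = \big[setU/set0]_(S <- atoms_in i) atom S.
Proof.
rewrite -bigcup_seq; apply/seteqP; split => x.
  move=> Aix; exists [set j | `[< A j x >]]%SET.
    by rewrite /= mem_filter mem_enum andbT inE; apply/asboolP.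
  rewrite /atom ifF /=.
    by move=> j; rewrite inE; split => [|/asboolP//]; move=> /asboolP.
  by apply/eqP => /setP/(_ i); rewrite !inE; move=> /asboolP.
by move=> [S]; rewrite /= mem_filter => /andP[iS _]; exact: atom_sub.
Qed.

End atoms.

Lemma indic_bigsetU (T : Type) (R : realType) (J : choiceType) (s : seq J) (B : J -> set T) x :
  uniq s -> trivIset setT B ->
  \1_(\big[setU/set0]_(j <- s) B j) x = \sum_(j <- s) \1_(B j) x :> R.
Proof.
move=> + tB; elim: s => [_|j s IH /= /andP[js us]].
  by rewrite !big_nil indic0.
rewrite !big_cons -IH// !indicE -bigcup_seq.
have [Bjx|nBjx] := pselect (B j x); last first.
  rewrite [x \in B j]memNset//= add0r; congr (_%:R); congr nat_of_bool.
  by apply/idP/idP => /set_mem h; apply/mem_set; [case: h|right].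
rewrite [x \in B j]mem_set//= [x \in _ `|` _]mem_set//; last by left.
rewrite memNset ?addr0// => -[k /= ks Bkx].
by move: js; rewrite (tB j k) ?ks//; exists x.
Qed.

Section white_noise_families.
Context {R : realType} (d : nat).
Context (dO : measure_display) (Omega : measurableType dO).
Variable P : probability Omega R.
Variable W : set (Rd R d) -> Omega -> R.
Hypothesis W_noise : white_noise P W.
Local Notation nu := (@lebesgue_measure_Rd R d).
Local Notation fms := (@finite_measure_set R d).

Lemma fms0 : fms set0.
Proof. by split; rewrite ?measure0. Qed.

Lemma fmsU A B : fms A -> fms B -> fms (A `|` B).
Proof.
move=> [mA Ao] [mB Bo]; split; first exact: measurableU.
by apply: le_lt_trans (measureU2 _ mA mB) _; exact: lte_add_pinfty.
Qed.

Lemma fms_sub A B : measurable A -> A `<=` B -> fms B -> fms A.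
Proof.
move=> mA AB [mB Bo]; split => //; apply: le_lt_trans Bo.
by apply: le_measure; rewrite ?inE.
Qed.

Lemma fms_bigsetU (J : choiceType) (s : seq J) (B : J -> set (Rd R d)) :
  (forall j, fms (B j)) -> fms (\big[setU/set0]_(j <- s) B j).
Proof.
move=> fB; elim: s => [|j s IH]; first by rewrite big_nil; exact: fms0.
by rewrite big_cons; exact: fmsU.
Qed.

Lemma white_noise_bigsetU (J : choiceType) (s : seq J) (B : J -> set (Rd R d)) :
  uniq s -> trivIset setT B -> (forall j, fms (B j)) ->
  {ae P, forall w, W (\big[setU/set0]_(j <- s) B j) w = \sum_(j <- s) W (B j) w}.
Proof.
case: W_noise => _ _ _ addW us tB fB; elim: s us => [_|j s IH /= /andP[js us]].
  have := addW set0 set0 fms0 fms0 (setI0 _); rewrite setU0.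
  by apply: filterS => w; rewrite !big_nil; lra.
have := addW _ _ (fB j) (fms_bigsetU s fB).
have -> : B j `&` \big[setU/set0]_(i <- s) B i = set0.
  rewrite -bigcup_seq; apply/seteqP; split => // x [Bjx [k /= ks Bkx]].
  by move: js; rewrite (tB j k) ?ks//; exists x.
move=> /(_ erefl); apply: filterS2 (IH us) => w E.
by rewrite !big_cons E.
Qed.

(** On the atoms of the family A the noise is independent, and W (A i) is the sum
of the noise over the atoms inside A i, almost surely. The cost of the shift is
a sum over atoms, at most the square norm of h by the Bessel inequality. The
function spaces I -> R carry no sigma-algebra, so measurability of psi is
expressed through measurable families. *)
Lemma white_noise_shift (I : finType) (A : I -> set (Rd R d)) (h : Rd R d -> R)
    (psi : (I -> R) -> R) (lam : R) :
  (forall i, fms (A i)) -> h \in Lfun nu 2%:E ->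
  (forall d' (T' : measurableType d') (X : I -> T' -> R),
     (forall i, measurable_fun setT (X i)) ->
     measurable_fun setT (fun w => psi (X^~ w))) ->
  (forall x, 0 <= psi x <= 1) -> 0 < lam ->
  (2%:E * \int[P]_w (psi (fun i => W (A i) w + ip nu h \1_(A i)))%:E <=
   lam%:E * \int[P]_w (psi (fun i => W (A i) w))%:E + (expR (ip nu h h) / lam)%:E)%E.
Proof.
move=> fA h2 mpsi psi01 lam0.
pose n := #|{set I}|.
pose B (k : 'I_n) := atom A (enum_val k).
have matom S : measurable (atom A S).
  rewrite /atom; case: ifP => // _.
  rewrite (_ : [set x | _] = \bigcap_(i in [set: I]) (if i \in S then A i else ~` A i)).
    apply: fin_bigcap_measurable; first exact: finite_finset.
    move=> i _; have [mA _] := fA i; case: ifP => // _; exact: measurableC.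
  apply/seteqP; split => x /=.
    move=> hx i _; case: ifPn => iS; first exact/hx.
    by move=> /hx; rewrite (negbTE iS).
  move=> hx i; have := hx i Logic.I; case: ifPn => // iS nA; split => //.
have fatom S : fms (atom A S).
  have [->|/set0Pn[i iS]] := eqVneq S finset.set0.
    by rewrite /atom eqxx; exact: fms0.
  by apply: fms_sub (fA i); [exact: matom|exact: atom_sub].
have tB : trivIset setT B.
  move=> k l _ _ /(trivIset_atom) => /(_ Logic.I Logic.I); exact: enum_val_inj.
pose c k := ip nu h \1_(B k).
pose g (t : Rd R n) (i : I) : R := \sum_(S <- atoms_in i) tnth t (enum_rank S).
pose phi (t : Rd R n) := psi (g t).
have mphi : measurable_fun setT phi.
  apply: (mpsi _ _ (fun i t => g t i)) => i; rewrite /g.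
  by apply: measurable_sum => S; exact: measurable_tnth.
have WA i : {ae P, forall w, W (A i) w = \sum_(S <- atoms_in i) W (atom A S) w}.
  have := @white_noise_bigsetU _ (atoms_in i) (atom A).
  rewrite -atom_cover; apply => //; first by rewrite filter_uniq// enum_uniq.
  exact: trivIset_atom.
have WAall : {ae P, forall w, forall i, W (A i) w = \sum_(S <- atoms_in i) W (atom A S) w}.
  exact: filter_forall.
have W_meas : forall A, fms A -> measurable_fun setT (W A) by case: W_noise.
have sE i : ip nu h \1_(A i) = \sum_(S <- atoms_in i) ip nu h \1_(atom A S).
  rewrite -ip_sumr//; last by move=> S; apply: L2_indic; case: (fatom S).
  congr ip; apply/funext => x; rewrite {1}(atom_cover A i) indic_bigsetU//.
    by rewrite filter_uniq// enum_uniq.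
  exact: trivIset_atom.
have -> : (\int[P]_w (psi (fun i => W (A i) w))%:E =
    \int[P]_w (phi [tuple W (B i) w | i < n])%:E)%E.
  apply: ae_eq_integral => //.
  - by apply/measurable_EFinP; apply: (mpsi _ _ (fun i => W (A i))) => i; apply: W_meas; first [exact: fA|exact: fatom].
  - apply/measurable_EFinP; apply: (measurableT_comp mphi).
    by apply: measurable_mktuple => i; apply: W_meas; first [exact: fA|exact: fatom].
  apply: filterS WAall => w h' _; congr (psi _)%:E; apply/funext => i.
  rewrite h' /g; apply: eq_bigr => S _.
  by rewrite tnth_mktuple /B enum_rankK.
have -> : (\int[P]_w (psi (fun i => W (A i) w + ip nu h \1_(A i)))%:E =
    \int[P]_w (phi [tuple W (B i) w + c i | i < n])%:E)%E.
  apply: ae_eq_integral => //.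
  - apply/measurable_EFinP; apply: (mpsi _ _ (fun i w => W (A i) w + ip nu h \1_(A i))) => i.
    by apply: measurable_funD => //; apply: W_meas; first [exact: fA|exact: fatom].
  - apply/measurable_EFinP; apply: (measurableT_comp mphi).
    by apply: (@measurable_mktuple _ _ _ _ (fun i w => W (B i) w + c i)) => i;
      apply: measurable_funD => //; apply: W_meas; first [exact: fA|exact: fatom].
  apply: filterS WAall => w h' _; congr (psi _)%:E; apply/funext => i.
  rewrite h' sE -big_split /=; apply: eq_bigr => S _.
  by rewrite tnth_mktuple /c /B enum_rankK.
apply: le_trans (white_noise_shift_disjoint W_noise _ tB _ mphi _ lam0) _ => //.
- by move=> k; exact: fatom.
- move=> k v0; apply: ip_null => //; first exact: matom.
  have [_ ?] := fatom (enum_val k).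
  by apply/eqP; rewrite -fine_eq0 ?ge0_fin_numE// v0.
- by move=> x; exact: psi01.
rewrite leeD2l// lee_fin ler_wpM2r ?invr_ge0 ?(ltW lam0)// ler_expR.
by apply: bessel_indic => // k; exact: fatom.
Qed.

End white_noise_families.

(** * Shifting the signal: Lipschitz functions of the observation *)

Section lipschitz_cylinder.
Context {R : realType} (d : nat).
Local Notation obs := (@observation R d).

(** The last two constructors mirror complement and intersection of events; all
these functions are Lipschitz in finitely many coordinates and [0, 1]-valued. *)
Inductive lipcyl : (obs -> R) -> Prop :=
| lipcyl_coord (g : L2 R d) (psi : R -> R) (M : R) :
    measurable_fun setT psi -> (forall t, 0 <= psi t <= 1) -> 0 <= M ->
    (forall s t, `|psi s - psi t| <= M * `|s - t|) ->
    lipcyl (fun x => psi (x g))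
| lipcyl_compl F : lipcyl F -> lipcyl (fun x => 1 - F x)
| lipcyl_mul F G : lipcyl F -> lipcyl G -> lipcyl (fun x => F x * G x).

Lemma lipcyl_01 F : lipcyl F -> forall x, 0 <= F x <= 1.
Proof.
elim=> [g psi M _ psi01 _ _ x|{}F _ IH x|{}F G _ IHF _ IHG x].
- exact: psi01.
- by have := IH x; lra.
- have /andP[f0 f1] := IHF x; have /andP[g0 g1] := IHG x.
  by rewrite mulr_ge0//= mulr_ile1.
Qed.

Lemma lipcyl_measurable F : lipcyl F ->
  forall d' (T' : measurableType d') (X : L2 R d -> T' -> R),
  (forall g, measurable_fun setT (X g)) -> measurable_fun setT (fun w => F (X^~ w)).
Proof.
elim=> [g psi M mpsi _ _ _|{}F _ IH|{}F G _ IHF _ IHG] d' T' X mX.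
- exact: measurableT_comp mpsi (mX g).
- by apply: measurable_funB => //; exact: IH.
- by apply: measurable_funM; [exact: IHF|exact: IHG].
Qed.

Lemma lipcyl_lip F : lipcyl F -> exists gs : seq (L2 R d), exists2 M : R, 0 <= M &
  forall x y, `|F x - F y| <= M * \sum_(g <- gs) `|x g - y g|.
Proof.
elim=> [g psi M _ _ M0 hM|{}F _ [gs [M M0 hM]]|{}F G lF [gs [M M0 hM]] lG [gs' [M' M'0 hM']]].
- by exists [:: g], M => // x y; rewrite big_seq1.
- exists gs, M => // x y; rewrite (_ : _ - _ = F y - F x); last by lra.
  by rewrite distrC.
- exists (gs ++ gs'), (M + M'); first exact: addr_ge0.
  move=> x y; rewrite big_cat /=.
  have /andP[f0 f1] := lipcyl_01 lF x; have /andP[g0 g1] := lipcyl_01 lG y.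
  have -> : F x * G x - F y * G y = F x * (G x - G y) + (F x - F y) * G y by lra.
  apply: (le_trans (ler_normD _ _)); rewrite !normrM (ger0_norm f0) (ger0_norm g0).
  have h1 := hM x y; have h2 := hM' x y.
  set S := \sum_(g <- gs) _ in h1 *; set S' := \sum_(g <- gs') _ in h2 *.
  have S0 : 0 <= S by apply: sumr_ge0.
  have S'0 : 0 <= S' by apply: sumr_ge0.
  have : F x * `|G x - G y| <= `|G x - G y| by apply: ler_piMl.
  have : `|F x - F y| * G y <= `|F x - F y| by apply: ler_piMr.
  have : 0 <= M * S' by apply: mulr_ge0.
  have : 0 <= M' * S by apply: mulr_ge0.
  have : (M + M') * (S + S') = M * S + M' * S' + M * S' + M' * S by lra.
  lra.
Qed.

End lipschitz_cylinder.

Section L1_dist.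
Context dT (T : measurableType dT) (R : realType) (P : probability T R).
Implicit Types F G : T -> R.
Local Open Scope ereal_scope.

Lemma integral_le_dist F G : measurable_fun setT F -> measurable_fun setT G ->
  (forall x, 0 <= F x)%R -> (forall x, 0 <= G x)%R ->
  \int[P]_x (F x)%:E <= \int[P]_x (G x)%:E + \int[P]_x `|F x - G x|%:E.
Proof.
move=> mF mG F0 G0.
have mFG : measurable_fun setT (fun x => `|F x - G x|%:E).
  by apply/measurable_EFinP; apply: measurableT_comp => //; exact: measurable_funB.
have mGE : measurable_fun setT (fun x => (G x)%:E) by exact/measurable_EFinP.
have G0E x : setT x -> 0 <= (G x)%:E by rewrite lee_fin.
have D0E x : setT x -> 0 <= `|F x - G x|%:E by rewrite lee_fin.
rewrite -(ge0_integralD P measurableT G0E mGE D0E mFG).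
apply: le_integral_nonmeasurable => x; first by rewrite lee_fin.
rewrite -EFinD lee_fin -lerBlDl; exact: ler_norm.
Qed.

Lemma L1_le_L2 F : measurable_fun setT F ->
  \int[P]_x `|F x|%:E <= 'N[P]_2%:E[EFin \o F].
Proof.
move=> mF.
have h : (2^-1 + 2^-1 = 1 :> R)%R by have := @splitr R 1; rewrite !mul1r.
have := @hoelder _ T R P F (cst 1%R) 2 2 mF (measurable_cst _) (ltr0Sn _ _) (ltr0Sn _ _) h.
have -> : 'N[P]_2%:E[EFin \o cst 1%R] = 1.
  apply: etrans; first exact: Lnorm_cst1.
  by rewrite -[RHS](poweR1r 2^-1); congr (_ `^ _); exact: probability_setT.
rewrite Lnorm1 mule1.
apply: le_trans; rewrite le_eqVlt; apply/orP; left; apply/eqP.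
by apply: eq_integral => x _; rewrite /= mulr1.
Qed.

End L1_dist.

Section observe_shift.
Context {R : realType} (d : nat).
Context (dO : measure_display) (Omega : measurableType dO).
Variable P : probability Omega R.
Variable W : set (Rd R d) -> Omega -> R.
Hypothesis W_noise : white_noise P W.
Variable Wint : L2 R d -> Omega -> R.
Hypothesis Wint_integral : forall g : L2 R d, wiener_integral P W g (Wint g).
Local Notation nu := (@lebesgue_measure_Rd R d).
Local Notation fms := (@finite_measure_set R d).
Local Notation Lf2 := (Lfun nu 2%:E).

Lemma observeE eps f w g : observe Wint eps f w g = ip nu f g + eps * Wint g w.
Proof. by []. Qed.

Lemma measurable_observe eps f g : measurable_fun setT (fun w => observe Wint eps f w g).
Proof.
by apply: measurable_funD => //; apply: measurable_funM => //; case: (Wint_integral g).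
Qed.

(** The step functions are chosen for all g at once, so that the signal and its
shift can be compared through the same ones. *)
Lemma wiener_approx (e : R) : 0 < e -> exists z : forall g : L2 R d,
    {n : nat & (('I_n -> R) * ('I_n -> set (Rd R d)))%type},
  forall g, [/\ forall i, fms ((projT2 (z g)).2 i),
    ('N[nu]_2%:E[EFin \o (fun x => g x - \sum_i (projT2 (z g)).1 i * \1_((projT2 (z g)).2 i) x)%R]
          < e%:E)%E &
    ('N[P]_2%:E[EFin \o (fun w => Wint g w - \sum_i (projT2 (z g)).1 i * W ((projT2 (z g)).2 i) w)%R]
          < e%:E)%E].
Proof.
move=> e0; pose Q (g : L2 R d) (z : {n : nat & (('I_n -> R) * ('I_n -> set (Rd R d)))%type}) :=
  [/\ forall i, fms ((projT2 z).2 i),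
    ('N[nu]_2%:E[EFin \o (fun x => g x - \sum_i (projT2 z).1 i * \1_((projT2 z).2 i) x)%R]
          < e%:E)%E &
    ('N[P]_2%:E[EFin \o (fun w => Wint g w - \sum_i (projT2 z).1 i * W ((projT2 z).2 i) w)%R]
          < e%:E)%E].
suff : forall g, exists z, Q g z by move=> /choice[z zP]; exists z.
move=> g; have [_ /(_ _ e0)[n [a [A [fA tA h1 h2]]]]] := Wint_integral g.
by exists (existT _ n (a, A)); split.
Qed.

(** Replace the Wiener integrals of the coordinates that F depends on by sums of
white noise over the sets of step functions. The error is small in L_1 because F
is Lipschitz; shifting the signal by eps * h moves a step sum by eps times the
inner product of h with the step function, close to that with g by
Cauchy-Schwarz. The inequality for white noise then applies to the sums. *)
Lemma observe_shift_lipcyl (eps lam : R) (f0 h : Rd R d -> R) (F : @observation R d -> R) :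
  0 <= eps -> 0 < lam -> f0 \in Lf2 -> h \in Lf2 -> lipcyl F ->
  (2%:E * \int[P]_w (F (observe Wint eps (fun x => f0 x + eps * h x)%R w))%:E <=
   lam%:E * \int[P]_w (F (observe Wint eps f0 w))%:E + (expR (ip nu h h) / lam)%:E)%E.
Proof.
move=> eps0 lam0 f02 h2 lF.
have regroup (x y z u v : R) :
    x + eps * y + eps * z - (x + eps * (u + v)) = eps * (z - u + (y - v)) by lra.
have total (x y z k : R) : x * eps * ((1 + y) * z) * k = x * k * (eps * (1 + y)) * z by lra.
have conclude (x y u v k e t : R) : (2 + lam) * k <= t -> x <= u + k ->
    2 * u <= lam * v + e -> lam * v <= lam * (y + k) -> 2 * x <= lam * y + e + t by lra.
have [gs [M M0 lipF]] := lipcyl_lip lF.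
have F01 := lipcyl_01 lF.
have F0 x : 0 <= F x by case/andP: (F01 x).
have hN : ('N[nu]_2%:E[EFin \o h] < +oo)%E.
  by move: h2; rewrite inE => /andP[_]; rewrite inE.
pose N := fine ('N[nu]_2%:E[EFin \o h])%E.
have NE : ('N[nu]_2%:E[EFin \o h] = N%:E)%E by rewrite fineK// ge0_fin_numE// Lnorm_ge0.
have N0 : 0 <= N by apply: fine_ge0; exact: Lnorm_ge0.
apply/lee_addgt0Pr => t t0.
pose C := (2 + lam) * (M * (size gs)%:R * (eps * (1 + N))).
have C0 : 0 <= C by rewrite !mulr_ge0// ?addr_ge0// ltW.
pose e := t / (C + 1).
have C1 : 0 < C + 1 by rewrite ltr_wpDl.
have e0 : 0 < e by rewrite divr_gt0.
have [z zP] := wiener_approx e0.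
pose n g := projT1 (z g). pose a g := (projT2 (z g)).1. pose A g := (projT2 (z g)).2.
pose gk k := tnth (in_tuple gs) k.
pose I := {k : 'I_(size gs) & 'I_(n (gk k))}.
pose AI (i : I) := A (gk (tag i)) (tagged i).
(* the observation rebuilt from the noise x on the sets of the step functions;
   the coordinates outside gs do not influence F *)
pose Y (x : I -> R) (g : L2 R d) : R := ip nu f0 g + eps *
  (if [pick k | gk k == g] is Some k then \sum_(i < n (gk k)) a (gk k) i * x (Tagged _ i) else 0).
pose psi x := F (Y x).
have W_meas : forall A, fms A -> measurable_fun setT (W A) by case: W_noise.
have fAI i : fms (AI i) by case: (zP (gk (tag i))) => /(_ (tagged i)).
have mY d' (T' : measurableType d') (X : I -> T' -> R) g :
    (forall i, measurable_fun setT (X i)) -> measurable_fun setT (fun w => Y (X^~ w) g).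
  move=> mX; apply: measurable_funD => //; apply: measurable_funM => //.
  case: pickP => [k _|_] //.
  by apply: measurable_sum => i; apply: measurable_funM => //; exact: mX.
have mpsi d' (T' : measurableType d') (X : I -> T' -> R) :
     (forall i, measurable_fun setT (X i)) ->
     measurable_fun setT (fun w => psi (X^~ w)).
  by move=> mX; apply: (lipcyl_measurable lF (X := fun g w => Y (X^~ w) g)) => g; exact: mY.
have key := white_noise_shift W_noise fAI h2 mpsi (fun x => F01 _) lam0.
have mWint g : measurable_fun setT (Wint g) by case: (Wint_integral g).
have mobs f : measurable_fun setT (fun w => F (observe Wint eps f w)).
  by apply: (lipcyl_measurable lF (X := fun g w => observe Wint eps f w g)) => g; exact: measurable_observe.
have mp0 : measurable_fun setT (fun w => psi (fun i => W (AI i) w)).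
  by apply: (mpsi _ _ (fun i => W (AI i))) => i; exact: W_meas.
have mp1 : measurable_fun setT (fun w => psi (fun i => W (AI i) w + ip nu h \1_(AI i))).
  apply: (mpsi _ _ (fun i w => W (AI i) w + ip nu h \1_(AI i))) => i.
  by apply: measurable_funD => //; exact: W_meas.
(* a common bound for both replacements of the noise integrals by step sums *)
have dist (f : Rd R d -> R) (X : I -> Omega -> R) :
    (forall i, measurable_fun setT (X i)) ->
    (forall g w, g \in gs -> `|observe Wint eps f w g - Y (X^~ w) g| <=
       eps * (`|Wint g w - \sum_i a g i * W (A g i) w| + N * e)) ->
    (\int[P]_w `|F (observe Wint eps f w) - psi (X^~ w)|%:E <=
      (M * (size gs)%:R * (eps * (1 + N)) * e)%:E)%E.
  move=> mX hX.
  pose D g w := `|Wint g w - \sum_i a g i * W (A g i) w|.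
  have mDin g : measurable_fun setT (fun w => Wint g w - \sum_i a g i * W (A g i) w).
    apply: measurable_funB => //; apply: measurable_sum => i.
    apply: measurable_funM => //; apply: W_meas.
    by have [hA _ _] := zP g; exact: hA.
  have mD g : measurable_fun setT (D g) by apply: measurableT_comp.
  have D0 g w : 0 <= D g w by exact: normr_ge0.
  have ID g : (\int[P]_w (D g w)%:E <= e%:E)%E.
    by apply: (le_trans (L1_le_L2 P (mDin g))); case: (zP g) => _ _ /ltW.
  have Ne0 : 0 <= N * e by rewrite mulr_ge0// ltW.
  apply: (@le_trans _ _ (\int[P]_w (\sum_(g <- gs) ((M * eps) * (D g w + N * e))%:E))%E).
    apply: le_integral_nonmeasurable => w; first by rewrite lee_fin.
    rewrite sumEFin lee_fin; apply: (le_trans (lipF _ _)).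
    rewrite mulr_sumr !big_seq; apply: ler_sum => g ggs.
    by rewrite -mulrA ler_wpM2l// hX.
  rewrite ge0_integral_sum//; last 2 first.
  - move=> g; apply/measurable_EFinP; apply: measurable_funM => //.
    exact: measurable_funD.
  - by move=> g w _; rewrite lee_fin !mulr_ge0// addr_ge0.
  apply: (@le_trans _ _ (\sum_(g <- gs) ((M * eps) * ((1 + N) * e))%:E)%E).
    apply: lee_sum => g _.
    under eq_integral do rewrite EFinM.
    have mDN : measurable_fun setT (fun w => (D g w + N * e)%:E).
      by apply/measurable_EFinP; exact: measurable_funD.
    have DN0 w : setT w -> (0 <= (D g w + N * e)%:E)%E by rewrite lee_fin addr_ge0.
    have Me0 : (0 <= (M * eps)%:E)%E by rewrite lee_fin mulr_ge0.
    rewrite (ge0_integralZl P measurableT mDN DN0 Me0).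
    rewrite [leRHS]EFinM; apply: lee_wpmul2l => //.
    under eq_integral do rewrite EFinD.
    have mDE : measurable_fun setT (fun w => (D g w)%:E) by exact/measurable_EFinP.
    have mNe : measurable_fun setT (fun w : Omega => (N * e)%:E) by [].
    have D0E w : setT w -> (0 <= (D g w)%:E)%E by rewrite lee_fin.
    have Ne0E (w : Omega) : setT w -> (0 <= (N * e)%:E)%E by rewrite lee_fin.
    rewrite (ge0_integralD P measurableT D0E mDE Ne0E mNe).
    rewrite integral_cst// [X in (_ + _ * X)%E](@probability_setT _ _ _ P) mule1 mulrDl mul1r EFinD.
    exact: leeD.
  rewrite sumEFin lee_fin big_const_seq count_predT iter_addr_0 -[leLHS]mulr_natr.
  by rewrite total.
have YE (g : L2 R d) x : g \in gs -> exists2 k, gk k = g & Y x g = ip nu f0 g + eps *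
    \sum_(i < n (gk k)) a (gk k) i * x (Tagged _ i).
  move=> ggs; rewrite /Y; case: pickP => [k /eqP kg|h']; first by exists k.
  have ig : (index g gs < size gs)%N by rewrite index_mem.
  by have := h' (Ordinal ig); rewrite /gk (tnth_nth g) /= nth_index// eqxx.
have d0 := dist f0 (fun i => W (AI i)).
have d1 := dist (fun x => f0 x + eps * h x) (fun i w => W (AI i) w + ip nu h \1_(AI i)).
have A2 g i : (\1_(A g i) : Rd R d -> R) \in Lf2.
  by case: (zP g) => /(_ i)[mA Ao] _ _; exact: L2_indic.
have g2 (g : L2 R d) : (g : Rd R d -> R) \in Lf2 by exact: LfunP.
have {}d0 : (\int[P]_w `|F (observe Wint eps f0 w) - psi (fun i => W (AI i) w)|%:E <=
      (M * (size gs)%:R * (eps * (1 + N)) * e)%:E)%E.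
  apply: d0; first by move=> i; exact: W_meas.
  move=> g w ggs; have [k <- ->] := YE g (fun i => W (AI i) w) ggs.
  rewrite observeE opprD addrACA subrr add0r -mulrBr normrM (ger0_norm eps0).
  by rewrite ler_wpM2l// lerDl mulr_ge0// ltW.
have {}d1 : (\int[P]_w `|F (observe Wint eps (fun x => f0 x + eps * h x) w) -
        psi (fun i => W (AI i) w + ip nu h \1_(AI i))|%:E <=
      (M * (size gs)%:R * (eps * (1 + N)) * e)%:E)%E.
  apply: d1; first by move=> i; apply: measurable_funD => //; exact: W_meas.
  move=> g w ggs; have [k <- ->] := YE g (fun i => W (AI i) w + ip nu h \1_(AI i)) ggs.
  set g' := gk k; rewrite observeE.
  have -> : ip nu (fun x => f0 x + eps * h x) g' = ip nu f0 g' + eps * ip nu h g'.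
    by rewrite ipC ipDr//; [rewrite ipZr// ![ip nu g' _]ipC|exact: L2_Z].
  pose r x := g' x - \sum_i a g' i * \1_(A g' i) x.
  have rE : ip nu h r = ip nu h g' - \sum_i a g' i * ip nu h \1_(A g' i).
    rewrite (_ : r = (fun x => g' x + (-1) * (\sum_i a g' i * \1_(A g' i) x))); last first.
      by apply/funext => x; rewrite mulN1r.
    rewrite ipDr//; last by apply: L2_Z; apply: L2_sum => i; exact: L2_Z.
    rewrite ipZr//; last by apply: L2_sum => i; exact: L2_Z.
    rewrite ip_sumr//; last by move=> i; exact: L2_Z.
    by rewrite mulN1r; congr (_ - _); apply: eq_bigr => i _; rewrite ipZr.
  have r2 : r \in Lf2.
    rewrite (_ : r = (fun x => g' x + (-1) * (\sum_i a g' i * \1_(A g' i) x))); last first.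
      by apply/funext => x; rewrite mulN1r.
    by apply: L2_D => //; apply: L2_Z; apply: L2_sum => i; exact: L2_Z.
  have hr : `|ip nu h r| <= N * e.
    rewrite -lee_fin; apply: (le_trans (ip_cauchy h2 r2)).
    rewrite NE EFinM lee_wpmul2l// ?lee_fin//.
    by case: (zP g') => _ /ltW.
  have -> : \sum_(i < n g') a g' i * (W (AI (Tagged (fun k => 'I_(n (gk k))) i)) w +
       ip nu h \1_(AI (Tagged (fun k => 'I_(n (gk k))) i))) =
      \sum_i a g' i * W (A g' i) w + \sum_i a g' i * ip nu h \1_(A g' i).
    by rewrite -big_split; apply: eq_bigr => i _; rewrite mulrDr.
  set s1 := \sum_i _ * W _ _; set s2 := \sum_i _ * ip _ _ _ in rE *.
  have -> : ip nu f0 g' + eps * ip nu h g' + eps * Wint g' w - (ip nu f0 g' + eps * (s1 + s2))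
    = eps * ((Wint g' w - s1) + ip nu h r).
    by rewrite rE; exact: regroup.
  rewrite normrM (ger0_norm eps0) ler_wpM2l//.
  by apply: (le_trans (ler_normD _ _)); rewrite lerD2l.
have i0 := integral_le_dist P mp0 (mobs f0) (fun=> F0 _) (fun=> F0 _).
have i1 := integral_le_dist P (mobs (fun x => f0 x + eps * h x)) mp1 (fun=> F0 _) (fun=> F0 _).
have d0' : (\int[P]_w `|psi (fun i => W (AI i) w) - F (observe Wint eps f0 w)|%:E <=
      (M * (size gs)%:R * (eps * (1 + N)) * e)%:E)%E.
  by under eq_integral do rewrite distrC.
set kap := M * (size gs)%:R * (eps * (1 + N)) * e in d0 d0' d1.
have {}i0 := le_trans i0 (leeD2l _ d0').
have {}i1 := le_trans i1 (leeD2l _ d1).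
have kapt : (2 + lam) * kap <= t.
  rewrite (_ : _ * kap = C * e); last by rewrite /C /kap !mulrA.
  by rewrite /e mulrCA ger_pMr// ler_pdivrMr// mul1r lerDl.
have Fi (G : Omega -> R) : (forall w, 0 <= G w <= 1) -> exists2 r, 0 <= r & (\int[P]_w (G w)%:E = r%:E)%E.
  move=> G01; have G0 : (0 <= \int[P]_w (G w)%:E)%E.
    by apply: integral_ge0 => w _; rewrite lee_fin; case/andP: (G01 w).
  have G1 : (\int[P]_w (G w)%:E <= 1)%E.
    apply: (@le_trans _ _ (\int[P]_w (cst 1%E) w)%E).
      by apply: le_integral_nonmeasurable => w; rewrite lee_fin; case/andP: (G01 w).
    by rewrite integral_cst// mul1e [leLHS](@probability_setT _ _ _ P).
  exists (fine (\int[P]_w (G w)%:E)); first exact: fine_ge0.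
  by rewrite fineK// ge0_fin_numE// (le_lt_trans G1)// ltry.
have [x0 x00 X0] := Fi _ (fun w => F01 (observe Wint eps f0 w)).
have [x1 x10 X1] := Fi _ (fun w => F01 (observe Wint eps (fun x => f0 x + eps * h x) w)).
have [p0 p00 P0] := Fi (fun w => psi (fun i => W (AI i) w)) (fun w => F01 _).
have [p1 p10 P1] := Fi (fun w => psi (fun i => W (AI i) w + ip nu h \1_(AI i))) (fun w => F01 _).
move: i0; rewrite X0 P0 -EFinD lee_fin => i0.
move: i1; rewrite X1 P1 -EFinD lee_fin => i1.
move: key; rewrite P0 P1 -!EFinM -EFinD lee_fin => key.
rewrite -!EFinD lee_fin.
by apply: conclude kapt i1 key _; rewrite ler_wpM2l// ltW.
Qed.

End observe_shift.

(** * Shifting the signal: cylinder events *)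

Section cylinder_approximation.
Context {R : realType} (d : nat).
Context (dO : measure_display) (Omega : measurableType dO).
Variable P : probability Omega R.
Local Notation obs := (@observation R d).
Variables X Y : Omega -> obs.
Hypothesis mX : forall g, measurable_fun setT (fun w => X w g).
Hypothesis mY : forall g, measurable_fun setT (fun w => Y w g).

Definition err (E : set obs) (F : obs -> R) (w : Omega) : R :=
  `|\1_E (X w) - F (X w)| + `|\1_E (Y w) - F (Y w)|.

(** The same F approximates E along both observations X and Y, because the shift
inequality compares the probabilities of E under their two laws. *)
Definition approximable (E : set obs) := [/\ measurable (X @^-1` E), measurable (Y @^-1` E) &
  forall e : R, 0 < e -> exists2 F, lipcyl F & (\int[P]_w (err E F w)%:E <= e%:E)%E].

Lemma measurable_lipcylX F : lipcyl F -> measurable_fun setT (fun w => F (X w)).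
Proof. by move=> lF; exact: (lipcyl_measurable lF (X := fun g w => X w g)). Qed.

Lemma measurable_lipcylY F : lipcyl F -> measurable_fun setT (fun w => F (Y w)).
Proof. by move=> lF; exact: (lipcyl_measurable lF (X := fun g w => Y w g)). Qed.

Lemma measurable_indic_pre (Z : Omega -> obs) (E : set obs) : measurable (Z @^-1` E) ->
  measurable_fun setT (fun w => \1_E (Z w) : R).
Proof.
move=> mE; rewrite (_ : (fun w => _) = \1_(Z @^-1` E)); first exact: measurable_indic.
by apply/funext => w; rewrite !indicE; congr (_%:R).
Qed.

Lemma measurable_err E F : measurable (X @^-1` E) -> measurable (Y @^-1` E) ->
  lipcyl F -> measurable_fun setT (err E F).
Proof.
move=> mE mE' lF; apply: measurable_funD; apply: measurableT_comp => //; apply: measurable_funB.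
- exact: measurable_indic_pre.
- exact: measurable_lipcylX.
- exact: measurable_indic_pre.
- exact: measurable_lipcylY.
Qed.

Lemma err_ge0 E F w : 0 <= err E F w.
Proof. by rewrite addr_ge0. Qed.

Lemma indic01 (E : set obs) x : 0 <= (\1_E x : R) <= 1.
Proof. by rewrite indicE; case: (_ \in _); rewrite /= ?ler01 ?lexx. Qed.

Lemma approximableC E : approximable E -> approximable (~` E).
Proof.
move=> [mE mE' h]; split.
- by rewrite preimage_setC; exact: measurableC.
- by rewrite preimage_setC; exact: measurableC.
move=> e /h[F lF hF]; exists (fun x => 1 - F x); first exact: lipcyl_compl.
apply: le_trans hF; apply: le_integral_nonmeasurable => w; first by rewrite lee_fin err_ge0.
have eC z (a : R) : `|\1_(~` E) z - (1 - a)| = `|\1_E z - a|.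
  rewrite indicC indicE /=; case: (z \in E) => /=; last first.
    by rewrite -[LHS]normrN; congr `|_|; lra.
  by rewrite -[LHS]normrN; congr `|_|; lra.
by rewrite lee_fin /err !eC.
Qed.

Lemma approximableI E E' : approximable E -> approximable E' -> approximable (E `&` E').
Proof.
move=> [mE mE' h] [mG mG' h']; split.
- by rewrite preimage_setI; exact: measurableI.
- by rewrite preimage_setI; exact: measurableI.
move=> e e0; have e2 : 0 < e / 2 by rewrite divr_gt0.
have [F lF hF] := h _ e2; have [G lG hG] := h' _ e2.
exists (fun x => F x * G x); first exact: lipcyl_mul.
apply: (@le_trans _ _ (\int[P]_w ((err E F w)%:E + (err E' G w)%:E))%E).
  apply: le_integral_nonmeasurable => w; first by rewrite lee_fin err_ge0.
  have eI z : `|\1_(E `&` E') z - F z * G z| <= `|\1_E z - F z| + `|\1_E' z - G z|.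
    rewrite indicI /= ; set a : R := \1_E z; set b : R := \1_E' z.
    have /andP[a0 a1] : 0 <= a <= 1 by exact: indic01.
    have /andP[g0 g1] := lipcyl_01 lG z.
    have -> : a * b - F z * G z = (a - F z) * G z + a * (b - G z) by lra.
    apply: (le_trans (ler_normD _ _)); rewrite !normrM (ger0_norm a0) (ger0_norm g0).
    by apply: lerD; [exact: ler_piMr|exact: ler_piMl].
  rewrite -EFinD lee_fin /err.
  by have := eI (X w); have := eI (Y w); lra.
have mEF := measurable_err mE mE' lF.
have mEG := measurable_err mG mG' lG.
have m1 : measurable_fun setT (fun w => (err E F w)%:E) by exact/measurable_EFinP.
have m2 : measurable_fun setT (fun w => (err E' G w)%:E) by exact/measurable_EFinP.
have e1 w : setT w -> (0 <= (err E F w)%:E)%E by rewrite lee_fin err_ge0.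
have e1' w : setT w -> (0 <= (err E' G w)%:E)%E by rewrite lee_fin err_ge0.
rewrite (ge0_integralD P measurableT e1 m1 e1' m2).
by rewrite [e]splitr EFinD; exact: leeD.
Qed.

Lemma small_tail (D : (set Omega)^nat) (e : R) : (forall n, measurable (D n)) ->
  (forall n m, (n <= m)%N -> D m `<=` D n) -> \bigcap_n D n = set0 -> 0 < e ->
  exists n, (P (D n) <= e%:E)%E.
Proof.
move=> mD nD D0 e0.
have : P \o D @ \oo --> P (\bigcap_n D n).
  apply: nonincreasing_cvg_mu => //.
  - by rewrite (le_lt_trans (probability_le1 _ _))// ltry.
  - exact: bigcapT_measurable.
  - by move=> n m nm; apply/subsetPset; exact: nD.
rewrite D0 measure0 => /fine_cvgP[_ /cvgr0Pnorm_le /(_ _ e0)[n _ hn]].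
exists n; have /= := hn n (leqnn n); rewrite ger0_norm; last exact: fine_ge0.
by rewrite -lee_fin fineK// fin_num_measure.
Qed.

(** If E' differs from E along X or Y only on D, the error of F grows by at most
2 there. *)
Lemma err_tail E E' F (D : set Omega) (e : R) : 0 < e -> measurable D ->
  measurable (X @^-1` E) -> measurable (Y @^-1` E) -> lipcyl F ->
  (forall w, err E' F w <= err E F w + 2 * \1_D w) ->
  (\int[P]_w (err E F w)%:E <= (e / 2)%:E)%E -> (P D <= (e / 4)%:E)%E ->
  (\int[P]_w (err E' F w)%:E <= e%:E)%E.
Proof.
move=> e0 mD mE mE' lF h h1 h2.
apply: (@le_trans _ _ (\int[P]_w ((err E F w)%:E + 2%:E * (\1_D w)%:E))%E).
  apply: le_integral_nonmeasurable => w; first by rewrite lee_fin err_ge0.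
  by rewrite -EFinM -EFinD lee_fin.
have mEF := measurable_err mE mE' lF.
have m1 : measurable_fun setT (fun w => (err E F w)%:E) by exact/measurable_EFinP.
have e1 w : setT w -> (0 <= (err E F w)%:E)%E by rewrite lee_fin err_ge0.
have mD1 : measurable_fun setT (fun w => (\1_D w : R)%:E).
  by apply/measurable_EFinP; exact: measurable_indic.
have m2 : measurable_fun setT (fun w => (2%:E * (\1_D w)%:E)%E : \bar R) by exact: measurable_funeM.
have i0 w : setT w -> (0 <= (\1_D w : R)%:E)%E by rewrite lee_fin.
have e2 w : setT w -> (0 <= 2%:E * (\1_D w : R)%:E)%E by move=> _; rewrite mule_ge0 ?lee_fin.
have t0 : (0 <= 2%:E :> \bar R)%E by rewrite lee_fin.
rewrite (ge0_integralD P measurableT e1 m1 e2 m2) (ge0_integralZl P measurableT mD1 i0 t0).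
rewrite integral_indic// setIT.
apply: (@le_trans _ _ ((e / 2)%:E + 2%:E * (e / 4)%:E)%E).
  by apply: leeD => //; exact: lee_wpmul2l.
rewrite -EFinM -EFinD lee_fin; lra.
Qed.

(** The union differs from E n, along X or Y, on a set that decreases to the
empty set, hence has small probability for large n. *)
Lemma approximable_bigcup_nd (E : (set obs)^nat) : (forall n, approximable (E n)) ->
  (forall n m, (n <= m)%N -> E n `<=` E m) -> approximable (\bigcup_n E n).
Proof.
move=> aE ndE.
have mXE n : measurable (X @^-1` E n) by case: (aE n).
have mYE n : measurable (Y @^-1` E n) by case: (aE n).
have mXU : measurable (X @^-1` \bigcup_n E n).
  by rewrite preimage_bigcup; exact: bigcupT_measurable.
have mYU : measurable (Y @^-1` \bigcup_n E n).
  by rewrite preimage_bigcup; exact: bigcupT_measurable.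
split => // e e0.
pose D n := ((X @^-1` (\bigcup_n E n)) `\` (X @^-1` E n)) `|`
  ((Y @^-1` (\bigcup_n E n)) `\` (Y @^-1` E n)).
have mD n : measurable (D n) by apply: measurableU; exact: measurableD.
have nD n m : (n <= m)%N -> D m `<=` D n.
  by move=> nm w [] [h1 h2]; [left|right]; split => // h; apply: h2; exact: ndE nm _ h.
have D0 : \bigcap_n D n = set0.
  apply/seteqP; split => // w hw.
  have [hx|hx] := pselect ((\bigcup_n E n) (X w)); have [hy|hy] := pselect ((\bigcup_n E n) (Y w)).
  - case: hx hy => n _ hn [m _ hm].
    case: (hw (maxn n m) Logic.I) => -[_]; apply.
      by apply: ndE hn; exact: leq_maxl.
    by apply: ndE hm; exact: leq_maxr.
  - by case: hx => n _ hn; case: (hw n Logic.I) => -[].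
  - by case: hy => n _ hn; case: (hw n Logic.I) => -[].
  - by case: (hw 0%N Logic.I) => -[].
have e4 : 0 < e / 4 by rewrite divr_gt0.
have e2 : 0 < e / 2 by rewrite divr_gt0.
have [n hn] := small_tail mD nD D0 e4.
have [_ _ /(_ _ e2)[F lF hF]] := aE n.
exists F => //; apply: (err_tail e0 (mD n) (mXE n) (mYE n) lF) => // w.
have H z : \1_(E n) z = \1_(\bigcup_n E n) z :> R \/ (\bigcup_n E n) z /\ ~ E n z.
  have [hz|hz] := pselect (E n z).
    by left; rewrite !indicE !mem_set//; exists n.
  have [hz'|hz'] := pselect ((\bigcup_n E n) z); first by right.
  by left; rewrite !indicE !memNset.
have dist (a b c : R) : 0 <= a <= 1 -> 0 <= b <= 1 -> `|a - c| <= `|b - c| + 1.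
  move=> /andP[a0 a1] /andP[b0 b1]; rewrite -[a - c](subrKA b) addrC.
  apply: (le_trans (ler_normD _ _)); rewrite lerD2l ler_norml; lra.
have [hXw|hXw] := H (X w); have [hYw|hYw] := H (Y w).
- by rewrite /err hXw hYw lerDl mulr_ge0.
- rewrite (_ : \1_(D n) w = 1); last by rewrite indicE mem_set//; right.
  by rewrite /err hXw; have := dist _ _ (F (Y w)) (indic01 (\bigcup_n E n) (Y w)) (indic01 (E n) (Y w)); lra.
- rewrite (_ : \1_(D n) w = 1); last by rewrite indicE mem_set//; left.
  by rewrite /err hYw; have := dist _ _ (F (X w)) (indic01 (\bigcup_n E n) (X w)) (indic01 (E n) (X w)); lra.
- rewrite (_ : \1_(D n) w = 1); last by rewrite indicE mem_set//; left.
  have := dist _ _ (F (X w)) (indic01 (\bigcup_n E n) (X w)) (indic01 (E n) (X w)).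
  have := dist _ _ (F (Y w)) (indic01 (\bigcup_n E n) (Y w)) (indic01 (E n) (Y w)).
  rewrite /err; lra.
Qed.

Lemma approximable0 : approximable set0.
Proof.
split; rewrite ?preimage_set0// => e e0.
pose g0 : L2 R d := 0.
exists (fun x : obs => (fun=> 0) (x g0)).
  apply: (@lipcyl_coord _ _ g0 (fun=> 0) 0) => //.
  - by move=> t; rewrite lexx ler01.
  - by move=> s t; rewrite subrr normr0 mul0r.
rewrite (eq_integral (cst 0%E)) ?integral0 ?lee_fin ?ltW// => w _.
by rewrite /err !indic0 !subrr normr0 addr0.
Qed.

Lemma sigma_algebra_approximable : sigma_algebra setT approximable.
Proof.
split; first exact: approximable0.
  by move=> E aE; rewrite setTD; exact: approximableC.
move=> E aE.
have aU n : approximable (\bigcup_(i < n) E i).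
  elim: n => [|n IH].
    rewrite (_ : \bigcup_(i < 0) E i = set0); first exact: approximable0.
    by apply/seteqP; split => // x [i].
  rewrite (_ : \bigcup_(i < n.+1) E i = ~` (~` (\bigcup_(i < n) E i) `&` ~` E n)).
    by apply: approximableC; apply: approximableI; exact: approximableC.
  rewrite setCI !setCK; apply/seteqP; split => x.
    move=> [i /=]; rewrite ltnS leq_eqVlt => /orP[/eqP ->|ni] h; first by right.
    by left; exists i.
  move=> [[i /= ni h]|h]; last by exists n => /=.
  by exists i => //=; exact: ltnW.
rewrite (_ : \bigcup_i E i = \bigcup_n \bigcup_(i < n) E i).
  apply: approximable_bigcup_nd => // n m nm x [i /= ni h].
  by exists i => //=; exact: leq_trans nm.
apply/seteqP; split => x; last by move=> [n _ [i _ h]]; exists i.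
by move=> [i _ h]; exists i.+1 => //; exists i => //=.
Qed.

End cylinder_approximation.

Section cylinder_approximable.
Context {R : realType} (d : nat).
Context (dO : measure_display) (Omega : measurableType dO).
Variable P : probability Omega R.
Local Notation obs := (@observation R d).
Variables X Y : Omega -> obs.
Hypothesis mX : forall g, measurable_fun setT (fun w => X w g).
Hypothesis mY : forall g, measurable_fun setT (fun w => Y w g).

Let ramp (n : nat) (a t : R) : R := Num.min 1 (Num.max 0 (n.+1%:R * (t - a))).

Let ramp01 n a t : 0 <= ramp n a t <= 1.
Proof. by rewrite /ramp le_min ler01 le_max lexx ge_min lexx. Qed.

Let ramp_lip n a s t : `|ramp n a s - ramp n a t| <= n.+1%:R * `|s - t|.
Proof.
rewrite -[X in X * `|_|](ger0_norm (ler0n R n.+1)) -normrM.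
have -> : n.+1%:R * (s - t) = n.+1%:R * (s - a) - n.+1%:R * (t - a) by lra.
rewrite /ramp; set x := n.+1%:R * (s - a); set y := n.+1%:R * (t - a).
rewrite ler_norml; have := ler_norm (x - y); have := ler_norm (y - x); rewrite distrC.
rewrite /Num.min /Num.max.
by case: (ltP 0 x) => h1; case: (ltP 0 y) => h2; case: ltP => h3; case: ltP => h4; lra.
Qed.

Let measurable_ramp n a : measurable_fun setT (ramp n a).
Proof.
apply: measurable_minr => //; apply: measurable_maxr => //.
by apply: measurable_funM => //; exact: measurable_funB.
Qed.

(** Steep ramps approximate the indicator of the ray; the error is supported where
the coordinate is in ]a, a + 1/(n+1)[, which decreases to the empty set. *)
Lemma approximable_ray (g : L2 R d) (a : R) : approximable P X Y [set x : obs | a < x g].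
Proof.
have mr (Z : Omega -> obs) : (forall g, measurable_fun setT (fun w => Z w g)) ->
    forall c : R, measurable ((fun w => Z w g) @^-1` `]a, c[).
  by move=> mZ c; rewrite -[Q in measurable Q]setTI; exact: (mZ g measurableT _ (measurable_itv `]a, c[)).
have mr' (Z : Omega -> obs) : (forall g, measurable_fun setT (fun w => Z w g)) ->
    measurable (Z @^-1` [set x : obs | a < x g]).
  move=> mZ; rewrite (_ : _ @^-1` _ = (fun w => Z w g) @^-1` `]a, +oo[).
    by rewrite -[Q in measurable Q]setTI; exact: (mZ g measurableT _ (measurable_itv `]a, +oo[)).
  by apply/seteqP; split => w /=; rewrite in_itv/= andbT.
split; [exact: mr'|exact: mr'|move=> e e0].
pose c n : R := a + n.+1%:R^-1.
pose D n := ((fun w => X w g) @^-1` `]a, c n[) `|` ((fun w => Y w g) @^-1` `]a, c n[).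
have mD n : measurable (D n) by apply: measurableU; exact: mr.
have nD n m : (n <= m)%N -> D m `<=` D n.
  move=> nm w; have cc : c m <= c n by rewrite lerD2l lef_pV2 ?posrE// ler_nat.
  by move=> [] /=; rewrite in_itv/= => /andP[h1 h2]; [left|right];
    rewrite /= in_itv/= h1 (lt_le_trans h2).
have D0 : \bigcap_n D n = set0.
  apply/seteqP; split => // w hw.
  have lim t : a < t -> exists n, c n <= t.
    move=> at_.
    by have [n /ltW hn] := ltr_add_invr at_; exists n.
  have [n hn] : exists n, a < X w g -> c n <= X w g.
    have [/lim[n hn]|] := boolP (a < X w g); first by exists n.
    by exists 0%N.
  have [m hm] : exists n, a < Y w g -> c n <= Y w g.
    have [/lim[k hk]|] := boolP (a < Y w g); first by exists k.
    by exists 0%N.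
  have [] := hw (maxn n m) Logic.I; rewrite /= in_itv/= => /andP[h1 h2].
    have := hn h1; apply/negP; rewrite -ltNge (lt_le_trans h2)// lerD2l lef_pV2 ?posrE//.
    by rewrite ler_nat ltnS leq_maxl.
  have := hm h1; apply/negP; rewrite -ltNge (lt_le_trans h2)// lerD2l lef_pV2 ?posrE//.
  by rewrite ler_nat ltnS leq_maxr.
have e2 : 0 < e / 2 by rewrite divr_gt0.
have [n hn] := small_tail P mD nD D0 e2.
exists (fun x : obs => ramp n a (x g)).
  exact: (@lipcyl_coord _ _ g (ramp n a) n.+1%:R (measurable_ramp n a) (ramp01 n a)
    (ler0n _ _) (ramp_lip n a)).
have H Z w : `|\1_[set x : obs | a < x g] (Z w) - ramp n a ((Z w : obs) g)| <=
    \1_((fun w : Omega => Z w g) @^-1` `]a, c n[) w :> R.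
  rewrite !indicE.
  have n0 : 0 < n.+1%:R :> R by [].
  have [h|h] := ltP a (Z w g); last first.
    rewrite memNset/=; last by rewrite ltNge h.
    rewrite /ramp max_l; last by rewrite mulr_ge0_le0// subr_le0.
    by rewrite min_r ?ler01// subrr normr0.
  rewrite mem_set//=.
  have [h'|h'] := ltP (Z w g) (c n).
    rewrite mem_set/=; last by rewrite in_itv/= h.
    by have /andP[] := ramp01 n a (Z w g); rewrite ler_norml; lra.
  rewrite memNset/=; last by rewrite in_itv/= h/= ltNge h'.
  rewrite /ramp max_r; last by rewrite mulr_ge0// subr_ge0 ltW.
  rewrite min_l ?subrr ?normr0//.
  by rewrite -ler_pdivrMl// mulr1 lerBrDl.
apply: (@le_trans _ _ (\int[P]_w (2%:E * (\1_(D n) w)%:E))%E).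
  apply: le_integral_nonmeasurable => w; first by rewrite lee_fin err_ge0.
  rewrite -EFinM lee_fin /err.
  have := H X w; have := H Y w.
  have hU (A B : set Omega) : \1_A w + \1_B w <= 2 * \1_(A `|` B) w :> R.
    have [hA|hA] := pselect (A w); have [hB|hB] := pselect (B w);
      rewrite !indicE ?(mem_set hA) ?(memNset hA) ?(mem_set hB) ?(memNset hB)/=.
    - by rewrite mem_set/=; [lra|left].
    - by rewrite mem_set/=; [lra|left].
    - by rewrite mem_set/=; [lra|right].
    - by rewrite memNset/=; [lra|case].
  have := hU ((fun w => X w g) @^-1` `]a, c n[) ((fun w => Y w g) @^-1` `]a, c n[).
  rewrite -/(D n); lra.
have i0 w : setT w -> (0 <= (\1_(D n) w : R)%:E)%E by rewrite lee_fin.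
have t0 : (0 <= 2%:E :> \bar R)%E by rewrite lee_fin.
have mD1 : measurable_fun setT (fun w => (\1_(D n) w : R)%:E).
  by apply/measurable_EFinP; exact: measurable_indic.
rewrite (ge0_integralZl P measurableT mD1 i0 t0) integral_indic// setIT.
apply: (@le_trans _ _ (2%:E * (e / 2)%:E)%E); first exact: lee_wpmul2l.
by rewrite -EFinM lee_fin; lra.
Qed.

Lemma approximable_cylinder (E : set obs) : @cylinder R d E -> approximable P X Y E.
Proof.
have [s0 sC sU] := @sigma_algebra_approximable R d dO Omega P X Y mX mY.
move: E; apply: smallest_sub; first by split.
move=> E [g _ [B mB <-]]; rewrite setTI.
pose G := [set B : set R | approximable P X Y ((fun x : obs => x g) @^-1` B)].
suff : <<s @RGenOInfty.G R >> `<=` G.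
  apply; have mB' : (ocitv (R:=R)).-sigma.-measurable B by exact: mB.
  by move: mB'; rewrite RGenOInfty.measurableE.
apply: smallest_sub.
  split; rewrite /G /=.
  - by rewrite preimage_set0.
  - by move=> A aA; have := sC _ aA; rewrite !setTD.
  - by move=> A aA; rewrite preimage_bigcup; exact: sU.
move=> _ [a ->]; rewrite /G /=.
rewrite (_ : _ @^-1` _ = [set x : obs | a < x g]); first exact: approximable_ray.
by apply/seteqP; split => x /=; rewrite in_itv/= andbT.
Qed.

End cylinder_approximable.

Section observe_shift_event.
Context {R : realType} (d : nat).
Context (dO : measure_display) (Omega : measurableType dO).
Variable P : probability Omega R.
Variable W : set (Rd R d) -> Omega -> R.
Hypothesis W_noise : white_noise P W.
Variable Wint : L2 R d -> Omega -> R.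
Hypothesis Wint_integral : forall g : L2 R d, wiener_integral P W g (Wint g).
Local Notation nu := (@lebesgue_measure_Rd R d).
Local Notation Lf2 := (Lfun nu 2%:E).

Lemma measurable_cylinder_observe eps f E : @cylinder R d E ->
  measurable (observe Wint eps f @^-1` E).
Proof.
by move=> /(@approximable_cylinder _ _ _ _ P _ _ (measurable_observe Wint_integral eps f)
  (measurable_observe Wint_integral eps f))[].
Qed.

(** The inequality for a function F close to the indicator of E along both
observations, up to an arbitrary error. *)
Lemma observe_shift_event (eps lam : R) (f0 h : Rd R d -> R) (E : set (@observation R d)) :
  0 <= eps -> 0 < lam -> f0 \in Lf2 -> h \in Lf2 -> cylinder E ->
  (2%:E * P (observe Wint eps (fun x => f0 x + eps * h x)%R @^-1` E) <=
   lam%:E * P (observe Wint eps f0 @^-1` E) + (expR (ip nu h h) / lam)%:E)%E.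
Proof.
move=> eps0 lam0 f02 h2 cE.
set X := observe Wint eps (fun x => f0 x + eps * h x).
set Y := observe Wint eps f0.
have mX g : measurable_fun setT (fun w => X w g) by exact: measurable_observe.
have mY g : measurable_fun setT (fun w => Y w g) by exact: measurable_observe.
have [mXE mYE aE] := @approximable_cylinder _ _ _ _ P _ _ mX mY _ cE.
have [x xE] : exists x, P (X @^-1` E) = x%:E.
  by exists (fine (P (X @^-1` E))); rewrite fineK// fin_num_measure.
have [y yE] : exists x, P (Y @^-1` E) = x%:E.
  by exists (fine (P (Y @^-1` E))); rewrite fineK// fin_num_measure.
rewrite xE yE -!EFinM -EFinD lee_fin.
apply/ler_addgt0Pr => t t0.
pose e := t / (2 + lam).
have l2 : 0 < 2 + lam by rewrite addr_gt0.
have e0 : 0 < e by rewrite divr_gt0.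
have [F lF hF] := aE _ e0.
have F0 z : 0 <= F z by case/andP: (lipcyl_01 lF z).
have key := observe_shift_lipcyl W_noise Wint_integral eps0 lam0 f02 h2 lF.
rewrite -/X -/Y in key.
have mFX := measurable_lipcylX mX lF.
have mFY := measurable_lipcylX mY lF.
have mEX := measurable_indic_pre mXE.
have mEY := measurable_indic_pre mYE.
have PX : (\int[P]_w (\1_E (X w) : R)%:E = x%:E)%E.
  by rewrite -xE -[X @^-1` E]setIT -(integral_indic P measurableT mXE).
have PY : (\int[P]_w (\1_E (Y w) : R)%:E = y%:E)%E.
  by rewrite -yE -[Y @^-1` E]setIT -(integral_indic P measurableT mYE).
have i1 := integral_le_dist P mEX mFX (fun w => ler0n _ _) (fun w => F0 _).
have i2 := integral_le_dist P mFY mEY (fun w => F0 _) (fun w => ler0n _ _).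
have d1 : (\int[P]_w `|\1_E (X w) - F (X w)|%:E <= e%:E)%E.
  apply: le_trans hF; apply: le_integral_nonmeasurable => w; rewrite lee_fin//.
  by rewrite /err lerDl.
have d2 : (\int[P]_w `|F (Y w) - \1_E (Y w)|%:E <= e%:E)%E.
  apply: le_trans hF; apply: le_integral_nonmeasurable => w; rewrite lee_fin//.
  by rewrite /err distrC lerDr.
move: i1; rewrite PX => /le_trans/(_ (leeD2l _ d1)) i1.
move: i2; rewrite PY => /le_trans/(_ (leeD2l _ d2)) i2.
have [v vE] : exists v, (\int[P]_w (F (Y w))%:E = v%:E)%E.
  exists (fine (\int[P]_w (F (Y w))%:E)); rewrite fineK// ge0_fin_numE.
    by apply: le_lt_trans i2 _; rewrite -EFinD ltry.
  by apply: integral_ge0 => w _; rewrite lee_fin.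
have [u uE] : exists v, (\int[P]_w (F (X w))%:E = v%:E)%E.
  exists (fine (\int[P]_w (F (X w))%:E)); rewrite fineK// ge0_fin_numE.
    move: key; rewrite vE -EFinM -EFinD.
    case: (\int[P]_w (F (X w))%:E)%E => [r _||]; rewrite ?ltry//.
    by rewrite gt0_muley ?lte_fin// leye_eq.
  by apply: integral_ge0 => w _; rewrite lee_fin.
move: i1; rewrite uE -EFinD lee_fin => i1.
move: i2; rewrite vE -EFinD lee_fin => i2.
move: key; rewrite uE vE -!EFinM -EFinD lee_fin => key.
have lv : lam * v <= lam * (y + e) by rewrite ler_wpM2l// ltW.
have te : t = 2 * e + lam * e by rewrite -mulrDl /e mulrCA mulfV ?mulr1// gt_eqF.
rewrite te; move: lv; rewrite mulrDr; lra.
Qed.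

End observe_shift_event.

(** * Smooth profiles on the line *)

Section smooth_line.
Context {R : realType}.
Implicit Types (phi psi : R -> R) (t u : R).

Lemma is_derive_quad phi t (l : R) :
  (forall h, `|phi (t + h) - phi t - h * l| <= h ^+ 2) -> is_derive t 1 phi l.
Proof.
move=> hq.
have H : (fun h : R => h^-1 *: ((phi \o shift t) (h *: 1) - phi t)) @ 0^' --> l.
  apply/cvgrPdist_le => e e0; near=> h.
  have h0 : h != 0 by near: h; exact: nbhs_dnbhs_neq.
  have he : `|h| <= e by near: h; exact: dnbhs0_le.
  apply: le_trans he; rewrite /= [h%:A]mulr1 [h + t]addrC.
  set D := phi (t + h) - phi t.
  have E : D - h * l = - (h * (l - h^-1 *: D)).
    by rewrite mulrBr [h * (_ *: _)]mulrA mulfV// mul1r; lra.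
  have := hq h; rewrite -/D E normrN normrM.
  by rewrite -real_normK ?num_real// expr2 ler_pM2l ?normr_gt0.
apply: DeriveDef; first by apply/cvg_ex; exists l.
exact: cvg_lim H.
Unshelve. all: by end_near. Qed.

(** The truncated power, with n - 1 continuous derivatives. Powers suffice for the
profile of the bumps: the order of the differences to control is fixed by beta. *)
Definition ppow n t : R := Num.max t 0 ^+ n.

(** For n = 0 the remainder of max(t, 0)^2 at order one is at most the square of
the increment; the product rule does the rest. *)
Lemma is_derive_ppow n t : is_derive t 1 (ppow n.+2) (n.+2%:R * ppow n.+1 t).
Proof.
elim: n => [|n IH].
  apply: is_derive_quad => h; rewrite /ppow expr1 /Num.max ler_norml.
  by case: ltP => h1; case: ltP => h2; nra.
rewrite (_ : ppow n.+3 = id * ppow n.+2); last first.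
  apply/funext => s; rewrite /ppow /GRing.mul/= [LHS]exprS /Num.max.
  by case: ltP => // _; rewrite expr0n/= !mulr0.
apply: is_derive_eq.
rewrite /= [_%:A]mulr1 /GRing.scale/=.
rewrite mulrCA.
have -> : t * ppow n.+1 t = ppow n.+2 t.
  by rewrite /ppow [RHS]exprS /Num.max; case: ltP => // _; rewrite expr0n /= !mulr0 ?mul0r.
have -> : n.+3%:R = n.+2%:R + 1 :> R by rewrite natr1.
by rewrite [RHS]mulrDl mul1r.
Qed.

(** The k-th derivative of phi exists and is bounded by M. No continuity is asked
of it, as the mean value theorem needs none. *)
Fixpoint bdiff k (M : R) phi : Prop :=
  match k with
  | 0 => forall t, `|phi t| <= M
  | k'.+1 => exists2 psi, forall t, is_derive t 1 phi (psi t) & bdiff k' M psi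
  end.

Definition dif u phi : R -> R := fun t => phi (t + u) - phi t.

(** The mean value theorem trades one derivative for a factor |u|. *)
Lemma bdiff_dif k M phi u : bdiff k.+1 M phi -> bdiff k (M * `|u|) (dif u phi).
Proof.
elim: k phi => [|k IH] phi [psi dphi] /=; last first.
  move=> [psi' dpsi h]; exists (dif u psi); last by apply: IH; exists psi'.
  move=> t; rewrite /dif.
  have h1 : is_derive t 1 (fun s => phi (s + u)) (psi (t + u)).
    have := @is_derive1_comp R phi (fun s => s + u) t (psi (t + u)) 1 (dphi _) _.
    rewrite mulr1; apply.
    have := @is_deriveD R R R id (cst u) t 1 1 0; rewrite addr0; apply.
  exact: is_deriveB.
move=> hM t; rewrite /dif.
have cont a b : {within `[a, b], continuous phi}.
  apply: continuous_subspaceT => x.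
  by apply: differentiable_continuous; apply/derivable1_diffP; case: (dphi x).
have [u0|u0] := leP 0 u.
  have [|c _ ->] := @MVT_segment R phi psi t (t + u) _ (fun x _ => dphi x) (cont _ _).
    by rewrite lerDl.
  by rewrite normrM ler_pM// addrAC subrr add0r.
have [|c _] := @MVT_segment R phi psi (t + u) t _ (fun x _ => dphi x) (cont _ _).
  by rewrite gerDl ltW.
rewrite -[X in X <= _]normrN opprB => ->.
by rewrite normrM ler_pM// opprD addrA subrr sub0r normrN.
Qed.

Lemma bdiff_iter k M phi u t : bdiff k M phi -> `|iter k (dif u) phi t| <= M * `|u| ^+ k.
Proof.
elim: k M phi => [|k IH] M phi; first by move=> /= h; rewrite expr0 mulr1.
by move=> h; have := IH _ _ (@bdiff_dif k M phi u h); rewrite iterSr exprS mulrA.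
Qed.

Lemma iter_dif_bounded k M phi u t : (forall s, `|phi s| <= M) ->
  `|iter k (dif u) phi t| <= 2 ^+ k * M.
Proof.
elim: k M phi => [|k IH] M phi h; first by rewrite mul1r.
rewrite iterSr exprSr -mulrA; apply: IH => s; rewrite /dif.
by apply: (le_trans (ler_normB _ _)); have := h (s + u); have := h s; lra.
Qed.

(** Functions supported in ]0, 1[ whose k-th derivative exists and is bounded. *)
Fixpoint usmooth k phi : Prop :=
  (forall t, ~~ (0 < t < 1) -> phi t = 0) /\
  match k with
  | 0 => exists M, forall t, `|phi t| <= M
  | k'.+1 => exists2 psi, forall t, is_derive t 1 phi (psi t) & usmooth k' psi
  end.

Lemma usmooth_supp k phi : usmooth k phi -> forall t, ~~ (0 < t < 1) -> phi t = 0.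
Proof. by case: k => [|k] []. Qed.

Lemma usmooth_lin k phi psi a c : usmooth k phi -> usmooth k psi ->
  usmooth k (fun t => a * phi t + c * psi t).
Proof.
elim: k phi psi => [|k IH] phi psi [s1 h1] [s2 h2]; split.
- by move=> t ht; rewrite s1// s2// !mulr0 addr0.
- case: h1 h2 => M hM [M' hM']; exists (`|a| * M + `|c| * M') => t.
  by apply: (le_trans (ler_normD _ _)); rewrite !normrM lerD// ler_wpM2l.
- by move=> t ht; rewrite s1// s2// !mulr0 addr0.
- case: h1 h2 => phi' d1 h1 [psi' d2 h2].
  exists (fun t => a * phi' t + c * psi' t); last exact: IH.
  by move=> t; apply: is_deriveD; apply: is_deriveZ.
Qed.

Definition mono a b t := ppow a t * ppow b (1 - t).

Lemma usmooth_mono k a b : (k < a)%N -> (k < b)%N -> usmooth k (mono a b).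
Proof.
have supp a' b' : (0 < a')%N -> (0 < b')%N -> forall t, ~~ (0 < t < 1) -> mono a' b' t = 0.
  move=> a0 b0 t; rewrite negb_and -!leNgt /mono /ppow => /orP[h|h].
    by rewrite max_r// expr0n gtn_eqF// mul0r.
  by rewrite (@max_r _ _ (1 - t)) ?subr_le0// [X in _ * X]expr0n gtn_eqF// mulr0.
elim: k a b => [|k IH] a b ka kb; split; try by apply: supp; apply: leq_ltn_trans (leq0n _) _; eassumption.
  exists 1 => t; have [/andP[t0 t1]|ht] := boolP (0 < t < 1); last by rewrite supp// normr0.
  have t1' : 0 <= 1 - t by rewrite subr_ge0 ltW.
  rewrite /mono /ppow (max_l (ltW t0)) (max_l t1') ger0_norm ?mulr_ge0 ?exprn_ge0 ?(ltW t0)//.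
  apply: mulr_ile1; rewrite ?exprn_ge0 ?(ltW t0)//; apply: exprn_ile1; rewrite ?(ltW t0) ?(ltW t1)//.
  by rewrite gerBl ltW.
case: a ka => [//|[//|a]] ka; case: b kb => [//|[//|b]] kb.
exists (fun t => a.+2%:R * mono a.+1 b.+2 t + (- b.+2%:R) * mono a.+2 b.+1 t); last first.
  by apply: usmooth_lin; apply: IH => //; exact: ltnW.
move=> t.
have d1 := is_derive_ppow a t.
have d2 : is_derive t 1 (fun s => ppow b.+2 (1 - s)) (- (b.+2%:R * ppow b.+1 (1 - t))).
  have := @is_derive1_comp R (ppow b.+2) (fun s => 1 - s) t _ (-1) (is_derive_ppow b (1 - t)) _.
  rewrite mulrN1; apply.
  have := @is_deriveB R R R (cst 1) id t 1 0 1; rewrite sub0r; apply.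
have := @is_deriveM R R _ _ t 1 _ _ d1 d2.
set v := (X in is_derive _ _ _ X -> _); rewrite (_ : v = a.+2%:R * mono a.+1 b.+2 t + (- b.+2%:R) * mono a.+2 b.+1 t)//.
by rewrite /v /GRing.scale/= /mono; lra.
Qed.

End smooth_line.

(** * Bumps on the cells of a grid *)

Section translates.
Context {R : realType}.
Implicit Types phi psi : R -> R.

Lemma bdiff_scale k M phi (c : R) : 0 <= c -> bdiff k M phi ->
  bdiff k (c * M) (fun t => c * phi t).
Proof.
move=> c0; elim: k phi => [|k IH] phi /=.
  by move=> h t; rewrite normrM (ger0_norm c0) ler_wpM2l.
by move=> [psi d h]; exists (fun t => c * psi t); [move=> t; exact: is_deriveZ|exact: IH].
Qed.

Lemma is_derive_bigsum (J : Type) (s : seq J) (F dF : J -> R -> R) (t : R) :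
  (forall z, is_derive t 1 (F z) (dF z t)) ->
  is_derive t 1 (fun t => \sum_(z <- s) F z t) (\sum_(z <- s) dF z t).
Proof.
move=> d; elim: s => [|z s IH].
  by rewrite big_nil; under eq_fun do rewrite big_nil; exact: is_derive_cst.
by rewrite big_cons; under eq_fun do rewrite big_cons; exact: is_deriveD.
Qed.

(** At every point at most one term of the sum and of its derivatives is nonzero,
so the bound of a single profile holds whatever the number of terms. *)
Lemma bdiff_translates k phi : usmooth k phi -> exists2 M : R, 0 <= M &
  forall (J : finType) (C s : J -> R) (h : R), 0 < h -> (forall z, `|C z| <= 1) ->
  (forall z z' t, C z != 0 -> C z' != 0 -> 0 < t / h + s z < 1 ->
     0 < t / h + s z' < 1 -> z = z') ->
  bdiff k (M / h ^+ k) (fun t => \sum_z C z * phi (t / h + s z)).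
Proof.
elim: k phi => [|k IH] phi [supp].
  move=> [M hM]; have M0 : 0 <= M by apply: le_trans (hM 0).
  exists M => // J C s h h0 C1 dis t; rewrite /= expr0 divr1.
  have [[z /andP[Cz tz]]|nz] := pselect (exists z, (C z != 0) && (0 < t / h + s z < 1)).
    rewrite (bigD1 z)//= big1 ?addr0.
      by rewrite normrM -[leRHS]mul1r ler_pM.
    move=> z' zz'; have [->|Cz'] := eqVneq (C z') 0; first by rewrite mul0r.
    rewrite supp ?mulr0//; apply/negP => tz'.
    by move: zz'; rewrite (dis z z' t)// eqxx.
  rewrite big1 ?normr0// => z _.
  have [->|Cz] := eqVneq (C z) 0; first by rewrite mul0r.
  by rewrite supp ?mulr0//; apply/negP => tz; apply: nz; exists z; rewrite Cz.
move=> [psi dphi /IH[M M0 hM]]; exists M => // J C s h h0 C1 dis.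
exists (fun t => h^-1 * \sum_z C z * psi (t / h + s z)); last first.
  have := bdiff_scale (c := h^-1) _ (hM J C s h h0 C1 dis).
  by rewrite mulrCA exprS invfM; apply; rewrite invr_ge0 ltW.
move=> t.
rewrite mulr_sumr; apply: (@is_derive_bigsum _ _ (fun z t => C z * phi (t / h + s z))
  (fun z t => h^-1 * (C z * psi (t / h + s z)))) => z.
rewrite mulrCA; apply: is_deriveZ.
have := @is_derive1_comp R phi (fun t => t / h + s z) t _ h^-1 (dphi _) _.
rewrite [_ * h^-1]mulrC; apply.
have := @is_deriveD R R R (fun t => t / h) (cst (s z)) t 1 h^-1 0; rewrite addr0; apply.
rewrite (_ : (fun t => t / h) = h^-1 \*: id); last by apply/funext => u; rewrite /= mulrC.
by have := @is_deriveZ R R R id h^-1 t 1 1 _; rewrite [_%:A]mulr1; apply.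
Qed.

End translates.

Section lines.
Context {R : realType} (d : nat).
Implicit Types (f : Rd R d -> R) (x : Rd R d).

Lemma shift_tupleD u t j x : Defs.shift u j (Defs.shift t j x) = Defs.shift (t + u) j x.
Proof.
by apply: eq_from_tnth => i; rewrite !tnth_mktuple mulrDl addrA.
Qed.

Lemma shift_tuple0 j x : Defs.shift 0 j x = x.
Proof. by apply: eq_from_tnth => i; rewrite !tnth_mktuple mul0r addr0. Qed.

Lemma iter_Delta_line k u j f x t :
  iter k (Delta u j) f (Defs.shift t j x) = iter k (dif u) (fun s => f (Defs.shift s j x)) t.
Proof.
elim: k t => [//|k IH] t; rewrite !iterS /dif -!IH.
by rewrite {1}/Delta shift_tupleD.
Qed.

Lemma iter_Delta_eq0 k u j f x :
  (forall i, (i <= k)%N -> f (Defs.shift (i%:R * u) j x) = 0) -> iter k (Delta u j) f x = 0.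
Proof.
elim: k f => [|k IH] f h /=; first by have := h 0%N (leqnn 0); rewrite mul0r shift_tuple0.
rewrite -iterS iterSr; apply: IH => i ik; rewrite /Delta shift_tupleD.
rewrite h ?subr0; last exact: leqW.
by have := h i.+1 ik; rewrite -natr1 mulrDl mul1r.
Qed.

End lines.

Section bumps.
Context {R : realType} (d : nat).
Variables (b : R) (a : nat) (h : 'I_d -> R).
Hypotheses (a0 : (0 < a)%N) (h0 : forall i, 0 < h i).
Implicit Types (c : 'I_d -> nat) (x : Rd R d).

Local Notation lam := (@mono R a a).
Local Notation coord x c i := ((tnth x i + b) / h i - (c i)%:R).

(** A product of one-dimensional profiles, on the cell of side lengths h whose
lower corner is at c in units of h, counted from the corner of the cube. *)
Definition cellbump c x : R := \prod_i lam ((tnth x i + b) / h i - (c i)%:R).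

Lemma lam_supp (t : R) : ~~ (0 < t < 1) -> lam t = 0.
Proof. by apply: (usmooth_supp (k := 0)); exact: usmooth_mono. Qed.

Lemma lam01 (t : R) : 0 <= lam t <= 1.
Proof.
have [/andP[t0 t1]|ht] := boolP (0 < t < 1); last by rewrite lam_supp// lexx ler01.
have t1' : 0 <= 1 - t by rewrite subr_ge0 ltW.
rewrite /mono /ppow (max_l (ltW t0)) (max_l t1').
rewrite mulr_ge0 ?exprn_ge0 ?(ltW t0)//=.
apply: mulr_ile1; rewrite ?exprn_ge0 ?(ltW t0)//; apply: exprn_ile1; rewrite ?(ltW t0) ?(ltW t1)//.
by rewrite gerBl ltW.
Qed.

Lemma lam_ge (t : R) : 4^-1 <= t <= 3 / 4 -> (16^-1) ^+ a <= lam t.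
Proof.
move=> /andP[t1 t2]; rewrite /mono /ppow !max_l; try lra.
rewrite -exprMn lerXn2r ?nnegrE ?mulr_ge0 ?invr_ge0//; nra.
Qed.

Lemma cellbump01 c x : 0 <= cellbump c x <= 1.
Proof.
apply/andP; split; first by apply: prodr_ge0 => i _; case/andP: (lam01 (coord x c i)).
by rewrite prodr_ile1// => i _; exact: lam01.
Qed.

Lemma cellbump_neq0 c x : cellbump c x != 0 -> forall i, 0 < coord x c i < 1.
Proof.
move=> /prodf_neq0 bx i; apply/negPn/negP => /lam_supp E.
by have := bx i erefl; rewrite E eqxx.
Qed.

Lemma floor_uniq (y : R) (m n : nat) : 0 < y - m%:R < 1 -> 0 < y - n%:R < 1 -> m = n.
Proof.
move=> /andP[m0 m1] /andP[n0 n1].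
have : (m < n.+1)%N by rewrite -(ltr_nat R) -natr1; lra.
have : (n < m.+1)%N by rewrite -(ltr_nat R) -natr1; lra.
by rewrite !ltnS => h1 h2; apply/eqP; rewrite eqn_leq h1 h2.
Qed.

Lemma cellbump_disjoint c c' x : cellbump c x != 0 -> cellbump c' x != 0 -> c =1 c'.
Proof.
move=> /cellbump_neq0 h1 /cellbump_neq0 h2 i; exact: floor_uniq (h1 i) (h2 i).
Qed.

Lemma measurable_cellbump c : measurable_fun setT (cellbump c).
Proof.
have mp n : measurable_fun setT (@ppow R n).
  by apply: measurable_funX; apply: measurable_maxr.
apply: measurable_prod => i _; apply: measurable_funM.
  apply: measurableT_comp (mp a) _; apply: measurable_funB => //.
  by apply: measurable_funM => //; apply: measurable_funD => //; exact: measurable_tnth.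
apply: measurableT_comp (mp a) _; apply: measurable_funB => //; apply: measurable_funB => //.
by apply: measurable_funM => //; apply: measurable_funD => //; exact: measurable_tnth.
Qed.

(** The part of the cell c whose coordinates relative to the cell lie in [s, t]. *)
Definition subcell s t c : set (Rd R d) :=
  cbox (fun i => ((c i)%:R + s) * h i - b) (fun i => ((c i)%:R + t) * h i - b).

Lemma mem_subcell s t c x : subcell s t c x <-> forall i, s <= coord x c i <= t.
Proof.
split => hx i; have := hx i.
  move=> /andP[h1 h2]; rewrite lerBrDl lerBlDl ler_pdivlMr// ler_pdivrMr//; lra.
rewrite lerBrDl lerBlDl ler_pdivlMr// ler_pdivrMr//; lra.
Qed.

Lemma lebesgue_subcell s t c : s <= t ->
  lebesgue_measure_Rd d (subcell s t c) = ((t - s) ^+ d * \prod_i h i)%:E.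
Proof.
move=> st; rewrite lebesgue_cbox; last first.
  by move=> j; rewrite lerD2r ler_wpM2r ?(ltW (h0 j))// lerD2l.
congr EFin; rewrite -[X in (t - s) ^+ X]card_ord -prodr_const -big_split /=.
by apply: eq_bigr => i _; lra.
Qed.

Lemma cellbump_outside c x : ~ subcell 0 1 c x -> cellbump c x = 0.
Proof.
move=> hx; apply/eqP/negPn/negP => /cellbump_neq0 h1; apply: hx; apply/mem_subcell => i.
by have /andP[/ltW -> /ltW ->] := h1 i.
Qed.

Lemma cellbump_middle c x : subcell 4^-1 (3 / 4) c x -> (16^-1) ^+ (a * d) <= cellbump c x.
Proof.
move=> /mem_subcell hx.
rewrite exprM -[X in _ ^+ X]card_ord -prodr_const; apply: ler_prod => i _.
by rewrite exprn_ge0 ?invr_ge0//= lam_ge.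
Qed.

End bumps.

(** * Bump sums in the Nikolskii class *)

Lemma measure_bigsetU_le dT (T : measurableType dT) (R : realType)
    (mu : {measure set T -> \bar R}) (J : Type) (s : seq J) (B : J -> set T) :
  (forall z, measurable (B z)) ->
  (mu (\big[setU/set0]_(z <- s) B z) <= \sum_(z <- s) mu (B z))%E.
Proof.
move=> mB; elim: s => [|z s IH]; first by rewrite !big_nil measure0.
rewrite !big_cons; apply: le_trans (measureU2 _ (mB z) _) _; last exact: leeD2l.
exact: bigsetU_measurable.
Qed.

Section bump_sums.
Context {R : realType} (d : nat).
Variables (b : R) (a : nat) (h : 'I_d -> R).
Hypotheses (a0 : (0 < a)%N) (h0 : forall i, 0 < h i).
Variables (J : finType) (c : J -> 'I_d -> nat).
Hypothesis c_inj : forall z z', c z =1 c z' -> z = z'.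
Variables (A : R).
Hypothesis A0 : 0 <= A.
Local Notation nu := (@lebesgue_measure_Rd R d).
Local Notation V := (\prod_i h i).
Implicit Types (x : Rd R d).

Definition bump_sum (x : Rd R d) : R := A * \sum_z cellbump b a h (c z) x.

Lemma bump_sum_at z x : cellbump b a h (c z) x != 0 -> bump_sum x = A * cellbump b a h (c z) x.
Proof.
move=> bz; rewrite /bump_sum (bigD1 z)//= big1 ?addr0// => z' zz'.
apply/eqP/negPn/negP => bz'; move: zz'; rewrite (@c_inj z' z) ?eqxx//.
exact: cellbump_disjoint bz' bz.
Qed.

Lemma bump_sum_range x : 0 <= bump_sum x <= A.
Proof.
have [[z bz]|nz] := pselect (exists z, cellbump b a h (c z) x != 0).
  rewrite (bump_sum_at bz); have /andP[b0 b1] := cellbump01 b h a0 (c z) x.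
  by rewrite mulr_ge0//= ler_piMr.
rewrite /bump_sum big1 ?mulr0 ?lexx//= => z _.
by apply/eqP/negPn/negP => bz; apply: nz; exists z.
Qed.

Lemma bump_sum_outside x : (forall z, ~ subcell b h 0 1 (c z) x) -> bump_sum x = 0.
Proof. by move=> hx; rewrite /bump_sum big1 ?mulr0// => z _; exact: cellbump_outside. Qed.

Let V0 : 0 < V. Proof. by apply: prodr_gt0 => i _. Qed.

Lemma Lnorm_bump_sum (r : \bar R) : (1 <= r)%E -> (0 < #|J|)%N ->
  ('N[nu]_r[EFin \o bump_sum] <= (A * (#|J|%:R * V) `^ fine r^-1%E)%:E)%E.
Proof.
move=> r1 J0.
pose B z := subcell b h 0 1 (c z).
have mB z : measurable (B z) by exact: measurable_cbox.
have nuB z : nu (B z) = V%:E by rewrite lebesgue_subcell// ?subr0 ?expr1n ?mul1r.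
pose D := \big[setU/set0]_(z <- enum J) B z.
have BD z : B z `<=` D.
  by move=> x Bx; rewrite /D -bigcup_seq; exists z => //=; rewrite mem_enum.
have [z0 _] := card_gt0P J0.
apply: (@Lnorm_le_support _ _ _ _ _ D) => //.
- exact: bigsetU_measurable.
- apply/andP; split.
    apply: (@lt_le_trans _ _ (nu (B z0))); first by rewrite nuB lte_fin.
    by apply: le_measure; rewrite ?inE//; exact: bigsetU_measurable.
  apply: (le_trans (measure_bigsetU_le nu _ mB)).
  rewrite (eq_bigr (fun=> V%:E) (fun z _ => nuB z)).
  by rewrite sumEFin lee_fin big_const_seq count_predT iter_addr_0 -cardE -[leLHS]mulr_natl.
- by move=> x; have /andP[f0 f1] := bump_sum_range x; rewrite ger0_norm.
- by move=> x nD; apply: bump_sum_outside => z hz; apply: nD; exact: (BD z).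
Qed.

End bump_sums.

Section bump_sum_difference.
Context {R : realType} (d : nat).

(** Along a line in direction j the bump sum is a sum of translates of one
profile, the other coordinates giving coefficients in [0, 1]. *)
Lemma bump_sum_Delta (a k : nat) : (k < a)%N -> exists2 M : R, 0 <= M &
  forall (b : R) (h : 'I_d -> R) (J : finType) (c : J -> 'I_d -> nat) (A : R) (j : 'I_d) u x,
  (forall i, 0 < h i) -> (forall z z', c z =1 c z' -> z = z') -> 0 <= A ->
  `|iter k (Delta u j) (bump_sum b a h c A) x| <= A * (M * (`|u| / h j) ^+ k).
Proof.
move=> ka; have a0 : (0 < a)%N by exact: leq_ltn_trans ka.
have [M M0 hM] := bdiff_translates (@usmooth_mono R _ _ _ ka ka).
exists M => // b h J c A j u x h0 c_inj A0.
rewrite -[x in X in X <= _](shift_tuple0 j) iter_Delta_line.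
pose C z := \prod_(i | i != j) mono a a ((tnth x i + b) / h i - (c z i)%:R) : R.
pose s z := (tnth x j + b) / h j - (c z j)%:R.
have C01 z : 0 <= C z <= 1.
  rewrite prodr_ge0//=; last by move=> i _; case/andP: (lam01 a0 ((tnth x i + b) / h i - (c z i)%:R)).
  by apply: prodr_ile1 => i _; exact: lam01.
have fE : (fun t => bump_sum b a h c A (Defs.shift t j x)) =
    (fun t => A * \sum_z C z * mono a a (t / h j + s z)).
  apply/funext => t; congr (_ * _); apply: eq_bigr => z _.
  rewrite /cellbump (bigD1 j)//= mulrC; congr (_ * _).
    apply: eq_bigr => i ij; congr (mono a a _).
    by rewrite tnth_mktuple (negbTE ij) mulr0 addr0.
  by congr (mono a a _); rewrite tnth_mktuple eqxx mulr1 /s; lra.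
have {}hM := hM J C s (h j) (h0 j).
rewrite fE.
have /(bdiff_iter u 0) : bdiff k (A * (M / h j ^+ k)) (fun t => A * \sum_z C z * mono a a (t / h j + s z)).
  apply: bdiff_scale => //; apply: hM.
    by move=> z; case/andP: (C01 z) => C0 C1; rewrite ger0_norm.
  move=> z z' t Cz Cz' tz tz'; apply: c_inj => i.
  have [->|ij] := eqVneq i j.
    apply: (@floor_uniq R (t / h j + (tnth x j + b) / h j)).
      by move: tz; rewrite /s addrA.
    by move: tz'; rewrite /s addrA.
  have H w : C w != 0 -> 0 < (tnth x i + b) / h i - (c w i)%:R < 1.
    move=> /prodf_neq0/(_ i ij) hn; apply/negPn/negP => /(lam_supp a0) E.
    by move: hn; rewrite E eqxx.
  exact: floor_uniq (H _ Cz) (H _ Cz').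
move=> /le_trans; apply; rewrite -!mulrA ler_wpM2l// ler_wpM2l//.
by rewrite exprMn exprVn mulrC.
Qed.

End bump_sum_difference.

Section nikolskii_bumps.
Context {R : realType} (d : nat).
Local Notation nu := (@lebesgue_measure_Rd R d).

Lemma fine_inv_le1 (r : \bar R) : (1 <= r)%E -> fine r^-1%E <= 1.
Proof.
case: r => [r|_|//]; last by rewrite invey ler01.
rewrite lee_fin => r1; rewrite inver gt_eqF/= ?(lt_le_trans _ r1)//.
by rewrite invf_le1// (lt_le_trans _ r1).
Qed.

(** The k-th difference vanishes outside the union of k + 1 translates of the
support, by multiples of u. *)
Lemma Lnorm_bump_sum_Delta (b : R) (a : nat) (h : 'I_d -> R) (J : finType) (c : J -> 'I_d -> nat)
   (A K u : R) (j : 'I_d) (k : nat) (r : \bar R) :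
  (0 < a)%N -> (forall i, 0 < h i) -> (1 <= r)%E -> (0 < #|J|)%N -> 0 <= K ->
  (forall x, `|iter k (Delta u j) (bump_sum b a h c A) x| <= K) ->
  ('N[nu]_r[EFin \o iter k (Delta u j) (bump_sum b a h c A)] <=
     (K * ((k.+1%:R * #|J|%:R) * \prod_i h i) `^ fine r^-1%E)%:E)%E.
Proof.
move=> a0 h0 r1 J0 K0 hK.
pose V := \prod_i h i.
have V0 : 0 < V by apply: prodr_gt0.
pose e (i : nat) i' : R := i%:R * u * (i' == j)%:R.
pose B (iz : 'I_k.+1 * J) : set (Rd R d) :=
  cbox (fun i => ((c iz.2 i)%:R + 0) * h i - b - e iz.1 i) (fun i => ((c iz.2 i)%:R + 1) * h i - b - e iz.1 i).
have mB z : measurable (B z) by exact: measurable_cbox.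
have nuB z : nu (B z) = V%:E.
  rewrite lebesgue_cbox; last by move=> i; rewrite lerB// lerD2r ler_wpM2r ?(ltW (h0 _))// lerD2l ler01.
  by congr EFin; apply: eq_bigr => i _; lra.
pose D := \big[setU/set0]_(z <- enum {: 'I_k.+1 * J}) B z.
have BD z : B z `<=` D.
  by move=> x Bx; rewrite /D -bigcup_seq; exists z => //=; rewrite mem_enum.
have [z0 _] := card_gt0P J0.
apply: (@Lnorm_le_support _ _ _ _ _ D) => //.
- exact: bigsetU_measurable.
- apply/andP; split.
    apply: (@lt_le_trans _ _ (nu (B (ord0, z0)))); first by rewrite nuB lte_fin.
    by apply: le_measure; rewrite ?inE//; exact: bigsetU_measurable.
  apply: (le_trans (measure_bigsetU_le nu _ mB)).
  rewrite (eq_bigr (fun=> V%:E) (fun z _ => nuB z)).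
  rewrite sumEFin lee_fin big_const_seq count_predT iter_addr_0 -cardE -[leLHS]mulr_natl.
  by rewrite card_prod card_ord natrM.
- move=> x nD; apply: iter_Delta_eq0 => i ik; apply: bump_sum_outside => // z hz; apply: nD.
  apply: (BD (Ordinal (n := k.+1) (m := i) ik, z)) => i' /=.
  have := hz i'; rewrite tnth_mktuple -/(e i i').
  by move=> /andP[h1 h2]; rewrite lerBlDr h1 lerBrDr h2.
Qed.

(** For |u| <= h_j the bound by the k-th derivative gives (|u|/h_j)^k, at most
(|u|/h_j)^beta_j as k > beta_j; for larger |u| the trivial bound 2^k suffices. *)
Lemma nikolskii_bump_sum (beta : 'I_d -> R) (r : 'I_d -> \bar R) :
  (forall j, 0 < beta j) -> (forall j, (1 <= r j)%E) ->
  exists2 a : nat, (0 < a)%N & exists2 C : R, 1 <= C &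
  forall (b : R) (h : 'I_d -> R) (J : finType) (c : J -> 'I_d -> nat) (A : R) (L : 'I_d -> R),
  (forall i, 0 < h i <= 1) -> (forall z z', c z =1 c z' -> z = z') -> 0 <= A ->
  (0 < #|J|)%N ->
  (forall j, C * A * (#|J|%:R * \prod_i h i) `^ fine (r j)^-1%E <= L j * h j `^ beta j) ->
  nikolskii_bar beta r L (bump_sum b a h c A).
Proof.
move=> beta0 r1.
pose k j := Num.bound (beta j).
have kb j : beta j < (k j)%:R by rewrite archi_boundP// ltW.
pose a := (\max_j k j).+1.
have ka j : (k j < a)%N by rewrite ltnS; exact: leq_bigmax.
have k0 j : (0 < k j)%N by rewrite -(ltr_nat R) (lt_trans (beta0 j)).
have a0 : (0 < a)%N by [].
exists a => //.
have /choice[M hM] : forall j : 'I_d, exists M : R, 0 <= M /\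
  forall (b : R) (h : 'I_d -> R) (J : finType) (c : J -> 'I_d -> nat) (A : R) u x,
  (forall i, 0 < h i) -> (forall z z', c z =1 c z' -> z = z') -> 0 <= A ->
  `|iter (k j) (Delta u j) (bump_sum b a h c A) x| <= A * (M * (`|u| / h j) ^+ k j).
  move=> j; have [M M0 h] := @bump_sum_Delta R d a (k j) (ka j); exists M; split => //.
  by move=> *; exact: h.
pose Cj j := (2 ^+ k j + M j) * (k j).+1%:R.
have Cj0 j : 0 <= Cj j by rewrite mulr_ge0// addr_ge0 ?exprn_ge0//; case: (hM j).
exists (1 + \sum_j Cj j); first by rewrite lerDl sumr_ge0.
have CjC j : Cj j <= 1 + \sum_j Cj j.
  by rewrite (bigD1 j)//= addrCA lerDl addr_ge0// sumr_ge0.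
move=> b h J c A L h01 c_inj A0 J0 hL j.
have h0 i : 0 < h i by case/andP: (h01 i).
pose V := \prod_i h i.
have V0 : 0 < V by apply: prodr_gt0.
set Sr := (#|J|%:R * \prod_i h i) `^ fine (r j)^-1%E in hL *.
have Sr0 : 0 <= Sr by exact: powR_ge0.
have C1 : 1 <= 1 + \sum_j Cj j by rewrite lerDl sumr_ge0.
have hLj : A * Sr * (1 + \sum_j Cj j) <= L j * h j `^ beta j.
  by apply: le_trans (hL j); rewrite -/Sr; lra.
have hb1 : 0 < h j `^ beta j <= 1.
  rewrite powR_gt0//=.
  have := @ge0_ler_powR R (beta j) (ltW (beta0 j)) (h j) 1.
  by rewrite powR1; apply; rewrite ?nnegrE ?(ltW (h0 j))//; case/andP: (h01 j).
have /andP[hb0 hb1'] := hb1.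
have ASr0 : 0 <= A * Sr by rewrite mulr_ge0.
split.
  apply: (le_trans (Lnorm_bump_sum b a0 h0 c_inj A0 (r1 j) J0)).
  rewrite lee_fin -/Sr.
  have h1 : A * Sr <= L j * h j `^ beta j by apply: le_trans hLj; rewrite ler_peMr.
  apply: (le_trans h1); rewrite ler_piMr//.
  by rewrite -(pmulr_lge0 _ hb0) (le_trans ASr0).
exists (k j) => // u.
pose s := `|u| / h j.
have s0 : 0 <= s by rewrite divr_ge0 ?(ltW (h0 j)).
have M0 : 0 <= M j by case: (hM j).
have bound x : `|iter (k j) (Delta u j) (bump_sum b a h c A) x| <= A * (2 ^+ k j + M j) * s `^ beta j.
  have [s1|s1] := leP s 1.
    apply: (le_trans ((hM j).2 b h J c A u x h0 c_inj A0)); rewrite -/s -mulrA ler_wpM2l//.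
    apply: ler_pM; rewrite ?exprn_ge0 ?lerDr ?exprn_ge0//.
    rewrite -powR_mulrn//.
    have [->|sN] := eqVneq s 0; first by rewrite powR0 ?powR_ge0// pnatr_eq0 -lt0n.
    apply: ger_powR; last exact: ltW.
    by rewrite s1 lt_neqAle eq_sym sN s0.
  rewrite -[x in X in X <= _](shift_tuple0 j) iter_Delta_line.
  apply: (le_trans (iter_dif_bounded _ _ _ (M := A) _)).
    move=> t; have /andP[f0 f1] := bump_sum_range b h a0 c_inj A0 (Defs.shift t j x).
    by rewrite ger0_norm.
  have sb : 1 <= s `^ beta j.
    by rewrite -[leLHS](powRr0 s) ler_powR ?(ltW s1)// ltW.
  rewrite mulrC -mulrA ler_wpM2l//.
  by apply: le_trans (ler_peMr _ sb); rewrite ?lerDl ?addr_ge0 ?exprn_ge0.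
apply: (le_trans (Lnorm_bump_sum_Delta a0 h0 (r1 j) J0 _ bound)).
  by rewrite mulr_ge0 ?powR_ge0// mulr_ge0// addr_ge0 ?exprn_ge0.
rewrite lee_fin.
have -> : s `^ beta j = `|u| `^ beta j / h j `^ beta j.
  apply: (canRL (mulfK _)); first by rewrite gt_eqF.
  by rewrite -powRM ?(ltW (h0 j))// /s divfK// gt_eqF.
rewrite -[_.+1%:R * _ * _]mulrA powRM//; last by rewrite mulr_ge0// ltW.
rewrite -/Sr.
set kap := _.+1%:R `^ _.
have kap0 : 0 <= kap by exact: powR_ge0.
have kr : kap <= (k j).+1%:R by rewrite /kap ler1_powR ?fine_inv_le1// ler1n.
have X0 : 0 <= 2 ^+ k j + M j by rewrite addr_ge0 ?exprn_ge0.
have h1 : (A * Sr) * ((2 ^+ k j + M j) * kap) <= L j * h j `^ beta j.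
  apply: le_trans hLj; rewrite ler_wpM2l//; apply: le_trans (CjC j).
  by rewrite ler_wpM2l.
have -> : A * (2 ^+ k j + M j) * (`|u| `^ beta j / h j `^ beta j) * (kap * Sr) =
  ((A * Sr) * ((2 ^+ k j + M j) * kap)) / h j `^ beta j * `|u| `^ beta j by lra.
by rewrite ler_wpM2r ?powR_ge0// ler_pdivrMr.
Qed.

End nikolskii_bumps.

(** * Decoding the active cells *)

Section averaging.
Context {R : realType} (I : finType) (n : nat).
Local Notation M := {ffun I -> 'I_n}.

Definition upd (i : I) (m : M) (k : 'I_n) : M := [ffun z => if z == i then k else m z].

(** If Q m k does not depend on the i-th component of m, the sum over m of Q m (m i)
is, up to the factor n, the sum of Q m k over all pairs: the exchange of k with
m i is an involution of the pairs (m, k). *)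
Lemma average_diagonal (i : I) (Q : M -> 'I_n -> R) :
  (forall m k l, Q (upd i m l) k = Q m k) -> (forall m, \sum_k Q m k <= 1) ->
  n%:R * \sum_m Q m (m i) <= #|{: M}|%:R.
Proof.
move=> Qi Q1.
pose H m := Q m (m i).
(* the involution that exchanges k with the i-th component of m *)
pose sg (mk : M * 'I_n) : M * 'I_n := (upd i mk.1 mk.2, mk.1 i).
have sgK : involutive sg.
  move=> [m k]; rewrite /sg /=; congr pair; last by rewrite ffunE eqxx.
  by apply/ffunP => z; rewrite !ffunE; case: eqP => // ->.
have -> : n%:R * \sum_m H m = \sum_m \sum_k Q m k.
  transitivity (\sum_(mk : M * 'I_n) H mk.1).
    rewrite -(pair_bigA _ (fun m _ => H m)) /=.
    under [RHS]eq_bigr do rewrite sumr_const card_ord.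
    by rewrite mulr_natl -sumrMnl.
  rewrite (reindex_inj (inv_inj sgK)) /= -(pair_bigA _ (fun m k => H (upd i m k))) /=.
  by apply: eq_bigr => m _; apply: eq_bigr => k _; rewrite /H ffunE eqxx Qi.
rewrite -sum1_card natr_sum; apply: ler_sum => m _; exact: Q1.
Qed.

Lemma exists_le_average (J : finType) (F : J -> R) (v : R) : (0 < #|J|)%N ->
  \sum_j F j <= #|J|%:R * v -> exists j, F j <= v.
Proof.
move=> J0 h; apply: contrapT => nle.
have {}nle j : v < F j by rewrite ltNge; apply/negP => Fj; apply: nle; exists j.
have [j0 _] := card_gt0P J0.
move: h; rewrite mulr_natl -sumr_const (bigD1 j0)//= [leRHS](bigD1 j0)//=.
apply/negP; rewrite -ltNge; apply: ltr_leD; first exact: nle.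
by apply: ler_sum => j _; exact: ltW.
Qed.

End averaging.

Section risk_bound.
Context {R : realType} (d : nat).
Context (dO : measure_display) (Omega : measurableType dO).
Variable P : probability Omega R.
Variable Wint : L2 R d -> Omega -> R.
Variables (p : \bar R) (p1 : (1 <= p)%E).
Local Notation nu := (@lebesgue_measure_Rd R d).

(** The q-th moment is at least al^q / 2, and 2^(-1/q) >= 1/2. *)
Lemma risk_ge (b eps q al : R) (T : @observation R d -> LfunType nu p1) (f : Rd R d -> R)
    (G : set Omega) : 1 <= q -> 0 <= al -> measurable G -> ((2^-1)%:E <= P G)%E ->
  (forall w, G w -> (al%:E <=
    'N[nu]_p[(EFin \o (T (observe Wint eps f w) \- f)%R) \_ (cube b)])%E) ->
  ((al / 2)%:E <= risk P Wint b eps q T f)%E.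
Proof.
move=> q1 al0 mG PG hG; have q0 : 0 < q by exact: lt_le_trans q1.
rewrite /risk; apply: (@le_trans _ _ ((\int[P]_w ((al `^ q)%:E * (\1_G w)%:E)) `^ q^-1)%E); last first.
  apply: ge0_le_poweR; rewrite ?invr_ge0 ?(ltW q0)//.
    by apply: integral_ge0 => w _; rewrite mule_ge0// lee_fin powR_ge0.
  apply: le_integral_nonmeasurable => w; first by rewrite mule_ge0// lee_fin powR_ge0.
  rewrite indicE; case: (boolP (w \in G)) => [/set_mem Gw|_]; last by rewrite mule0 poweR_ge0.
  rewrite mule1 -poweR_EFin; apply: ge0_le_poweR; rewrite ?(ltW q0) ?lee_fin//.
  exact: hG.
have mG1 : measurable_fun setT (fun w => (\1_G w : R)%:E).
  by apply/measurable_EFinP; exact: measurable_indic.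
have G0 w : setT w -> (0 <= (\1_G w : R)%:E)%E by rewrite lee_fin.
have aq0 : (0 <= (al `^ q)%:E)%E by rewrite lee_fin powR_ge0.
rewrite (ge0_integralZl P measurableT mG1 G0 aq0) integral_indic// setIT poweRM//.
rewrite -poweR_EFin -poweRrM mulfV ?gt_eqF// poweRe1 ?lee_fin//.
rewrite EFinM; apply: lee_wpmul2l; rewrite ?lee_fin//.
apply: (@le_trans _ _ ((2^-1)%:E `^ q^-1)%E); last first.
  by apply: ge0_le_poweR; rewrite ?invr_ge0 ?(ltW q0) ?lee_fin ?invr_ge0.
rewrite poweR_EFin lee_fin ger1_powR//.
  by rewrite invr_gt0 ltr0n/= invf_le1// ler1n.
by rewrite invf_le1.
Qed.

End risk_bound.

Section L2_bumps.
Context {R : realType} (d : nat).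
Local Notation nu := (@lebesgue_measure_Rd R d).

Lemma L2_le dT (T : measurableType dT) (mu : {measure set T -> \bar R}) (f g : T -> R) :
  measurable_fun setT f -> g \in Lfun mu 2%:E -> (forall x, `|f x| <= `|g x|) ->
  f \in Lfun mu 2%:E.
Proof.
move=> mf; rewrite !inE => /andP[_]; rewrite inE /= => g2 fg.
apply/andP; split; first by rewrite inE.
rewrite inE /= /finite_norm; apply: le_lt_trans g2.
by apply: Lnorm_le_nonmeasurable => //; rewrite lee_fin ler1n.
Qed.

Variables (b : R) (a : nat) (h : 'I_d -> R).
Hypotheses (a0 : (0 < a)%N) (h0 : forall i, 0 < h i).
Implicit Types (c : 'I_d -> nat).

Lemma cellbump_le_indic c x : cellbump b a h c x <= \1_(subcell b h 0 1 c) x.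
Proof.
rewrite indicE; case: (boolP (x \in _)) => [_|]; first by case/andP: (cellbump01 b h a0 c x).
by rewrite notin_setE => /cellbump_outside ->.
Qed.

Lemma subcell_finite s t c : s <= t -> @finite_measure_set R d (subcell b h s t c).
Proof.
by move=> st; split; [exact: measurable_cbox|rewrite lebesgue_subcell// ltry].
Qed.

Lemma L2_cellbump c : cellbump b a h c \in Lfun nu 2%:E.
Proof.
have [mc c2] := subcell_finite c ler01.
apply: (L2_le _ (L2_indic mc c2)); first exact: measurable_cellbump.
move=> x; rewrite ger0_norm; last by case/andP: (cellbump01 b h a0 c x).
by rewrite ger0_norm ?cellbump_le_indic.
Qed.

Lemma ip_cellbump (B : R) c :
  ip nu (fun x => B * cellbump b a h c x) (fun x => B * cellbump b a h c x) <=
  B ^+ 2 * \prod_i h i.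
Proof.
have [mc c2] := subcell_finite c ler01.
have c2' := L2_indic mc c2.
have bc := L2_cellbump c.
apply: (@le_trans _ _ (ip nu (fun x => B * \1_(subcell b h 0 1 c) x) (fun x => B * \1_(subcell b h 0 1 c) x))).
  apply: le_Rintegral => //.
  - by apply: ip_integrable; exact: L2_Z.
  - by apply: ip_integrable; exact: L2_Z.
  move=> x _; rewrite -!expr2 !exprMn ler_wpM2l ?sqr_ge0//.
  have /andP[b0 b1] := cellbump01 b h a0 c x.
  by rewrite lerXn2r ?nnegrE ?cellbump_le_indic.
have z2 : (fun x => B * \1_(subcell b h 0 1 c) x) \in Lfun nu 2%:E by exact: L2_Z.
have E : nu (subcell b h 0 1 c) = ((1 - 0) ^+ d * \prod_i h i)%:E by exact: lebesgue_subcell.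
rewrite ipZr// ipC ipZr// ip_indic2// [X in fine X]E subr0 expr1n mul1r /=.
by rewrite mulrA expr2.
Qed.

End L2_bumps.

Section probability_sums.
Context dT (T : measurableType dT) (R : realType) (P : probability T R).

Lemma integral_sum_indic (J : finType) (B : J -> set T) : (forall j, measurable (B j)) ->
  (\int[P]_w (\sum_j (\1_(B j) w : R))%:E = (\sum_j fine (P (B j)))%:E)%E.
Proof.
move=> mB; under eq_integral do rewrite -sumEFin.
rewrite ge0_integral_sum//; last by move=> j; apply/measurable_EFinP; exact: measurable_indic.
rewrite -sumEFin; apply: eq_bigr => j _.
by rewrite integral_indic// setIT fineK// fin_num_measure.
Qed.

Lemma sum_prob_disjoint (J : finType) (B : J -> set T) : (forall j, measurable (B j)) ->
  trivIset setT B -> \sum_j fine (P (B j)) <= 1.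
Proof.
move=> mB tB; rewrite -lee_fin -integral_sum_indic//.
apply: (@le_trans _ _ (\int[P]_w (cst 1%E) w)%E).
  apply: le_integral_nonmeasurable => w; rewrite lee_fin; first by apply: sumr_ge0.
  have [[j Bj]|nB] := pselect (exists j, B j w).
    rewrite (bigD1 j)//= big1 ?addr0 ?indicE; first by case: (_ \in _).
    move=> i ij; rewrite indicE memNset// => Bi.
    by move: ij; rewrite (tB i j)// ?eqxx//; exists w.
  by rewrite big1// => j _; rewrite indicE memNset// => Bj; apply: nB; exists j.
by rewrite integral_cst// mul1e [leLHS](@probability_setT _ _ _ P).
Qed.

(** The expected number of events that occur is at most a quarter of S, so it
exceeds half of S with probability at most 1/2. *)
Lemma markov_half (J : finType) (B : J -> set T) (S : R) : (forall j, measurable (B j)) ->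
  0 < S -> \sum_j fine (P (B j)) <= S / 4 ->
  exists G : set T, [/\ measurable G, ((2^-1)%:E <= P G)%E &
    forall w, G w -> \sum_j (\1_(B j) w : R) <= S / 2].
Proof.
move=> mB S0 hS; pose N w : R := \sum_j \1_(B j) w.
have mN : measurable_fun setT N by apply: measurable_sum => j; exact: measurable_indic.
pose G := [set w | N w <= S / 2].
have mG : measurable G.
  rewrite (_ : G = N @^-1` `]-oo, S / 2]).
    by rewrite -[Q in measurable Q]setTI; exact: (mN measurableT _ (measurable_itv `]-oo, S / 2])).
  by apply/seteqP; split => w /=; rewrite in_itv/=.
exists G; split => //.
have : ((S / 2)%:E * P (~` G) <= (S / 4)%:E)%E.
  have mGc : measurable (~` G) by exact: measurableC.
  have m1 : measurable_fun setT (fun w => (\1_(~` G) w : R)%:E).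
    by apply/measurable_EFinP; exact: measurable_indic.
  have i0 w : setT w -> (0 <= (\1_(~` G) w : R)%:E)%E by rewrite lee_fin.
  have s0 : (0 <= (S / 2)%:E)%E by rewrite lee_fin divr_ge0 ?(ltW S0).
  rewrite -[X in (_ * P X)%E]setIT -(integral_indic P measurableT mGc).
  rewrite -(ge0_integralZl P measurableT m1 i0 s0).
  apply: (@le_trans _ _ (\int[P]_w (N w)%:E)%E); last by rewrite integral_sum_indic// lee_fin.
  apply: le_integral_nonmeasurable => w; first by rewrite mule_ge0.
  rewrite -EFinM lee_fin indicE; case: (boolP (w \in _)) => [/set_mem|_] /=.
    by rewrite mulr1 /G /= => /negP; rewrite -ltNge => /ltW.
  by rewrite mulr0 sumr_ge0.
rewrite probability_setC//.
have [g gE] : exists g, P G = g%:E by exists (fine (P G)); rewrite fineK// fin_num_measure.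
rewrite gE -EFinB -EFinM !lee_fin => h.
have : 1 - g <= 2^-1.
  have S2 : 0 < S / 2 by rewrite divr_gt0.
  by rewrite -(ler_pM2l S2); lra.
lra.
Qed.

End probability_sums.

Lemma fine_affine_le (R : realType) (u v : \bar R) (k a c : R) :
  u \is a fin_num -> v \is a fin_num ->
  (k%:E * u <= a%:E * v + c%:E)%E -> k * fine u <= a * fine v + c.
Proof. by case: u v => [u| |] [v| |]//= _ _; rewrite -!EFinM -EFinD lee_fin. Qed.

Lemma sum_le_quarter (R : realFieldType) (J : finType) (x : R) (F G : J -> R) :
  x * \sum_j G j <= #|J|%:R -> (forall j, 2 * F j <= (x / 4) * G j + 4^-1) ->
  \sum_j F j <= #|J|%:R / 4.
Proof.
move=> hG hF; have : \sum_j 2 * F j <= \sum_j ((x / 4) * G j + 4^-1) by apply: ler_sum.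
by rewrite big_split /= -!mulr_sumr sumr_const -[X in _ + X]mulr_natl; lra.
Qed.

Section minimax_bumps.
Context {R : realType} (d : nat).
Context (dO : measure_display) (Omega : measurableType dO).
Variable P : probability Omega R.
Variable W : set (Rd R d) -> Omega -> R.
Hypothesis W_noise : white_noise P W.
Variable Wint : L2 R d -> Omega -> R.
Hypothesis Wint_integral : forall g : L2 R d, wiener_integral P W g (Wint g).
Variables (p : \bar R) (p1 : (1 <= p)%E).
Local Notation nu := (@lebesgue_measure_Rd R d).
Variables (b : R) (a : nat) (h : 'I_d -> R).
Hypotheses (a0 : (0 < a)%N) (h0 : forall i, 0 < h i).
Variables (S n : nat) (c : 'I_S -> 'I_n -> 'I_d -> nat).
Hypotheses (S0 : (0 < S)%N) (n0 : (0 < n)%N).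
Hypothesis c_inj : forall s k s' k', c s k =1 c s' k' -> s = s' /\ k = k'.
Hypothesis c_cube : forall s k i, (c s k i).+1%:R * h i <= 2 * b.
Variables (A eps q : R).
Hypotheses (A0 : 0 < A) (eps0 : 0 < eps) (q1 : 1 <= q).
Local Notation V := (\prod_i h i).
Hypothesis n16 : expR (A ^+ 2 * V / eps ^+ 2) <= n%:R / 16.
Variable T : @observation R d -> LfunType nu p1.
Hypothesis T_est : estimator T.

(* the middle half of a cell, where its bump is bounded below *)
Let mid s k : set (Rd R d) := subcell b h 4^-1 (3 / 4) (c s k).
Let blk s : set (Rd R d) := [set x | exists k, mid s k x].
Let g s k x : R := A * cellbump b a h (c s k) x.
Let f (m : {ffun 'I_S -> 'I_n}) : Rd R d -> R := bump_sum b a h (fun s => c s (m s)) A.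
(* the signal with the bump of block s erased *)
Let f' (m : {ffun 'I_S -> 'I_n}) s x : R := A * \sum_(z | z != s) cellbump b a h (c z (m z)) x.
(* the L_p norm on the middle parts of the cells of block s *)
Let N s (u : Rd R d -> R) : \bar R := ('N[nu]_p[EFin \o (fun x => u x * \1_(blk s) x)%R])%E.
Let mm : R := (3 / 4 - 4^-1) ^+ d * V.
(* half of the lower bound for the distance between two bumps of a block *)
Let al : R := A * 16^-1 ^+ (a * d) * mm `^ fine p^-1%E / 2.
Let E s k : set (LfunType nu p1) := [set t | (N s (t \- g s k)%R < al%:E)%E].

Let mmid s k : measurable (mid s k). Proof. exact: measurable_cbox. Qed.

Let mblk s : measurable (blk s).
Proof.
rewrite (_ : blk s = \bigcup_(k in [set: 'I_n]) mid s k).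
  by apply: fin_bigcup_measurable.
by apply/seteqP; split => x; [move=> [k hk]; exists k|move=> [k _ hk]; exists k].
Qed.

Let mid_coord s k x i : mid s k x -> 0 < (tnth x i + b) / h i - (c s k i)%:R < 1.
Proof. by move=> /(mem_subcell b h0)/(_ i); lra. Qed.

Let mid_bump s k s' k' x : mid s k x -> cellbump b a h (c s' k') x != 0 -> s = s' /\ k = k'.
Proof.
move=> mx /(cellbump_neq0 a0) hx; apply: c_inj => i.
exact: floor_uniq (mid_coord i mx) (hx i).
Qed.

Let mid_mid s k s' k' x : mid s k x -> mid s' k' x -> s = s' /\ k = k'.
Proof.
by move=> mx mx'; apply: c_inj => i; exact: floor_uniq (mid_coord i mx) (mid_coord i mx').
Qed.

Let trivIset_blk : trivIset setT blk.
Proof. by move=> s s' _ _ [x [[k hk] [k' hk']]]; case: (mid_mid hk hk'). Qed.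

Let coord_cube s k x : (forall i, 0 < (tnth x i + b) / h i - (c s k i)%:R < 1) -> cube b x.
Proof.
move=> hx j; have /andP[] := hx j; rewrite subr_gt0 ltrBlDr => h1 h2.
have c0 : 0 <= (c s k j)%:R :> R by [].
move: h1 h2; rewrite ltr_pdivlMr// ltr_pdivrMr// => h1 h2.
have := c_cube s k j; rewrite -natr1 => h3.
have := mulr_ge0 c0 (ltW (h0 j)); lra.
Qed.

Let blk_cube s : blk s `<=` cube b.
Proof. by move=> x [k mx]; apply: (@coord_cube s k) => i; exact: mid_coord. Qed.

Lemma bump_sum_cube m x : ~ cube b x -> f m x = 0.
Proof.
move=> hx; rewrite /f /bump_sum big1 ?mulr0// => s _.
by apply/eqP/negPn/negP => /(cellbump_neq0 a0) /coord_cube.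
Qed.

Let f_blk m s x : blk s x -> f m x = g s (m s) x.
Proof.
move=> [k mx]; rewrite /f /bump_sum /g (bigD1 s)//= big1 ?addr0// => z zs.
apply/eqP/negPn/negP => /(mid_bump mx)[zs' _]; by move: zs; rewrite zs' eqxx.
Qed.

(* the shift that restores the bump of block s, in units of the noise level *)
Let f_split m s : f m = fun x => f' m s x + eps * (eps^-1 * g s (m s) x).
Proof.
apply/funext => x; rewrite mulrA mulfV ?gt_eqF// mul1r.
by rewrite /f /bump_sum (bigD1 s)//= /f' /g mulrDr addrC.
Qed.

Let g2 s k : g s k \in Lfun nu 2%:E.
Proof. by apply: L2_Z; exact: L2_cellbump. Qed.

Let f'2 m s : f' m s \in Lfun nu 2%:E.
Proof.
apply: L2_Z; rewrite (_ : (fun x => _) =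
    fun x => \sum_z (if z != s then 1 else 0) * cellbump b a h (c z (m z)) x).
  by apply: L2_sum => z; apply: L2_Z; exact: L2_cellbump.
apply/funext => x; rewrite big_mkcond; apply: eq_bigr => z _.
by case: ifP; rewrite ?mul1r ?mul0r.
Qed.

Lemma L2_bump_sum m : f m \in Lfun nu 2%:E.
Proof. by apply: L2_Z; apply: L2_sum => z; exact: L2_cellbump. Qed.

Let mg s k : measurable_fun setT (g s k). Proof. exact: L2_measurable (g2 s k). Qed.

Let mT (t : LfunType nu p1) : measurable_fun setT (t : Rd R d -> R).
Proof. exact: measurable_funP. Qed.

Let N_triangle s (u v : Rd R d -> R) : measurable_fun setT u -> measurable_fun setT v ->
  (N s (fun x => u x + v x)%R <= N s u + N s v)%E.
Proof.
move=> mu mv; rewrite /N.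
have m1 : measurable_fun setT (\1_(blk s) : Rd R d -> R) by exact: measurable_indic.
rewrite (_ : (fun x => (u x + v x) * \1_(blk s) x) =
  ((fun x => u x * \1_(blk s) x) \+ (fun x => v x * \1_(blk s) x))).
  by apply: eminkowski => //; exact: measurable_funM.
by apply/funext => x; rewrite /= mulrDl.
Qed.

Let Lp_open_E s k : Lp_open (E s k).
Proof.
move=> t; rewrite /E /= => Et.
have [r rE] : exists r, N s (t \- g s k)%R = r%:E.
  by exists (fine (N s (t \- g s k)%R)); rewrite fineK// ge0_fin_numE ?Lnorm_ge0// (lt_trans Et) ?ltry.
move: Et; rewrite rE lte_fin => ral; exists (al - r); first by rewrite subr_gt0.
move=> u ut; rewrite /E /=.
apply: (@le_lt_trans _ _ (N s (fun x => (u \- t) x + (t \- g s k) x))).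
  rewrite /N; apply: Lnorm_le_nonmeasurable => // x.
  by rewrite le_eqVlt; apply/orP; left; apply/eqP; congr (`|_ * _|); rewrite /=; lra.
apply: (le_lt_trans (N_triangle _ _ _)).
- by apply: measurable_funB.
- by apply: measurable_funB.
rewrite rE; apply: (@lt_le_trans _ _ ((al - r)%:E + r%:E)%E); last by rewrite -EFinD subrK.
rewrite lteD2rE//; apply: le_lt_trans ut.
apply: Lnorm_le_nonmeasurable => // x.
by rewrite normrM ler_piMr// indicE; case: (_ \in _); rewrite ?normr1 ?normr0.
Qed.

Let mm0 : 0 < mm.
Proof. by rewrite mulr_gt0 ?exprn_gt0 ?prodr_gt0//; lra. Qed.

Let separated s k k' : k != k' -> ((2 * al)%:E <= N s (g s k \- g s k')%R)%E.
Proof.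
move=> kk'; have st : 4^-1 <= 3 / 4 :> R by lra.
rewrite (_ : 2 * al = A * 16^-1 ^+ (a * d) * mm `^ fine p^-1%E); last by rewrite /al; lra.
apply: (@Lnorm_ge_support _ _ _ _ _ (mid s k)) => //.
- have nuE : nu (mid s k) = mm%:E by exact: lebesgue_subcell.
  by apply/andP; split; [rewrite [leRHS]nuE|rewrite [ltLHS]nuE ltry].
- by rewrite mulr_ge0 ?exprn_ge0 ?invr_ge0 ?(ltW A0).
move=> x mx; rewrite indicE mem_set ?mulr1; last by exists k.
have E0 : cellbump b a h (c s k') x = 0.
  apply/eqP/negPn/negP => /(mid_bump mx)[_ kk]; by move: kk'; rewrite kk eqxx.
have h1 : 16^-1 ^+ (a * d) <= cellbump b a h (c s k) x by exact: cellbump_middle mx.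
rewrite /= /g E0 mulr0 subr0 ger0_norm.
  by rewrite ler_wpM2l// ltW.
by rewrite mulr_ge0 ?(ltW A0)// (le_trans _ h1)// exprn_ge0// invr_ge0.
Qed.

Let E_disjoint s : trivIset setT (E s).
Proof.
move=> k k' _ _ [t [/= h1 h2]]; apply/eqP/negPn/negP => kk'.
have := separated s kk'; apply/negP; rewrite -ltNge.
apply: (@le_lt_trans _ _ (N s (t \- g s k)%R + N s (t \- g s k')%R)%E).
  apply: (@le_trans _ _ (N s (fun x => (g s k \- t) x + (t \- g s k') x))).
    rewrite /N; apply: Lnorm_le_nonmeasurable => // x.
    by rewrite le_eqVlt; apply/orP; left; apply/eqP; congr (`|_ * _|); rewrite /=; lra.
  apply: (le_trans (N_triangle _ _ _)).
  - by apply: measurable_funB.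
  - by apply: measurable_funB.
  apply: leeD => //; apply: Lnorm_le_nonmeasurable => // x.
  by rewrite /= !normrM distrC.
by rewrite mulr_natl mulr2n EFinD lteD.
Qed.

Let cylinder_E s k : cylinder (T @^-1` E s k).
Proof. by apply: T_est; apply: sub_sigma_algebra; exact: Lp_open_E. Qed.

Let ev m s := observe Wint eps (f m) @^-1` (T @^-1` E s (m s)).

Let mev m s : measurable (ev m s).
Proof. exact: (@measurable_cylinder_observe _ _ _ _ _ _ _ Wint_integral). Qed.

Let prob_ev m s : 2 * fine (P (ev m s)) <=
  (n%:R / 4) * fine (P (observe Wint eps (f' m s) @^-1` (T @^-1` E s (m s)))) + 4^-1.
Proof.
(* lam = n / 4 balances the two terms: the likelihood costs at most n / 16 *)
have n40 : 0 < n%:R / 4 :> R by rewrite divr_gt0// ltr0n.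
have h2 : (fun x => eps^-1 * g s (m s) x) \in Lfun nu 2%:E by exact: L2_Z.
have := observe_shift_event W_noise Wint_integral (ltW eps0) n40 (f'2 m s) h2 (cylinder_E s (m s)).
rewrite -f_split.
have m1 := mev m s.
have m2 : measurable (observe Wint eps (f' m s) @^-1` (T @^-1` E s (m s))).
  exact: (@measurable_cylinder_observe _ _ _ _ _ _ _ Wint_integral).
move=> /(fine_affine_le (fin_num_measure P _ m1) (fin_num_measure P _ m2))/le_trans.
apply; rewrite lerD2l.
rewrite ler_pdivrMr//; apply: (@le_trans _ _ (n%:R / 16)); last by lra.
apply: le_trans n16; rewrite ler_expR.
have -> : (fun x => eps^-1 * g s (m s) x) = (fun x => (A / eps) * cellbump b a h (c s (m s)) x).
  by apply/funext => x; rewrite /g; lra.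
apply: (le_trans (ip_cellbump b a0 h0 _ _)).
by rewrite expr_div_n mulrAC.
Qed.

Let sum_prob_ev s : \sum_m fine (P (ev m s)) <= #|{: {ffun 'I_S -> 'I_n}}|%:R / 4.
Proof.
pose Q m k := fine (P (observe Wint eps (f' m s) @^-1` (T @^-1` E s k))).
have Qupd m k l : Q (upd s m l) k = Q m k.
  rewrite /Q (_ : f' (upd s m l) s = f' m s)//.
  apply/funext => x; congr (_ * _); apply: eq_bigr => z zs.
  by rewrite ffunE (negbTE zs).
have Q1 m : \sum_k Q m k <= 1.
  apply: sum_prob_disjoint.
    by move=> k; exact: (@measurable_cylinder_observe _ _ _ _ _ _ _ Wint_integral).
  by move=> k k' _ _ [w [h1 h2]]; apply: (@E_disjoint s) => //; eexists; split; [exact: h1|exact: h2].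
exact: sum_le_quarter (average_diagonal Qupd Q1) (prob_ev^~ s).
Qed.

(** On average over m and over the blocks, the active cell is found with
probability at most 1/4. Fix m that does at least as well as the average: with
probability at least 1/2 no more than half of the blocks are decoded, and each of
the others contributes an L_p error of at least al. *)
Lemma minimax_bumps : exists m : {ffun 'I_S -> 'I_n},
  ((al * S%:R `^ fine p^-1%E / 4)%:E <= risk P Wint b eps q T (f m))%E.
Proof.
have S0' : 0 < S%:R :> R by rewrite ltr0n.
have M0 : (0 < #|{: {ffun 'I_S -> 'I_n}}|)%N.
  by apply/card_gt0P; exists [ffun=> Ordinal n0].
have [m hm] : exists m, \sum_s fine (P (ev m s)) <= S%:R / 4.
  apply: exists_le_average => //; rewrite exchange_big /=.
  apply: (@le_trans _ _ (\sum_(s < S) #|{: {ffun 'I_S -> 'I_n}}|%:R / 4)).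
    by apply: ler_sum => s _; exact: sum_prob_ev.
  by rewrite sumr_const card_ord -[leLHS]mulr_natl; lra.
exists m.
have [G [mG PG hG]] := markov_half (mev m) S0' hm.
have al0 : 0 <= al.
  by rewrite divr_ge0// mulr_ge0 ?powR_ge0// mulr_ge0 ?exprn_ge0 ?invr_ge0// ltW.
have rho1 := fine_inv_le1 p1. have rho0 := fine_inv_ge0 p1.
rewrite (_ : al * _ / 4 = (al * S%:R `^ fine p^-1%E / 2) / 2); last by lra.
apply: (risk_ge q1 _ mG PG).
  by rewrite divr_ge0// mulr_ge0// powR_ge0.
move=> w Gw.
(* the undecoded blocks *)
pose K := [set s | ~~ `[< ev m s w >]]%SET.
have KS : S%:R / 2 <= #|K|%:R :> R.
  have := hG w Gw.
  have -> : \sum_s \1_(ev m s) w = S%:R - #|K|%:R :> R.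
    apply/eqP; rewrite eq_sym subr_eq; apply/eqP.
    rewrite -[in RHS]sum1_card natr_sum [X in _ + X]big_mkcond -big_split /=.
    rewrite (eq_bigr (fun=> 1)) ?sumr_const ?card_ord// => s _.
    rewrite inE indicE; case: asboolP => es; first by rewrite mem_set//= addr0.
    by rewrite memNset//= add0r.
  lra.
have K0 : (0 < #|K|)%N by rewrite -(ltr_nat R) (lt_le_trans _ KS)// divr_gt0.
set t := T _.
have mf : measurable_fun setT (f m) by exact: L2_measurable (L2_bump_sum m).
apply: le_trans (@Lnorm_blocks_ge _ _ _ _ (t \- f m)%R _ blk (cube b) p al K p1 _ mblk trivIset_blk blk_cube al0 _ K0).
- rewrite lee_fin -mulrA ler_wpM2l//.
  apply: (@le_trans _ _ ((S%:R / 2) `^ fine p^-1%E)).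
    rewrite powRM ?invr_ge0 ?(ltW S0')// ler_wpM2l ?powR_ge0//.
    by rewrite ger1_powR// invr_gt0 ltr0n/= invf_le1// ler1n.
  by apply: ge0_ler_powR => //; rewrite nnegrE ?divr_ge0// ltW.
- by apply: measurable_funB.
move=> s; rewrite inE => /asboolP; rewrite /ev /E /= => /negP; rewrite -leNgt => /le_trans; apply.
apply: Lnorm_le_nonmeasurable => // x; rewrite indicE.
case: (boolP (x \in blk s)) => [/set_mem bx|_]; last by rewrite !mulr0.
by rewrite /= (f_blk m bx).
Qed.

End minimax_bumps.

(** * From bump sums to a bound with free amplitude and support *)

Section master.
Context {R : realType} (d : nat).

Lemma truncn_half (x : R) : 1 <= x -> x / 2 <= (Num.truncn x)%:R <= x.
Proof.
move=> x1; have x0 : 0 <= x by lra.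
have := truncn_itv x0 => /andP[h1 h2]; rewrite h1 andbT.
have : 1 <= (Num.truncn x)%:R :> R by rewrite ler1n truncn_gt0.
by move: h2; rewrite -natr1; lra.
Qed.

(** There are between b / h_i and 2 b / h_i whole cells in direction i, hence at
least b^d / V cells in total. *)
Lemma choose_cells (b : R) (h : 'I_d -> R) (S n : nat) :
  0 < b -> (forall i, 0 < h i <= b) -> S%:R * n%:R * \prod_i h i <= b ^+ d ->
  exists c : 'I_S -> 'I_n -> 'I_d -> nat,
    (forall s k s' k', c s k =1 c s' k' -> s = s' /\ k = k') /\
    (forall s k i, (c s k i).+1%:R * h i <= 2 * b).
Proof.
move=> b0 hb Sn.
have h0 i : 0 < h i by case/andP: (hb i).
pose N i := Num.truncn (2 * b / h i).
have N2 i : b / h i <= (N i)%:R <= 2 * b / h i.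
  have /andP[hi0 hib] := hb i.
  have /truncn_half/andP[h1 h2] : 1 <= 2 * b / h i by rewrite ler_pdivlMr//; lra.
  by rewrite h2 andbT; apply: le_trans h1; lra.
pose cells := {dffun forall i : 'I_d, 'I_(N i)}.
have card : (S * n <= #|{: cells}|)%N.
  have -> : #|{: cells}| = (\prod_i N i)%N.
    rewrite card_dep_ffun foldrE big_map big_enum /=.
    by apply: eq_bigr => i _; rewrite card_ord.
  rewrite -(ler_nat R) natrM natr_prod.
  apply: (@le_trans _ _ (\prod_i (b / h i))).
    by rewrite prodf_div prodr_const card_ord ler_pdivlMr// prodr_gt0.
  apply: ler_prod => i _; have /andP[-> _] := N2 i; rewrite andbT.
  by rewrite divr_ge0// ltW.
have card' : (#|{: 'I_S * 'I_n}| <= #|{: cells}|)%N by rewrite card_prod !card_ord.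
pose e (sk : 'I_S * 'I_n) : cells := enum_val (widen_ord card' (enum_rank sk)).
exists (fun s k i => val (e (s, k) i)); split.
  move=> s k s' k' E.
  have : e (s, k) = e (s', k') by apply/ffunP => i; apply: val_inj; exact: E.
  move=> /enum_val_inj /(congr1 val) /= /val_inj/enum_rank_inj [-> ->].
  by [].
move=> s k i; apply: (@le_trans _ _ ((N i)%:R * h i)).
  by rewrite ler_wpM2r ?(ltW (h0 i))// ler_nat ltn_ord.
by rewrite -ler_pdivlMr//; case/andP: (N2 i).
Qed.

Context (dO : measure_display) (Omega : measurableType dO).
Variable P : probability Omega R.
Variable W : set (Rd R d) -> Omega -> R.
Hypothesis W_noise : white_noise P W.
Variable Wint : L2 R d -> Omega -> R.
Hypothesis Wint_integral : forall g : L2 R d, wiener_integral P W g (Wint g).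
Variables (p : \bar R) (p1 : (1 <= p)%E) (b q : R).
Hypotheses (b0 : 0 < b) (q1 : 1 <= q).
Variables (beta : 'I_d -> R) (r : 'I_d -> \bar R).
Hypotheses (beta0 : forall j, 0 < beta j) (r1 : forall j, (1 <= r j)%E).

(** The number of blocks is about rho / V and the number of cells per block about
b^d / rho; rounding to integers costs a factor 2 in each. *)
Lemma risk_lower_bound_cells : exists2 kap : R, 0 < kap & exists2 C : R, 1 <= C &
  forall (L h : 'I_d -> R) (A rho eps : R),
  (forall j, 0 < h j) -> (forall j, h j <= 1) -> (forall j, h j <= b) ->
  0 < A -> 0 < rho -> 0 < eps ->
  (forall j, C * A * rho `^ fine (r j)^-1%E <= L j * h j `^ beta j) ->
  \prod_i h i <= rho ->
  expR (A ^+ 2 * (\prod_i h i) / eps ^+ 2) <= b ^+ d / (32 * rho) ->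
  forall T : @observation R d -> LfunType (@lebesgue_measure_Rd R d) p1, estimator T ->
  exists2 f, nikolskii b beta r L f &
    ((kap * (A * rho `^ fine p^-1%E))%:E <= risk P Wint b eps q T f)%E.
Proof.
have [a a0 [C C1 hC]] := nikolskii_bump_sum beta0 r1.
have k0 : 0 < 16^-1 ^+ (a * d) :> R by rewrite exprn_gt0.
exists (16^-1 ^+ (a * d) / 8 * (2^-1 ^+ d.+1)).
  by rewrite mulr_gt0 ?exprn_gt0// divr_gt0.
exists C => // L h A rho eps h0 h1 hb A0 rho0 eps0 hL Vrho hexp T T_est.
pose V := \prod_i h i; rewrite -/V in Vrho hexp.
have V0 : 0 < V by apply: prodr_gt0.
pose S := Num.truncn (rho / V). pose n := Num.truncn (b ^+ d / rho).
have bd0 : 0 < b ^+ d by rewrite exprn_gt0.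
have /truncn_half/andP[S1 S2] : 1 <= rho / V by rewrite ler_pdivlMr// mul1r.
have bd32 : 32 <= b ^+ d / rho.
  have : 1 <= b ^+ d / (32 * rho).
    apply: le_trans hexp; rewrite -[leLHS]expR0 ler_expR; apply: divr_ge0; last exact: sqr_ge0.
    by apply: mulr_ge0; [exact: sqr_ge0|exact: ltW].
  by rewrite !ler_pdivlMr ?mulr_gt0//; lra.
have /truncn_half/andP[n1 n2] : 1 <= b ^+ d / rho by apply: le_trans bd32; rewrite ler1n.
rewrite -/S in S1 S2; rewrite -/n in n1 n2.
have SV : S%:R * V <= rho by rewrite -ler_pdivlMr.
have S0 : (0 < S)%N.
  by rewrite -(ltr_nat R) (lt_le_trans _ S1)// !divr_gt0.
have n0 : (0 < n)%N.
  by rewrite -(ltr_nat R) (lt_le_trans _ n1)// !divr_gt0.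
have Sn : S%:R * n%:R * \prod_i h i <= b ^+ d.
  rewrite -/V mulrAC; apply: (@le_trans _ _ (rho * n%:R)); first by rewrite ler_wpM2r.
  by rewrite mulrC -ler_pdivlMr.
have [c [c_inj c_cube]] := choose_cells b0 (fun i => introT andP (conj (h0 i) (hb i))) Sn.
have n16 : expR (A ^+ 2 * (\prod_i h i) / eps ^+ 2) <= n%:R / 16.
  apply: (le_trans hexp); rewrite invfM mulrCA; lra.
have [m hm] := minimax_bumps W_noise Wint_integral a0 h0 S0 n0 c_inj c_cube A0 eps0 q1 n16 T_est.
have rho0' j := fine_inv_ge0 (r1 j).
have p0' := fine_inv_ge0 p1. have p1' := fine_inv_le1 p1.
exists (bump_sum b a h (fun s => c s (m s)) A); last first.
  apply: le_trans hm; rewrite lee_fin.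
  have -> : (3 / 4 - 4^-1 : R) = 2^-1 by lra.
  set y := fine p^-1%E in p0' p1' *; set k := 16^-1 ^+ _ in k0 *.
  have E1 : (2^-1 ^+ d * \prod_i h i) `^ y * S%:R `^ y = (2^-1 ^+ d * (S%:R * V)) `^ y.
    by rewrite -powRM ?mulr_ge0 ?exprn_ge0 ?(ltW V0)//; congr (_ `^ _); rewrite -/V; lra.
  have E2 : 2^-1 ^+ d.+1 * rho `^ y <= (2^-1 ^+ d * (S%:R * V)) `^ y.
    apply: (@le_trans _ _ ((2^-1 ^+ d.+1 * rho) `^ y)).
      rewrite powRM ?exprn_ge0 ?(ltW rho0)// ler_wpM2r ?powR_ge0//.
      by rewrite ger1_powR// exprn_gt0//= exprn_ile1//; lra.
    apply: ge0_ler_powR; rewrite ?nnegrE ?mulr_ge0 ?exprn_ge0 ?(ltW rho0) ?(ltW V0)//.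
    rewrite exprSr -mulrA ler_wpM2l ?exprn_ge0//.
    have : rho / V / 2 * V <= S%:R * V by rewrite ler_wpM2r// ltW.
    by rewrite mulrAC divfK ?gt_eqF//; lra.
  have -> : A * k * (2^-1 ^+ d * \prod_i h i) `^ y / 2 * S%:R `^ y / 4 =
    A * k / 8 * ((2^-1 ^+ d * \prod_i h i) `^ y * S%:R `^ y) by lra.
  rewrite E1; apply: le_trans (ler_wpM2l _ E2); first by lra.
  by rewrite divr_ge0// mulr_ge0 ?(ltW A0) ?(ltW k0).
split.
- apply: hC => //.
  + by move=> i; rewrite h0 h1.
  + by move=> z z' E; have [] := c_inj _ _ _ _ E.
  + exact: ltW.
  + by rewrite card_ord.
  move=> j; apply: le_trans (hL j); rewrite card_ord ler_wpM2l ?mulr_ge0 ?(ltW A0)//.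
    by rewrite (le_trans _ C1).
  by apply: ge0_ler_powR; rewrite ?nnegrE ?mulr_ge0 ?(ltW rho0) ?(ltW V0).
- exact: L2_bump_sum.
- move=> x hx; by apply: (@bump_sum_cube R d b a h).
Qed.

End master.

(** * The constraints in logarithmic scale *)

Section log_scale.
Context {R : realType}.

Lemma ln_prod (J : finType) (F : J -> R) : (forall j, 0 < F j) ->
  ln (\prod_j F j) = \sum_j ln (F j).
Proof.
move=> F0; suff [_ ->] : 0 < \prod_j F j /\ ln (\prod_j F j) = \sum_j ln (F j) by [].
apply: (big_ind2 (fun x y => 0 < x /\ ln x = y)) => //.
- by rewrite ln1.
- by move=> x1 x2 y1 y2 [x0 <-] [y0 <-]; rewrite mulr_gt0// lnM// posrE.
Qed.

Lemma ln_inj_pos (x y : R) : 0 < x -> 0 < y -> ln x = ln y -> x = y.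
Proof. by move=> x0 y0 e; rewrite -(lnK x0) -(lnK y0) e. Qed.

Lemma ln_L_beta d (beta L : 'I_d -> R) : (forall j, 0 < L j) ->
  ln (L_beta beta L) = \sum_j (beta j)^-1 * ln (L j).
Proof.
by move=> L0; rewrite ln_prod => [|j]; [apply: eq_bigr => j _; rewrite ln_powR|exact: powR_gt0].
Qed.

Lemma L_beta_gt0 d (beta L : 'I_d -> R) : (forall j, 0 < L j) -> 0 < L_beta beta L.
Proof. by move=> L0; apply: prodr_gt0 => j _; exact: powR_gt0. Qed.

End log_scale.

Section master_log.
Context {R : realType} (d : nat).
Context (dO : measure_display) (Omega : measurableType dO).
Variable P : probability Omega R.
Variable W : set (Rd R d) -> Omega -> R.
Hypothesis W_noise : white_noise P W.
Variable Wint : L2 R d -> Omega -> R.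
Hypothesis Wint_integral : forall g : L2 R d, wiener_integral P W g (Wint g).
Variables (p : \bar R) (p1 : (1 <= p)%E) (b q : R).
Hypotheses (b0 : 0 < b) (q1 : 1 <= q).
Variables (beta : 'I_d -> R) (r : 'I_d -> \bar R).
Hypotheses (beta0 : forall j, 0 < beta j) (r1 : forall j, (1 <= r j)%E).
Local Notation B := (inv_beta beta).
Local Notation O := (inv_omega beta r).

(** Here al, lr and x are the logarithms of the amplitude A, of the measure rho of
the support and of eps, and lV is the logarithm of the volume V of a cell. The
conditions ensure that the sides h_j are at most 1 and b, that V <= rho, and that
the cells are numerous enough to hide the active ones. *)
Definition admissible (lc leta lb : R) (L : 'I_d -> R) (x al lr : R) :=
  let lV := B * (lc + al) + O * lr - ln (L_beta beta L) in
  [/\ forall j, al + fine (r j)^-1%E * lr <= leta + ln (L j),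
      lV <= lr & expR (2 * al + lV - 2 * x) <= lb - lr].

(** The sides h_j are chosen to make the smoothness constraints equalities. *)
Lemma risk_lower_bound : exists2 kap : R, 0 < kap & exists lc leta lb : R,
  forall (L : 'I_d -> R) (x al lr : R), (forall j, 0 < L j) ->
  admissible lc leta lb L x al lr ->
  forall T : @observation R d -> LfunType (@lebesgue_measure_Rd R d) p1, estimator T ->
  exists2 f, nikolskii b beta r L f &
    ((kap * expR (al + fine p^-1%E * lr))%:E <= risk P Wint b (expR x) q T f)%E.
Proof.
have [kap kap0 [C C1 hC]] := risk_lower_bound_cells W_noise Wint_integral p1 b0 q1 beta0 r1.
have C0 : 0 < C by lra.
pose mb := Num.min 1 b.
have mb0 : 0 < mb by rewrite lt_min ltr01.
have mb1 : mb <= 1 by rewrite ge_min lexx.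
have mbb : mb <= b by rewrite ge_min lexx orbT.
pose eta := (\prod_j mb `^ beta j) / C.
have etaj j : C * eta <= mb `^ beta j.
  rewrite mulrC divfK ?gt_eqF// (bigD1 j)//= ler_piMr ?powR_ge0//.
  apply: prodr_ile1 => i _; rewrite powR_ge0/=.
  by have := ge0_ler_powR (ltW (beta0 i)) (x := mb) (y := 1); rewrite powR1; apply; rewrite ?nnegrE// ltW.
have eta0 : 0 < eta by rewrite divr_gt0// prodr_gt0// => j _; exact: powR_gt0.
exists kap => //; exists (ln C), (ln eta), (ln (b ^+ d / 32)).
move=> L x al lr L0 [hi hii hiii] T T_est.
pose e j := fine (r j)^-1%E.
(* ln h_j, from C * A * rho^(1/r_j) = L_j * h_j^beta_j *)
pose u j := (ln C + al + e j * lr - ln (L j)) / beta j.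
pose h j := expR (u j).
have h0 j : 0 < h j by exact: expR_gt0.
have hb j : h j `^ beta j = C * expR al * expR lr `^ e j / L j.
  apply: ln_inj_pos; first exact: powR_gt0.
    by rewrite divr_gt0// mulr_gt0 ?powR_gt0 ?expR_gt0// mulr_gt0// expR_gt0.
  rewrite ln_powR expRK lnM ?posrE ?invr_gt0//; last first.
    by rewrite mulr_gt0 ?powR_gt0 ?expR_gt0// mulr_gt0// expR_gt0.
  rewrite lnV ?posrE// lnM ?posrE ?powR_gt0 ?expR_gt0//; last by rewrite mulr_gt0// expR_gt0.
  rewrite lnM ?posrE ?expR_gt0// expRK ln_powR expRK /u mulrC divfK// gt_eqF//.
have hmb j : h j <= mb.
  have bj := beta0 j.
  have : h j `^ beta j <= mb `^ beta j.
    have hh : expR al * expR lr `^ e j <= eta * L j.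
      rewrite -(lnK (_ : L j \in Num.pos)) ?posrE// -{1}(lnK (_ : eta \in Num.pos)) ?posrE//.
      by rewrite -expRM [_ * e j]mulrC -!expRD ler_expR; exact: hi.
    apply: le_trans (etaj j); rewrite hb ler_pdivrMr//.
    by rewrite -[C * _ * _]mulrA -[C * eta * _]mulrA ler_wpM2l ?(ltW C0).
  move=> hm; rewrite leNgt; apply/negP => lt.
  have := @gt0_ltr_powR R (beta j) bj mb (h j); rewrite !nnegrE => /(_ (ltW mb0) (ltW (h0 j)) lt).
  by rewrite ltNge hm.
have lnV : ln (\prod_i h i) = B * (ln C + al) + O * lr - ln (L_beta beta L).
  rewrite ln_prod// ln_L_beta// /inv_beta /inv_omega !mulr_suml -big_split/= -sumrB.
  by apply: eq_bigr => j _; rewrite expRK /u; have := gt_eqF (beta0 j); rewrite /e; lra.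
have V0 : 0 < \prod_i h i by apply: prodr_gt0.
have VE : \prod_i h i = expR (B * (ln C + al) + O * lr - ln (L_beta beta L)).
  by rewrite -lnV lnK.
have bd0 : 0 < b ^+ d / 32 by rewrite divr_gt0// exprn_gt0.
have h1' j : h j <= 1 by exact: le_trans (hmb j) mb1.
have hb' j : h j <= b by exact: le_trans (hmb j) mbb.
have hc j : C * expR al * expR lr `^ fine (r j)^-1%E <= L j * h j `^ beta j.
  by rewrite hb mulrCA mulfV ?mulr1// gt_eqF.
have hV : \prod_i h i <= expR lr by rewrite VE ler_expR.
have hexp : expR (expR al ^+ 2 * (\prod_i h i) / expR x ^+ 2) <= b ^+ d / (32 * expR lr).
  rewrite VE -!expRM_natl -expRD -expRN -expRD.
  have -> : b ^+ d / (32 * expR lr) = expR (ln (b ^+ d / 32) - lr).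
    by rewrite expRD expRN lnK ?posrE// invfM mulrA.
  by rewrite ler_expR; apply: le_trans hiii; rewrite ler_expR; lra.
have [f hf fr] := hC L h (expR al) (expR lr) (expR x) h0 h1' hb' (expR_gt0 _) (expR_gt0 _)
  (expR_gt0 _) hc hV hexp T T_est.
exists f => //; apply: le_trans fr; rewrite lee_fin ler_wpM2l ?(ltW kap0)//.
by rewrite expRD ler_wpM2l ?expR_ge0// [_ * lr]mulrC expRM.
Qed.

End master_log.

(** * Amplitude and support in the four regimes *)

Section rates.
Context {R : realType} (d : nat).
Variables (beta : 'I_d -> R) (r : 'I_d -> \bar R) (lc leta lb L0 : R).
Hypotheses (beta0 : forall j, 0 < beta j) (L00 : 0 < L0).
Local Notation B := (inv_beta beta).
Local Notation O := (inv_omega beta r).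
Local Notation e j := (fine (r j)^-1%E).
Local Notation adm := (admissible beta r lc leta lb).
Hypothesis B0 : 0 < B.

(** ln (eps ^ 2 * |ln eps|) for eps = expR x < 1. *)
Definition log_noise (x : R) : R := 2 * x + ln (- x).

Lemma log_noise_le x : x < 0 -> log_noise x <= x.
Proof.
move=> x0; have : ln (- x) <= - x.
  have := expR_ge1Dx (ln (- x)); rewrite lnK ?posrE ?oppr_gt0//; lra.
rewrite /log_noise; lra.
Qed.

Lemma near_ninfty_lin (sl K : R) : 0 < sl -> \forall x \near -oo, sl * x <= K.
Proof.
move=> sl0; near=> x.
have : x <= K / sl by near: x; apply: nbhs_ninfty_le; rewrite num_real.
by rewrite ler_pdivlMr// mulrC.
Unshelve. all: by end_near. Qed.

Lemma near_log_noise (sl K : R) : 0 < sl -> \forall x \near -oo, sl * log_noise x <= K.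
Proof.
move=> sl0; near=> x.
have x0 : x < 0 by near: x; apply: nbhs_ninfty_lt; rewrite num_real.
have : sl * x <= K by near: x; exact: near_ninfty_lin.
by apply: le_trans; rewrite ler_wpM2l ?(ltW sl0)// log_noise_le.
Unshelve. all: by end_near. Qed.

Lemma ln_L_beta_ge (L : 'I_d -> R) : (forall j, L0 <= L j) -> B * ln L0 <= ln (L_beta beta L).
Proof.
move=> hL; have Lp j : 0 < L j by exact: lt_le_trans (hL j).
rewrite ln_L_beta// /inv_beta mulr_suml; apply: ler_sum => j _.
by rewrite ler_wpM2l ?invr_ge0 ?(ltW (beta0 j))// ler_ln ?posrE.
Qed.

(* the inverse of p *)
Variable y : R.

(** The support has constant measure, just small enough for the last constraint
when A^2 * V = eps^2, which determines A. *)
Lemma dense_rate (L : 'I_d -> R) : (forall j, L0 <= L j) ->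
  \forall x \near -oo, exists al lr, adm L x al lr /\
    (- (B * lc + O * (lb - 1))) / (2 + B) + y * (lb - 1) +
      (2 + B)^-1 * (ln (L_beta beta L) + 2 * x) <= al + y * lr.
Proof.
move=> hL; set ll := ln _; pose D := 2 + B.
have D0 : 0 < D by rewrite /D addr_gt0.
(* then A^2 * V / eps^2 = exp 0 = 1 is exactly lb - lr *)
pose lr := lb - 1. pose k := ll - B * lc - O * lr.
have h1 : \forall x \near -oo, forall j : 'I_d, 2 * x <= D * (leta + ln (L j) - e j * lr) - k.
  by apply: filter_forall => j; apply: near_ninfty_lin.
near=> x.
have hi : forall j : 'I_d, 2 * x <= D * (leta + ln (L j) - e j * lr) - k by near: x; exact: h1.
have hii : (2 * B) * x <= D * lr + 2 * k.
  by near: x; apply: near_ninfty_lin; rewrite mulr_gt0.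
pose al := (2 * x + k) / D.
have alE : D * al = 2 * x + k by rewrite mulrC divfK ?gt_eqF.
have lVE : B * (lc + al) + O * lr - ll = 2 * x - 2 * al.
  by move: alE; rewrite /D /k; lra.
exists al, lr; split; first split.
- move=> j; rewrite -lerBrDr -(ler_pM2l D0) alE; have := hi j; lra.
- rewrite -/ll lVE -(ler_pM2l D0).
  have -> : D * (2 * x - 2 * al) = 2 * (D * x) - 2 * (D * al) by lra.
  by rewrite alE; move: hii; rewrite /D; lra.
- rewrite -/ll lVE; have -> : 2 * al + (2 * x - 2 * al) - 2 * x = 0 by lra.
  by rewrite expR0 /lr; lra.
rewrite -/lr le_eqVlt; apply/orP; left; apply/eqP.
rewrite /al /k -/D; lra.
Unshelve. all: by end_near. Qed.

(** One block, V = rho, and A^2 * V = c eps^2 |ln eps|. Since - ln rho grows at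
least like B / (2 t2) * |ln eps|, the constant c = B / (4 t2) leaves enough cells.
The hypotheses on the r_j say that amplitude times rho^(1/r_j) vanishes with eps,
so that the first constraint holds for small eps. *)
Lemma sparse_rate (t2 ty : R) (L : 'I_d -> R) :
  t2 = 1 - O + B / 2 -> 0 < t2 -> ty = 1 - O + y * B ->
  (forall j, 0 < 1 - O + e j * B) -> (forall j, L0 <= L j) ->
  \forall x \near -oo, exists al lr, adm L x al lr /\
    (ty * ln (B / (4 * t2)) - (1 - 2 * y) * (B * lc)) / (2 * t2) +
     ((1 - 2 * y) * ln (L_beta beta L) + ty * log_noise x) / (2 * t2) <= al + y * lr.
Proof.
move=> t2E t20 tyE te hL; set ll := ln (L_beta _ _).
pose T := 2 * t2; have T0 : 0 < T by rewrite mulr_gt0.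
pose c3 := B / (4 * t2); have c30 : 0 < c3 by rewrite divr_gt0// mulr_gt0.
pose l3 := ln c3.
have h1 : \forall x \near -oo, forall j : 'I_d, (1 - O + e j * B) * log_noise x <=
    T * (leta + ln (L j)) - (1 - O + e j * B) * l3 - (1 - 2 * e j) * (ll - B * lc).
  by apply: filter_forall => j; apply: near_log_noise.
near=> x.
have x0 : x < 0 by near: x; apply: nbhs_ninfty_lt; rewrite num_real.
have hi : forall j : 'I_d, (1 - O + e j * B) * log_noise x <=
    T * (leta + ln (L j)) - (1 - O + e j * B) * l3 - (1 - 2 * e j) * (ll - B * lc).
  by near: x; exact: h1.
have hiii : (B / 2) * x <= T * lb - B * l3 + 2 * ll - 2 * (B * lc).
  by near: x; apply: near_ninfty_lin; rewrite divr_gt0.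
pose le := log_noise x.
pose al := (ll - B * lc + (1 - O) * (l3 + le)) / T.
have alE : T * al = ll - B * lc + (1 - O) * (l3 + le) by rewrite mulrC divfK ?gt_eqF.
pose lr := l3 + le - 2 * al.
have TE : T = 2 - 2 * O + B by rewrite /T t2E; lra.
have lrE : T * lr = B * (l3 + le) - 2 * ll + 2 * (B * lc).
  have -> : T * lr = T * (l3 + le) - 2 * (T * al) by rewrite /lr; lra.
  by rewrite alE TE; lra.
have lVE : B * (lc + al) + O * lr - ll = lr.
  by move: alE; rewrite TE /lr; lra.
have lin z : T * (al + z * lr) = (1 - O + z * B) * (l3 + le) + (1 - 2 * z) * (ll - B * lc).
  have -> : T * (al + z * lr) = T * al + z * (T * lr) by lra.
  by rewrite alE lrE; lra.
exists al, lr; split; first split.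
- by move=> j; rewrite -(ler_pM2l T0) lin; have := hi j; rewrite -/le; lra.
- by rewrite -/ll lVE.
- rewrite -/ll lVE.
  have -> : 2 * al + lr - 2 * x = l3 + ln (- x) by rewrite /lr /le /log_noise; lra.
  rewrite expRD /l3 !lnK ?posrE ?oppr_gt0// -(ler_pM2l T0).
  have -> : T * (c3 * - x) = - (B / 2) * x.
    rewrite /T /c3; have -> : 2 * t2 * (B / (4 * t2) * - x) = - (B / 2 * x) * (t2 / t2).
      by rewrite invfM; lra.
    by rewrite mulfV ?gt_eqF// mulr1 mulNr.
  rewrite mulrBr lrE.
  have : B * le <= B * x by rewrite ler_wpM2l ?(ltW B0)// log_noise_le.
  by move: hiii; rewrite -/c3 -/l3; lra.
rewrite -mulrDl ler_pdivrMr// -/T mulrC -[leRHS]mulrC lin -tyE -/c3 -/l3 -/le.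
lra.
Unshelve. all: by end_near. Qed.

(** With s the inverse of p*, the value of A * rho^s is a small constant exp l4, and
A^2 * V = c eps^2 |ln eps| determines rho. As - ln rho grows at least like
|ln eps| / D, the constant c = 1 / (2 D) leaves enough cells. *)
Lemma intermediate_rate (s D l4 : R) (L : 'I_d -> R) :
  D = O - s * (2 + B) -> 0 < D -> 1 - O + s * B <= 0 -> (forall j, s <= e j) ->
  l4 = Num.min (leta + ln L0) (ln L0 - lc) ->
  (forall j, L0 <= L j) ->
  \forall x \near -oo, exists al lr, adm L x al lr /\
    l4 + (y - s) / D * (ln (2 * D)^-1 - B * lc - (2 + B) * l4) +
     (y - s) / D * (ln (L_beta beta L) + log_noise x) <= al + y * lr.
Proof.
move=> DE D0 ts se l4E hL; set ll := ln (L_beta _ _).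
have l4a : l4 <= leta + ln L0 by rewrite l4E ge_min lexx.
have l4b : l4 <= ln L0 - lc by rewrite l4E ge_min lexx orbT.
pose c3 := (2 * D)^-1; have c30 : 0 < c3 by rewrite invr_gt0 mulr_gt0.
pose l3 := ln c3.
near=> x.
have x0 : x < 0 by near: x; apply: nbhs_ninfty_lt; rewrite num_real.
have hlr : 1 * log_noise x <= - (l3 + ll - B * lc - (2 + B) * l4).
  by near: x; apply: near_log_noise.
have hiii : 2^-1 * x <= D * lb - (l3 + ll - B * lc - (2 + B) * l4).
  by near: x; apply: near_ninfty_lin; rewrite invr_gt0.
pose le := log_noise x.
pose lr := (l3 + ll + le - B * lc - (2 + B) * l4) / D.
have lrE : D * lr = l3 + ll + le - B * lc - (2 + B) * l4 by rewrite mulrC divfK ?gt_eqF.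
have lr0 : lr <= 0.
  by rewrite -(pmulr_rle0 _ D0) lrE; move: hlr; rewrite -/le; lra.
have Bll := ln_L_beta_ge hL; rewrite -/ll in Bll.
exists (l4 - s * lr), lr; split; first split.
- move=> j; have : (e j - s) * lr <= 0 by rewrite mulr_ge0_le0// subr_ge0.
  have : ln L0 <= ln (L j) by rewrite ler_ln ?posrE// (lt_le_trans L00).
  lra.
- rewrite -/ll; have : (O - s * B - 1) * lr <= 0 by rewrite mulr_ge0_le0//; lra.
  have : B * l4 <= B * (ln L0 - lc) by rewrite ler_wpM2l// ltW.
  lra.
- rewrite -/ll.
  have -> : 2 * (l4 - s * lr) + (B * (lc + (l4 - s * lr)) + O * lr - ll) - 2 * x =
      l3 + ln (- x).
    by move: lrE; rewrite DE /le /log_noise; lra.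
  rewrite expRD /l3 !lnK ?posrE ?oppr_gt0// -(ler_pM2l D0).
  have -> : D * (c3 * - x) = - (2^-1 * x).
    rewrite /c3 invfM; have -> : D * (2^-1 * D^-1 * - x) = - (2^-1 * x) * (D / D) by lra.
    by rewrite mulfV ?gt_eqF// mulr1.
  have := log_noise_le x0; rewrite mulrBr lrE -/le.
  by move: hiii; rewrite -/c3 -/l3; lra.
rewrite le_eqVlt; apply/orP; left; apply/eqP.
rewrite -/c3 -/l3 -/le.
have -> : lr = (l3 + ll + le - B * lc - (2 + B) * l4) * D^-1 by [].
lra.
Unshelve. all: by end_near. Qed.

(** With A * rho^s constant, making rho smaller only relaxes the constraints
V <= rho and A^2 * V, and provides as many cells as needed. Equal radii
L0 suffice, whatever the radii of the class. *)
Lemma inconsistency_rate (s l4 x : R) :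
  0 <= O - s * (2 + B) -> 1 - O + s * B <= 0 -> (forall j, s <= e j) ->
  l4 = Num.min (leta + ln L0) (ln L0 - lc) ->
  exists al lr, adm (fun=> L0) x al lr /\ l4 <= al + s * lr.
Proof.
move=> Os ts se l4E.
have l4a : l4 <= leta + ln L0 by rewrite l4E ge_min lexx.
have l4b : l4 <= ln L0 - lc by rewrite l4E ge_min lexx orbT.
set ll := ln (L_beta beta (fun=> L0)).
pose K := 2 * l4 + B * (lc + l4) - ll.
pose lr := Num.min 0 (lb - expR (K - 2 * x)).
have lr0 : lr <= 0 by rewrite ge_min lexx.
have lr1 : lr <= lb - expR (K - 2 * x) by rewrite ge_min lexx orbT.
have Bll : B * ln L0 <= ll by apply: ln_L_beta_ge.
exists (l4 - s * lr), lr; split; first split.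
- by move=> j; have : (e j - s) * lr <= 0 by [rewrite mulr_ge0_le0// subr_ge0]; lra.
- rewrite -/ll; have : (O - s * B - 1) * lr <= 0 by rewrite mulr_ge0_le0//; lra.
  have : B * l4 <= B * (ln L0 - lc) by rewrite ler_wpM2l// ltW.
  lra.
- apply: (@le_trans _ _ (expR (K - 2 * x))); last by lra.
  rewrite ler_expR -/ll.
  have : (O - s * (2 + B)) * lr <= 0 by rewrite mulr_ge0_le0.
  rewrite /K; lra.
lra.
Qed.

End rates.

(** * Exponents of the rate *)

Section exponents.
Context {R : realType}.

Lemma fine_inv_fin (z : R) : 1 <= z -> fine (z%:E)^-1%E = z^-1.
Proof. by move=> z1; rewrite inver gt_eqF// (lt_le_trans _ z1). Qed.

Lemma fine_inv_lt (s t : \bar R) : (1 <= s)%E -> (s < t)%E -> fine t^-1%E < fine s^-1%E.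
Proof.
case: s => [s| |//]; case: t => [t| |//]; rewrite ?ltNyr ?ltry ?ltxx// ?lee_fin ?lte_fin.
- move=> s1 st; rewrite !fine_inv_fin ?(le_trans s1 (ltW st))//.
  by rewrite ltf_pV2// ?posrE; lra.
- by move=> s1 _; rewrite fine_inv_fin// invey/= invr_gt0; lra.
Qed.

Lemma fine_inv_le (s t : \bar R) : (1 <= s)%E -> (s <= t)%E -> fine t^-1%E <= fine s^-1%E.
Proof. by move=> s1; rewrite le_eqVlt => /predU1P[->//|/(fine_inv_lt s1)/ltW]. Qed.

Variables (d : nat) (beta : 'I_d -> R) (r : 'I_d -> \bar R) (p : \bar R).
Hypotheses (d0 : (0 < d)%N) (beta0 : forall j, 0 < beta j).
Hypotheses (r1 : forall j, (1 <= r j)%E) (p1 : (1 <= p)%E).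
Local Notation B := (inv_beta beta).
Local Notation O := (inv_omega beta r).
Local Notation s := (fine (pstar r p)^-1%E).
Local Notation y := (fine p^-1%E).

Lemma inv_beta_gt0 : 0 < B.
Proof.
rewrite /inv_beta (bigD1 (Ordinal d0))//= ltr_pwDl ?invr_gt0//.
by apply: sumr_ge0 => j _; rewrite invr_ge0 ltW.
Qed.

Lemma inv_omega_ge0 : 0 <= O.
Proof. by apply: sumr_ge0 => j _; rewrite mulr_ge0 ?fine_inv_ge0// invr_ge0 ltW. Qed.

Lemma pstar_ge : (p <= pstar r p)%E.
Proof. by rewrite /pstar le_max lexx orbT. Qed.

Lemma pstar_ge_r j : (r j <= pstar r p)%E.
Proof. by rewrite /pstar le_max le_bigmax. Qed.

(** A linear form of the condition, which covers p = +oo, where y = 0. *)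
Lemma kappa_le0 : ~~ (0 < kappa beta r p)%E -> (2 + B) * y <= O.
Proof.
have B0 := inv_beta_gt0; have O0 := inv_omega_ge0.
rewrite /kappa; case: p p1 => [z|_|//]; last by rewrite invey/= mulr0.
rewrite lee_fin => z1 /=; rewrite /omega.
have zp : 0 < z by lra.
have [->|On0] := eqVneq O 0.
  by rewrite inve0 gt0_mulye ?addye ?ltry// lte_fin; lra.
have Op : 0 < O by rewrite lt_def On0.
rewrite inver (negPf On0) -EFinM -EFinB lte_fin -leNgt subr_le0.
by rewrite ler_pdivrMl// fine_inv_fin// ler_pdivrMr.
Qed.

(** In terms of the inverses of p and p* the exponent needs no separate
expression for infinite p*. *)
Lemma intermediate_exponent : ~~ (0 < kappa beta r p)%E -> tau beta r (pstar r p) <= 0 ->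
  (p < pstar r p)%E ->
  0 < O - s * (2 + B) /\ rate_exponent beta r p = (y - s) / (O - s * (2 + B)).
Proof.
move=> k0 t0 pp; have := kappa_le0 k0 => ky.
have B0 := inv_beta_gt0; have O0 := inv_omega_ge0.
have ys : s < y by exact: fine_inv_lt.
have s0 : 0 <= s by apply: fine_inv_ge0; exact: le_trans pstar_ge.
have D0 : 0 < O - s * (2 + B).
  have : s * (2 + B) < y * (2 + B) by rewrite ltr_pM2r//; lra.
  lra.
split => //.
have Op : 0 < O by have : 0 <= s * (2 + B) by [apply: mulr_ge0 => //; lra]; lra.
rewrite /rate_exponent (negPf k0) ltNge t0/= pp.
have -> : fine (omega beta r) = O^-1 by rewrite /omega inver gt_eqF.
have [z zE] : exists z : R, p = z%:E.
  by move: pp p1; case: p => [z| |//]; [exists z|rewrite ltNge leey].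
have z1 : 1 <= z by move: p1; rewrite zE lee_fin.
have yE : y = z^-1 by rewrite zE fine_inv_fin.
have -> : fine p = z by rewrite zE.
move: (pstar r p) pstar_ge s0 ys D0 => [P| |]; last 2 first.
- by rewrite eqxx invey/= subr0 mul0r subr0 yE mulrC.
- by rewrite zE leeNy_eq.
rewrite zE lee_fin => zP; have P1 : 1 <= P by exact: le_trans zP.
rewrite fine_inv_fin// fine_inv_fin//= => s0 ys D0.
set w := O^-1; have wO : w * O = 1 by rewrite mulVf ?gt_eqF.
have yz : z^-1 * z = 1 by rewrite mulVf// gt_eqF//; lra.
have sP : P^-1 * P = 1 by rewrite mulVf// gt_eqF//; lra.
set E := P - w * (2 + B).
have -> : z^-1 - P^-1 = (P - z) * (z^-1 * P^-1).
  have -> : (P - z) * (z^-1 * P^-1) = (P^-1 * P) * z^-1 - (z^-1 * z) * P^-1 by lra.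
  by rewrite sP yz !mul1r.
have -> : O - P^-1 * (2 + B) = E * (O * P^-1).
  have -> : E * (O * P^-1) = (P^-1 * P) * O - (w * O) * (P^-1 * (2 + B)) by rewrite /E; lra.
  by rewrite sP wO !mul1r.
rewrite !invfM invrK -/w.
have -> : (P - z) * (z^-1 * P^-1) * (E^-1 * (w * P)) = (P^-1 * P) * (w * (P - z) * (z^-1 * E^-1)).
  by move: E^-1 z^-1 P^-1 => e f g; lra.
by rewrite sP mul1r.
Qed.

Variables (lc leta lb L0 : R).
Hypothesis L00 : 0 < L0.

(** The radii L' differ from L only in the regime of zero exponent, where they are
the constant L0; the Nikolskii class increases with its radii. *)
Lemma parameters_attaining_rate : exists l0 : R, forall L : 'I_d -> R, (forall j, L0 <= L j) ->
  \forall x \near -oo, exists L' al lr,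
    [/\ forall j, 0 < L' j, forall j, L' j <= L j,
        admissible beta r lc leta lb L' x al lr &
        l0 + rate_exponent beta r p * ln (delta beta r p L (expR x)) <= al + y * lr].
Proof.
have B0 := inv_beta_gt0; have O0 := inv_omega_ge0.
have y0 : 0 <= y by exact: fine_inv_ge0.
have x2 (x : R) : 0 < expR x ^+ 2 by rewrite exprn_gt0 ?expR_gt0.
have lnx (g x : R) : 0 < g -> ln (g * expR x ^+ 2) = ln g + 2 * x.
  by move=> g0; rewrite lnM ?posrE ?x2// -expRM_natl expRK.
have lnd (g x : R) : x < 0 -> 0 < g ->
    ln (g * expR x ^+ 2 * `|ln (expR x)|) = ln g + log_noise x.
  move=> x0 g0; rewrite expRK ltr0_norm// [LHS]lnM ?posrE ?oppr_gt0 ?(mulr_gt0 g0) ?x2//.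
  by rewrite lnx// /log_noise addrA.
have Lp (L : 'I_d -> R) : (forall j, L0 <= L j) -> forall j, 0 < L j.
  by move=> hL j; exact: lt_le_trans (hL j).
have lbp (L : 'I_d -> R) : (forall j, L0 <= L j) -> 0 < L_beta beta L.
  by move=> hL; apply: L_beta_gt0; exact: Lp.
have [k0|k0] := boolP (0 < kappa beta r p)%E.
  have -> : rate_exponent beta r p = (2 + B)^-1.
    rewrite /rate_exponent k0 /beta_mean.
    have -> : 2 * B^-1 + 1 = (2 + B) * B^-1 by rewrite [RHS]mulrDl mulfV ?(gt_eqF B0).
    by rewrite invfM invrK mulrCA mulVf ?mulr1 ?(gt_eqF B0).
  exists (- (B * lc + O * (lb - 1)) / (2 + B) + y * (lb - 1)) => L hL; near=> x.
  have : exists al lr, admissible beta r lc leta lb L x al lr /\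
      (- (B * lc + O * (lb - 1))) / (2 + B) + y * (lb - 1) +
        (2 + B)^-1 * (ln (L_beta beta L) + 2 * x) <= al + y * lr.
    by near: x; exact: dense_rate.
  move=> [al [lr [adm hv]]].
  exists L, al, lr; split => //; first exact: Lp.
  by apply: le_trans hv; rewrite /delta k0 lnx ?lbp.
have ky := kappa_le0 k0.
have [t0|t0] := ltP 0 (tau beta r (pstar r p)).
  have s0 : 0 <= s by apply: fine_inv_ge0; exact: le_trans pstar_ge.
  have tle z : s <= z -> 0 < 1 - O + z * B.
    by move=> sz; apply: lt_le_trans t0 _; rewrite /tau lerD2l ler_wpM2r// ltW.
  have ty0 : 0 < 1 - O + y * B by apply: tle; apply: fine_inv_le => //; exact: pstar_ge.
  have te j : 0 < 1 - O + fine (r j)^-1%E * B.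
    by apply: tle; apply: fine_inv_le => //; exact: pstar_ge_r.
  have t2E : tau beta r 2%:E = 1 - O + B / 2 by rewrite /tau fine_inv_fin// ?ler1n// mulrC.
  have t20 : 0 < tau beta r 2%:E.
    apply: (lt_le_trans ty0); rewrite t2E lerD2l mulrC ler_pM2l//.
    have : 0 < 1 - 2 * y by move: ty0 ky; rewrite mulrDl [B * y]mulrC; lra.
    lra.
  exists ((tau beta r p * ln (B / (4 * tau beta r 2%:E)) - (1 - 2 * y) * (B * lc)) / (2 * tau beta r 2%:E)) => L hL; near=> x.
  have x0 : x < 0 by near: x; apply: nbhs_ninfty_lt; rewrite num_real.
  have : exists al lr, admissible beta r lc leta lb L x al lr /\
    (tau beta r p * ln (B / (4 * tau beta r 2%:E)) - (1 - 2 * y) * (B * lc)) / (2 * tau beta r 2%:E) +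
     ((1 - 2 * y) * ln (L_beta beta L) + tau beta r p * log_noise x) / (2 * tau beta r 2%:E)
      <= al + y * lr.
    by near: x; exact: sparse_rate.
  move=> [al [lr [adm hv]]].
  exists L, al, lr; split => //; first exact: Lp.
  apply: le_trans hv; rewrite /delta (negPf k0) [tau _ _ _ <= 0]leNgt t0/= lnd ?powR_gt0 ?lbp// ln_powR.
  rewrite /rate_exponent (negPf k0) t0 lerD2l le_eqVlt; apply/orP; left; apply/eqP.
  have uE : 1 - 2 * y = (1 - 2 * y) / tau beta r p * tau beta r p by rewrite divfK// gt_eqF.
  rewrite [in RHS]uE; move: ((1 - 2 * y) / _) (2 * tau _ _ _)^-1 => u v; lra.
have pr j : s <= fine (r j)^-1%E by apply: fine_inv_le => //; exact: pstar_ge_r.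
pose l4 := Num.min (leta + ln L0) (ln L0 - lc).
have [pp|pp] := boolP (p < pstar r p)%E.
  have [D0 ->] := intermediate_exponent k0 t0 pp.
  exists (l4 + (y - s) / (O - s * (2 + B)) * (ln (2 * (O - s * (2 + B)))^-1 - B * lc - (2 + B) * l4)) => L hL; near=> x.
  have x0 : x < 0 by near: x; apply: nbhs_ninfty_lt; rewrite num_real.
  have : exists al lr, admissible beta r lc leta lb L x al lr /\
    l4 + (y - s) / (O - s * (2 + B)) * (ln (2 * (O - s * (2 + B)))^-1 - B * lc - (2 + B) * l4) +
     (y - s) / (O - s * (2 + B)) * (ln (L_beta beta L) + log_noise x) <= al + y * lr.
    by near: x; exact: intermediate_rate erefl D0 t0 pr erefl hL.
  move=> [al [lr [adm hv]]].
  exists L, al, lr; split => //; first exact: Lp.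
  by apply: le_trans hv; rewrite /delta (negPf k0) t0/= lnd ?lbp.
have pE : pstar r p = p.
  by apply/eqP; rewrite eq_le pstar_ge andbT leNgt.
exists l4 => L hL; near=> x.
have -> : rate_exponent beta r p = 0 by rewrite /rate_exponent (negPf k0) ltNge t0/= (negPf pp).
have [] := @inconsistency_rate _ _ beta r lc leta lb L0 beta0 L00 B0 y l4 x => //.
- by rewrite subr_ge0 mulrC.
- by rewrite -pE.
- by move=> j; rewrite -{1}pE.
move=> al [lr [adm hv]]; exists (fun=> L0), al, lr; split => //.
by rewrite mul0r addr0.
Unshelve. all: by end_near. Qed.
End exponents.

(** * The lower limit *)

Lemma nikolskii_mono (R : realType) (d : nat) (b : R) (beta : 'I_d -> R) (r : 'I_d -> \bar R)
    (L' L : 'I_d -> R) : (forall j, L' j <= L j) ->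
  nikolskii b beta r L' `<=` nikolskii b beta r L.
Proof.
move=> LL f [fL f2 f0]; split => // j; have [f1 [k bk fk]] := fL j.
split; first by apply: le_trans f1 _; rewrite lee_fin.
exists k => // u; apply: le_trans (fk u) _.
by rewrite lee_fin ler_wpM2r// powR_ge0.
Qed.

Lemma delta_gt0 (R : realType) (d : nat) (beta : 'I_d -> R) (r : 'I_d -> \bar R) (p : \bar R)
    (L : 'I_d -> R) (eps : R) : (forall j, 0 < L j) -> 0 < eps < 1 ->
  0 < delta beta r p L eps.
Proof.
move=> L0 /andP[e0 e1]; have Lb := L_beta_gt0 beta L0.
have e2 : 0 < eps ^+ 2 by exact: exprn_gt0.
have el : 0 < `|ln eps| by rewrite normr_gt0 lt_eqF// ln_lt0// e0.
rewrite /delta; case: ifP => _; first by rewrite mulr_gt0.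
by case: ifP => _; rewrite mulr_gt0// mulr_gt0// powR_gt0.
Qed.

Lemma limf_einf_right_ge (R : realType) (f : R -> \bar R) (c : \bar R) (M : R) :
  (forall x, x < M -> (c <= f (expR x))%E) -> (c <= limf_einf f 0^'+)%E.
Proof.
move=> h; rewrite limf_einfE; apply: le_ereal_sup_tmp.
exists (ereal_inf [set f e | e in [set e : R | 0 < e < expR M]]).
  exists [set e : R | 0 < e < expR M] => //.
  have h1 : \forall e \near (0:R)^'+, 0 < e by exact: nbhs_right_gt.
  have h2 : \forall e \near (0:R)^'+, e < expR M by apply: nbhs_right_lt; exact: expR_gt0.
  by near=> e; apply/andP; split; near: e.
apply/ereal_infP => _ [e /andP[e0 eM] <-].
rewrite -(lnK (_ : e \in Num.pos)) ?posrE//; apply: h.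
by rewrite -ltr_expR lnK ?posrE.
Unshelve. all: by end_near. Qed.

Theorem theorem2 (R : realType) (d : nat) (d_gt0 : (0 < d)%N)
    (b : R) (b_gt0 : 0 < b)
    (dO : measure_display) (Omega : measurableType dO)
    (P : probability Omega R)
    (W : set (Rd R d) -> Omega -> R) (W_noise : white_noise P W)
    (Wint : L2 R d -> Omega -> R)
    (Wint_integral : forall g : L2 R d, wiener_integral P W g (Wint g))
    (q L0 : R) (q_ge1 : 1 <= q) (L0_gt0 : 0 < L0)
    (p : \bar R) (p_ge1 : (1 <= p)%E)
    (beta : 'I_d -> R) (beta_gt0 : forall j, 0 < beta j)
    (r : 'I_d -> \bar R) (r_ge1 : forall j, (1 <= r j)%E) :
  exists2 c : R, 0 < c &
    forall L : 'I_d -> R, (forall j, L0 <= L j) ->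
    (c%:E <= limf_einf (fun eps : R =>
       ereal_inf [set ereal_sup
         [set (delta beta r p L eps `^ (- rate_exponent beta r p))%:E
                * risk P Wint b eps q T f
         | f in nikolskii b beta r L]
       | T in @estimator R d p p_ge1]) 0^'+)%E.
Proof.
have [kap kap0 [lc [leta [lb hrisk]]]] :=
  risk_lower_bound W_noise Wint_integral p_ge1 b_gt0 q_ge1 beta_gt0 r_ge1.
have [l0 hl0] := parameters_attaining_rate d_gt0 beta_gt0 r_ge1 p_ge1 lc leta lb L0_gt0.
exists (kap * expR l0); first by rewrite mulr_gt0 ?expR_gt0.
move=> L hL; have [M [_ hM]] := hl0 L hL.
apply: (@limf_einf_right_ge _ _ _ (Num.min M 0)) => x; rewrite lt_min => /andP[xM x0].
have [L' [al [lr [L'0 L'L adm hv]]]] := hM x xM.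
apply/ereal_infP => _ [T T_est <-].
have [f hf fr] := hrisk L' x al lr L'0 adm T T_est.
apply: le_ereal_sup_tmp; eexists; first by exists f => //; exact: nikolskii_mono hf.
have D0 : 0 < delta beta r p L (expR x).
  apply: delta_gt0 => [j|]; first exact: lt_le_trans (hL j).
  by rewrite expR_gt0/= expR_lt1.
apply: (@le_trans _ _ ((delta beta r p L (expR x) `^ (- rate_exponent beta r p))%:E *
    (kap * expR (al + fine p^-1%E * lr))%:E)%E); last first.
  by apply: lee_wpmul2l => //; rewrite lee_fin powR_ge0.
rewrite -EFinM lee_fin mulrCA ler_pM2l// -[X in X `^ _](lnK D0) -expRM -expRD ler_expR.
lra.
Qed.
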